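(* Let $CK$ be either $CK_0(\mathbf R^3)$ or $CK_b(\mathbf R^3)$. For any $v\in\mathbb V_{2n}(\mathbf R^3)$ coming from the Conway polynomial, $v$ is nontrivial in $H^{2n}(CK(\mathbf R^3),D)$.
   Context: The Conway polynomial $\nabla(z)$ is defined by $\nabla(\text{unknot})=1$ and $\nabla(L_+)-\nabla(L_-)=z\nabla(L_0)$; its coefficients are Vassiliev invariants, and together they determine the Conway weight system $W_C$ on chord diagrams. The paper gives no further definition of ''coming from the Conway polynomial''; what its argument uses of such a $v\in\mathbb V_{2n}(\mathbf R^3)$ is that its value on a $2n$-singular knot with chord diagram $D'$ is $W_C(D')$. An $n$-singular knot in $M=\mathbf R^3$ (oriented) is an immersion $S^1\to M$ (with a chosen direction of $S^1$) which is an embedding except for $n$ transverse double points; $X_n$ is the set of these up to direction-preserving rigid-vertex isotopy. Each double point has a canonical positive and a canonical negative resolution. $X_n^0$: $n$-singular knots with double points ordered $1,\dots,n$, up to direction-preserving rigid-vertex isotopy respecting labels. $X_n^b$: $n$-singular knots with a base point apart from the double points, up to direction-preserving rigid-vertex isotopy preserving base points and keeping them apart from the double points; double points are ordered as first met from the base point. $CK$ denotes either $CK_0$ or $CK_b$: the cubical CW-complex with one $n$-cube for each element of $X_n^0$ (resp. $X_n^b$), whose cellular chain complex over $\mathbf Q$ is $C_n$ = the $\mathbf Q$-vector space with basis $X_n^0$ (resp. $X_n^b$), $\partial K_{1\ldots n}=\sum_{i=1}^n(-1)^{i+1}\mathrm d_iK_{1\ldots n}$, where $\mathrm d_iK$ is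 the positive minus the negative resolution at the $i$-th double point (with induced ordering/base point). $K_{1\ldots n}$ ($n\ge1$) is degenerate if $\mathrm d_iK_{1\ldots n}=0$ for some $i$; $C_n(D)\subset C_n$ is the subcomplex spanned by degenerate knots, $C_0(D)=0$. $H^n(CK,D)$ is the cohomology of $\mathrm{Hom}(C_*/C_*(D),\mathbf Q)$, with $\delta\phi=\phi\circ\partial$. A knot invariant $\phi:X_0\to\mathbf Q$ is extended to all singular knots by $\phi(K_\times)=\phi(K_+)-\phi(K_-)$ (inductively at each double point). $\mathbb V_n(M)$ is the vector space of invariants vanishing on all $(n+1)$-singular knots (Vassiliev invariants of order $\le n$). Forgetting ordering/base point, $\phi\in\mathbb V_n$ defines a cochain $\phi|_{C_n}$ on $C_n$, which is a cocycle vanishing on $C_n(D)$ and so has a class in $H^n(CK,D)$; ''$\phi$ is nontrivial in $H^n(CK,D)$'' means this class is nonzero. *)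

(* Defs.v *)
From HB Require Import structures.
From Stdlib Require Import Relation_Operators.
From mathcomp Require Import all_boot all_order all_algebra.
From mathcomp Require Import all_classical all_reals all_analysis.
From mathcomp Require Import freeg.

Set Implicit Arguments.
Unset Strict Implicit.
Unset Printing Implicit Defensive.

Import Order.TTheory GRing.Theory Num.Theory.
Import numFieldNormedType.Exports.

Local Open Scope classical_set_scope.
Local Open Scope ring_scope.
Local Open Scope quotient_scope.

(** * Cubical complexes and their cohomology relative to degenerate cubes *)

Section CubicalComplex.
Variables (X : nat -> choiceType).

(* [face i s K K'] : the face of the cube [K] in direction [i] on the side [s]
   ([true] = positive, [false] = negative) is [K']. *)
Variable face : forall n, 'I_n.+1 -> bool -> X n.+1 -> X n -> Prop.

Definition chain (n : nat) := {freeg (X n) / rat}.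

(* The face as a basis element. The value 0 is only a default: for singular
   knots the face exists and is unique. *)
Definition face_chain n (i : 'I_n.+1) (s : bool) (K : X n.+1) : chain n :=
  match pselect (exists K', face i s K K') with
  | left h => << projT1 (cid h) >>
  | right _ => 0
  end.

Definition dface n (i : 'I_n.+1) (K : X n.+1) : chain n :=
  face_chain i true K - face_chain i false K.

(* Directions are numbered from 0, so the sign (-1)^(i+1) becomes (-1)^i. *)
Definition boundary n (x : chain n.+1) : chain n :=
  fglift (fun K => \sum_(i < n.+1) (-1) ^+ i *: dface i K) x.

Definition degenerate (n : nat) : X n -> Prop :=
  match n with
  | 0 => fun=> False
  | m.+1 => fun K => exists i : 'I_m.+1, dface i K = 0
  end.

(* The span of the degenerate cubes. *)
Definition degenerate_chain n (x : chain n) : Prop :=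
  forall K, K \in dom x -> degenerate K.

(* Hom(C_n / C_n(D), Q), as the linear forms on C_n that vanish on C_n(D). *)
Definition rel_cochain n (f : chain n -> rat) : Prop :=
  scalar f /\ forall x, degenerate_chain x -> f x = 0.

Definition cocycle n (f : chain n -> rat) : Prop :=
  forall x : chain n.+1, f (boundary x) = 0.

Definition rel_coboundary (n : nat) : (chain n -> rat) -> Prop :=
  match n with
  | 0 => fun f => f =1 fun=> 0
  | m.+1 => fun f =>
      exists2 g : chain m -> rat, rel_cochain g & f =1 g \o @boundary m
  end.

(* [f] has a class in the n-th relative cohomology, and it is nonzero. *)
Definition nontrivial_class n (f : chain n -> rat) : Prop :=
  [/\ rel_cochain f, cocycle f & ~ rel_coboundary f].

Definition cochain_of n (phi : X n -> rat) : chain n -> rat :=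
  fglift (phi : X n -> rat^o).

End CubicalComplex.

(** * Quotient by the equivalence relation generated by a relation *)

Section GeneratedEquivalence.
Variables (T : Type) (r : T -> T -> Prop).

Definition generated : rel T := fun x y => `[< clos_refl_sym_trans T r x y >].

Lemma generated_refl : reflexive generated.
Proof. by move=> x; apply/asboolP; exact: rst_refl. Qed.

Lemma generated_sym : symmetric generated.
Proof. by move=> x y; apply/asboolP/asboolP; exact: rst_sym. Qed.

Lemma generated_trans : transitive generated.
Proof.
by move=> y x z /asboolP xy /asboolP yz; apply/asboolP; exact: rst_trans yz.
Qed.

End GeneratedEquivalence.

(** * Immersed circles and singular knots in 3-space *)

Section Knots.
Variable R : realType.
Local Notation R3 := 'rV[R]_3.

(* For finite dimensional [V] this is being of class C^k. *)
Fixpoint Ck (V W : normedModType R) (k : nat) (f : V -> W) : Prop :=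
  match k with
  | 0 => continuous f
  | l.+1 => (forall x, differentiable f x) /\
            forall v : V, Ck l (fun x => 'D_v f x)
  end.

Definition smooth (V W : normedModType R) (f : V -> W) : Prop :=
  forall k, Ck k f.

Definition vec3 (x y z : R) : R3 := \row_i nth 0 [:: x; y; z] i.

Definition det3 (u v w : R3) : R := \det (col_mx u (col_mx v w)).

Definition indep (u v : R3) : Prop := row_free (col_mx u v).

(* The circle is R/Z: a map from the circle is a 1-periodic map on R. *)
Definition eqZ (s t : R) : Prop := s - t \is a Num.int.

Definition immersed_circle (g : R -> R3) : Prop :=
  [/\ smooth g, forall t, g (t + 1) = g t & forall t, derive1 g t != 0].

(* [g] is an immersion of the circle which is an embedding except for n
   transverse double points, the i-th one being met at the parameters
   [q i false] and [q i true]. *)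
Definition singular n (g : R -> R3) (q : 'I_n -> bool -> R) : Prop :=
  [/\ immersed_circle g,
      forall i e j e', eqZ (q i e) (q j e') -> i = j /\ e = e',
      forall s t, g s = g t <->
        eqZ s t \/ exists i e, eqZ s (q i e) /\ eqZ t (q i (~~ e)) &
      forall i, indep (derive1 g (q i false)) (derive1 g (q i true))].

(* [q] gives parameters for the double points [p] of [g], in the same order. *)
Definition double_at n (g : R -> R3) (p : 'I_n -> R3) (q : 'I_n -> bool -> R) :=
  singular g q /\ forall i, p i = g (q i false).

(* Singular knots with ordered double points. *)
Record sknot (n : nat) := SKnot {
  curve : R -> R3;
  dpt : 'I_n -> R3;
  sknotP : exists q, double_at curve dpt q }.

Definition smooth_family (H : R -> R -> R3) : Prop :=
  smooth (fun ut : R * R => H ut.1 ut.2).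

(* A rigid-vertex isotopy: a smooth family of immersions of the circle with n
   transverse double points, whose parameters are followed by [q]. *)
Definition sing_path n (H : R -> R -> R3) (q : R -> 'I_n -> bool -> R) : Prop :=
  [/\ smooth_family H, forall i e, smooth (fun u => q u i e) &
      forall u, 0 <= u <= 1 -> singular (H u) (q u)].

Definition path_between n (K K' : sknot n) H q : Prop :=
  [/\ sing_path H q,
      H 0 = curve K /\ double_at (curve K) (dpt K) (q 0) &
      H 1 = curve K' /\ double_at (curve K') (dpt K') (q 1)].

Definition isotopic n (K K' : sknot n) : Prop :=
  exists H q, path_between K K' H q.

(* [opens i s K K' H q] : [H] leads from [K] to [K'], keeps all double points
   but the i-th, and separates its two branches in the direction [s]. With
   tangents A, B at the parameters a = q i false and b = q i true, the branch
   at a moves relative to the branch at b with velocity V, and it passes above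
   the branch at b as seen from the tip of V: the crossing created has the sign
   of det(A, B, V). Exchanging a and b does not change this sign. *)
Definition opens n (i : 'I_n.+1) (s : bool) (K : sknot n.+1) (K' : sknot n)
    (H : R -> R -> R3) (q : 'I_n.+1 -> bool -> R) : Prop :=
  [/\ smooth_family H,
      H 0 = curve K /\ double_at (curve K) (dpt K) q,
      H 1 = curve K' /\
        double_at (curve K') (dpt K') (fun j => q (fintype.lift i j)),
      forall u, 0 < u <= 1 -> singular (H u) (fun j => q (fintype.lift i j)) &
      0 < (if s then 1 else -1) *
        det3 (derive1 (curve K) (q i false)) (derive1 (curve K) (q i true))
             (derive1 (fun u => H u (q i false) - H u (q i true)) 0)].

Definition resolution n (i : 'I_n.+1) (s : bool) (K : sknot n.+1)
    (K' : sknot n) : Prop :=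
  exists H q, opens i s K K' H q.

(* Going round the circle from the base point at [t0], the double points are
   first met in the order of their labels. *)
Definition met_in_order n (t0 : R) (q : 'I_n -> bool -> R) : Prop :=
  (forall i, [/\ t0 < q i false, q i false < q i true & q i true < t0 + 1]) /\
  forall i j : 'I_n, (i < j)%N -> q i false < q j false.

(* Singular knots with a base point; the order of the double points is
   determined by the base point. *)
Record bknot (n : nat) := BKnot {
  bsknot :> sknot n;
  bpt : R3;
  bknotP : exists t0 q, [/\ curve bsknot t0 = bpt,
    double_at (curve bsknot) (dpt bsknot) q & met_in_order t0 q] }.

Definition bisotopic n (K K' : bknot n) : Prop :=
  exists H q (t : R -> R),
    [/\ path_between K K' H q, smooth t,
        forall u, 0 <= u <= 1 -> met_in_order (t u) (q u),
        curve K (t 0) = bpt K & curve K' (t 1) = bpt K'].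

Definition bresolution n (i : 'I_n.+1) (s : bool) (K : bknot n.+1)
    (K' : bknot n) : Prop :=
  exists H q t0, [/\ opens i s K K' H q, met_in_order t0 q,
    curve K t0 = bpt K & curve K' t0 = bpt K'].

HB.instance Definition _ n := gen_eqMixin (sknot n).
HB.instance Definition _ n := gen_choiceMixin (sknot n).
HB.instance Definition _ n := gen_eqMixin (bknot n).
HB.instance Definition _ n := gen_choiceMixin (bknot n).

Definition isotopy n : rel (sknot n) := generated (@isotopic n).
Definition bisotopy n : rel (bknot n) := generated (@bisotopic n).

Canonical isotopy_equiv n := EquivRel (@isotopy n)
  (generated_refl _) (generated_sym _) (@generated_trans _ _).
Canonical bisotopy_equiv n := EquivRel (@bisotopy n)
  (generated_refl _) (generated_sym _) (@generated_trans _ _).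

(* The sets X_n^0 and X_n^b. *)
Definition X0 (n : nat) : choiceType := {eq_quot (@isotopy n)}.
Definition Xb (n : nat) : choiceType := {eq_quot (@bisotopy n)}.

Definition class0 n (K : sknot n) : X0 n := \pi_({eq_quot (@isotopy n)}) K.
Definition classb n (K : bknot n) : Xb n := \pi_({eq_quot (@bisotopy n)}) K.
Definition repr0 n (x : X0 n) : sknot n := repr (x : {eq_quot (@isotopy n)}).
Definition reprb n (x : Xb n) : bknot n := repr (x : {eq_quot (@bisotopy n)}).

Definition face0 n (i : 'I_n.+1) (s : bool) (x : X0 n.+1) (y : X0 n) : Prop :=
  exists K K', [/\ class0 K = x, class0 K' = y & resolution i s K K'].
Definition faceb n (i : 'I_n.+1) (s : bool) (x : Xb n.+1) (y : Xb n) : Prop :=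
  exists K K', [/\ classb K = x, classb K' = y & bresolution i s K K'].

(** The complexes CK_0 and CK_b *)

Variant cube_complex := CK0 | CKb.

Definition cube (c : cube_complex) (n : nat) : choiceType :=
  match c with CK0 => X0 n | CKb => Xb n end.

Definition cube_face (c : cube_complex) :
    forall n, 'I_n.+1 -> bool -> cube c n.+1 -> cube c n -> Prop :=
  match c with CK0 => face0 | CKb => faceb end.

(* Forgetting the base point; the order of the double points is kept. *)
Definition forget (c : cube_complex) (n : nat) : cube c n -> X0 n :=
  match c with
  | CK0 => id
  | CKb => fun x => class0 (bsknot (reprb x))
  end.

(** * Vassiliev invariants *)

(* The extension of a knot invariant to singular knots by
   phi(K_x) = phi(K_+) - phi(K_-). Resolving the first double point is no loss:
   the result depends neither on the order nor on the double point resolved. *)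
Fixpoint extend (phi : X0 0 -> rat) (n : nat) : X0 n -> rat :=
  match n with
  | 0 => phi
  | m.+1 => fun K => cochain_of (@extend phi m) (dface (@face0) ord0 K)
  end.

Definition vassiliev (n : nat) (phi : X0 0 -> rat) : Prop :=
  forall K : X0 n.+1, extend phi K = 0.

(* phi|C_n *)
Definition vassiliev_cochain (c : cube_complex) (n : nat) (phi : X0 0 -> rat) :
    chain (cube c) n -> rat :=
  cochain_of (fun K : cube c n => extend phi (forget K)).

(** * Links and the Conway polynomial *)

(* A link with [r] components. *)
Definition is_link r (L : 'I_r -> R -> R3) : Prop :=
  (forall j, immersed_circle (L j)) /\
  forall j s k t, L j s = L k t <-> j = k /\ eqZ s t.

Record link (r : nat) := Link {
  lcurve :> 'I_r.+1 -> R -> R3;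
  linkP : is_link lcurve }.

Definition link_isotopic r (L L' : link r) : Prop :=
  exists (H : R -> 'I_r.+1 -> R -> R3) (p : 'I_r.+1 -> 'I_r.+1),
    [/\ injective p /\ forall j, smooth_family (fun u => H u j),
        forall u, 0 <= u <= 1 -> is_link (H u),
        H 0 = L & forall j, H 1 j = L' (p j)].

Definition round_circle (t : R) : R3 :=
  vec3 (cos (2 * pi * t)) (sin (2 * pi * t)) 0.

(* The points of an arc together with their positive tangent vectors; it
   determines the arc up to orientation preserving reparametrization. *)
Definition oriented_arc (g : R -> R3) (I : set R) : set (R3 * R3) :=
  [set pv | exists t l, [/\ I t, 0 < l & pv = (g t, l *: derive1 g t)]].

Definition oriented_image r (L : link r) : set (R3 * R3) :=
  \bigcup_(j : 'I_r.+1) oriented_arc (L j) setT.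

Definition box : set R3 :=
  [set p | [/\ `|p 0 0| <= 1, `|p 0 1| <= 2 & `|p 0 2%:R| <= 2]].

(* The parametrization of a ball in 3-space, preserving orientation. *)
Definition ball_chart (Psi : R3 -> R3) : Prop :=
  [/\ smooth Psi, {in box &, injective Psi} &
      forall p, box p -> 0 < \det ('J Psi p)].

Definition bsign (e : bool) : R := if e then 1 else -1.

(* The two strands of a crossing of sign [s] lie over the lines y = x and
   y = -x, both traversed in the direction of increasing x. *)
Definition crossing (g : R -> R) (s e : bool) (x : R) : R3 :=
  vec3 x (bsign e * x) (- (bsign s * bsign e * g x)).

Definition smoothing (f : R -> R) (e : bool) (x : R) : R3 :=
  vec3 x (bsign e * f x) 0.

Definition crossing_profile (g : R -> R) : Prop :=
  [/\ smooth g, forall x, 0 <= g x <= 1, 0 < g 0 &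
      forall x, 2^-1 <= `|x| -> g x = 0].

Definition smoothing_profile (f : R -> R) : Prop :=
  [/\ smooth f, forall x, `|x| <= 1 -> 0 < f x <= 1 &
      forall x, 2^-1 <= `|x| <= 1 -> f x = `|x|].

(* Inside the ball, [L] consists of the two oriented arcs [Psi \o a e]. *)
Definition looks_like r (L : link r) (Psi : R3 -> R3) (a : bool -> R -> R3) :=
  oriented_image L `&` [set pv | (Psi @` box) pv.1] =
  \bigcup_(e : bool) oriented_arc (Psi \o a e) [set x | `|x| <= 1].

Definition agree_outside r r' (L : link r) (L' : link r') (Psi : R3 -> R3) :=
  oriented_image L `\` [set pv | (Psi @` box) pv.1] =
  oriented_image L' `\` [set pv | (Psi @` box) pv.1].

Definition skein_triple r r' (Lp Lm : link r) (L0 : link r') : Prop :=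
  exists Psi g f,
    [/\ ball_chart Psi, crossing_profile g /\ smoothing_profile f,
        agree_outside Lp Lm Psi /\ agree_outside Lp L0 Psi &
        [/\ looks_like Lp Psi (crossing g true),
            looks_like Lm Psi (crossing g false) &
            looks_like L0 Psi (smoothing f)]].

Definition conway_polynomial (nabla : forall r, link r -> {poly int}) : Prop :=
  [/\ forall r (L L' : link r), link_isotopic L L' -> nabla r L = nabla r L',
      forall L : link 0, L ord0 = round_circle -> nabla 0%N L = 1 &
      forall r r' (Lp Lm : link r) (L0 : link r'), skein_triple Lp Lm L0 ->
        nabla r Lp - nabla r Lm = 'X * nabla r' L0].

Lemma knot_is_link (K : sknot 0) : is_link (fun _ : 'I_1 => curve K).
Proof.
case: (sknotP K) => q [[imm _ inj _] _]; split=> // j s k t.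
rewrite inj !ord1; split=> [[|[[]]]//|[_ h]]; by left.
Qed.

Definition knot_link (K : sknot 0) : link 0 := Link (knot_is_link K).

(* The coefficient of z^m in the Conway polynomial, as a knot invariant. *)
Definition conway_coef (nabla : forall r, link r -> {poly int}) (m : nat)
    (K : X0 0) : rat :=
  ((nabla 0%N (knot_link (repr0 K)))`_m)%:~R.

(* W_C(D) is the value of the coefficient of z^m on any m-singular knot with
   chord diagram D, so this says that [v] takes the value W_C(D) on every
   m-singular knot with chord diagram D. *)
Definition from_conway (nabla : forall r, link r -> {poly int}) (m : nat)
    (v : X0 0 -> rat) : Prop :=
  forall K : X0 m, extend v K = extend (conway_coef nabla m) K.

End Knots.

(* Main.v *)
Require Import Defs.
From Stdlib Require Import Relation_Operators.
From mathcomp Require Import all_boot all_order all_algebra.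
From mathcomp Require Import all_classical all_reals all_analysis.
From mathcomp Require Import zify ring lra.
From mathcomp Require Import freeg.

(* Let K(N, m) be the N-singular knot formed by two strands that run round an
   axis, turn about each other by m half twists and meet in N double points
   (m - N being odd, the strands close up to a single curve). It depends on N
   and m only: the double points may be slid along the strands and the base
   point does not matter. Resolving any double point of K(N, m) positively or
   negatively gives K(N - 1, m + 1) or K(N - 1, m - 1). Hence all the faces
   d_i K(2n, 1) are equal, and as their signs alternate and their number is
   even, K(2n, 1) is a cycle. On the other hand, the skein relation
   T(m + 1) - T(m - 1) = z T(m) for the Conway polynomials T(m) of the closed
   strands with m half twists shows by induction that the Conway polynomial,
   extended to singular knots, takes the value z^N T(m) on K(N, m). As T(1) = 1,
   the coefficient of z^(2n) takes the value 1 on the cycle K(2n, 1), so it is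
   not a coboundary. *)

Set Implicit Arguments.
Unset Strict Implicit.
Unset Printing Implicit Defensive.

Import Order.TTheory GRing.Theory Num.Theory.
Import numFieldNormedType.Exports.

Local Open Scope classical_set_scope.
Local Open Scope ring_scope.

(** * Smooth functions *)

(** The obstacle is that a face is only a relation between isotopy classes: [face_chain] has
    geometric content once every cube is shown to have exactly one face in each direction and on
    each side. An opening may be any smooth family whose initial velocity has the right sign, so two
    openings of the same double point cannot be compared directly; both are compared with a standard
    push-off along the normal to the two tangents. This works because singular curves form an open
    class: injectivity is stable near the diagonal, near the double points and elsewhere, and
    compactness of the parameter square makes it uniform. The same push-offs show that resolutions
    at different double points commute, hence that the extension of an invariant does not depend on
    the double point resolved.

    The explicit knots and links are given by the offset of a strand from a core circle, the second
    strand being at the opposite offset. The strands meet exactly where the offset vanishes, so an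
    isotopy is a deformation of the offset that keeps its zeros simple and neither creates nor loses
    any. *)

Section SmoothCalculus.
Variable R : realType.
Implicit Types V W : normedModType R.

Lemma eq_Ck V W k (f g : V -> W) : Ck k g -> f =1 g -> Ck k f.
Proof. by move=> Cg /funext ->. Qed.

Lemma CkSE V W k (f : V -> W) : Ck k.+1 f <->
  (forall x, differentiable f x) /\ forall v, Ck k (fun x => 'D_v f x).
Proof. by []. Qed.

Lemma CkW V W k (f : V -> W) : Ck k.+1 f -> Ck k f.
Proof.
elim: k f => [|k IH] f /CkSE[df Df].
  by move=> x; apply: differentiable_continuous.
by split=> // v; apply: IH.
Qed.

Lemma Ck_cst V W k (c : W) : Ck k (fun _ : V => c).
Proof.
elim: k c => [|k IH] c; first by move=> x; apply: cvg_cst.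
split=> [x|v]; first exact: differentiable_cst.
by apply: (eq_Ck (IH 0)) => x; rewrite (derive_cst c).
Qed.

Lemma CkD V W k (f g : V -> W) : Ck k f -> Ck k g -> Ck k (fun x => f x + g x).
Proof.
elim: k f g => [|k IH] f g.
  by move=> cf cg x; apply: continuousD; [exact: cf|exact: cg].
move=> /CkSE[df Df] /CkSE[dg Dg]; split=> [x|v]; first exact: differentiableD.
by apply: (eq_Ck (IH _ _ (Df v) (Dg v))) => x; rewrite deriveD//; exact: diff_derivable.
Qed.

Lemma CkM V k (f g : V -> R) : Ck k f -> Ck k g -> Ck k (fun x => f x * g x).
Proof.
elim: k f g => [|k IH] f g.
  by move=> cf cg x; apply: continuousM; [exact: cf|exact: cg].
move=> Cf Cg; have [df Df] := (CkSE _ _).1 Cf; have [dg Dg] := (CkSE _ _).1 Cg.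
split=> [x|v]; first exact: differentiableM.
apply: (@eq_Ck _ _ _ _ (fun x => f x * 'D_v g x + g x * 'D_v f x)) => [|x].
  by apply: CkD; apply: IH => //; exact: CkW.
by rewrite deriveM//; exact: diff_derivable.
Qed.

Lemma CkZl V W k (f : V -> R) (w : W) : Ck k f -> Ck k (fun x => f x *: w).
Proof.
elim: k f => [|k IH] f.
  by move=> cf x; apply: (continuousZr_tmp (cf x)).
move=> /CkSE[df Df]; split=> [x|v]; first exact: differentiableZl.
apply: (eq_Ck (IH _ (Df v))) => x.
by rewrite (deriveE v (differentiableZl w (df x))) (deriveE v (df x)) diffZl.
Qed.

Lemma Ck_comp V k (f : R -> R) (g : V -> R) : Ck k f -> Ck k g -> Ck k (f \o g).
Proof.
elim: k f g => [|k IH] f g.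
  by move=> cf cg x; apply: continuous_comp; [exact: cg|exact: cf].
move=> Cf Cg; have [df Df] := (CkSE _ _).1 Cf; have [dg Dg] := (CkSE _ _).1 Cg.
split=> [x|v]; first exact: differentiable_comp.
apply: (@eq_Ck _ _ _ _ (fun x => 'D_v g x * (fun y => 'D_1 f y) (g x))) => [|x].
  by apply: CkM => //; apply: (IH (fun y => 'D_1 f y)) => //; exact: CkW.
rewrite (deriveE v (differentiable_comp (dg x) (df (g x)))).
rewrite (deriveE v (dg x)) (deriveE (1 : R) (df (g x))) diff_comp//=.
by rewrite -[RHS]/('d g x v *: _) -linearZ /= [_ *: 1]mulr1.
Qed.

(** Families are functions of the isotopy parameter and the time, hence outer maps on [R * R]. Their
    derivatives along (1, 0) and (0, 1) are again such maps, so the chain rule closes the induction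
    on [k]. *)
Lemma Ck_comp2 V k (f : R * R -> R) (g h : V -> R) :
  Ck k f -> Ck k g -> Ck k h -> Ck k (fun x => f (g x, h x)).
Proof.
elim: k f g h => [|k IH] f g h.
  move=> cf cg ch x; apply: (@continuous_comp _ _ _ (fun x => (g x, h x)) f).
    exact: (cvg_pair (cg x) (ch x)).
  exact: cf.
move=> Cf Cg Ch; have [df Df] := (CkSE _ _).1 Cf; have [dg Dg] := (CkSE _ _).1 Cg.
have [dh Dh] := (CkSE _ _).1 Ch.
have dgh x : differentiable (fun x => (g x, h x)) x by exact: differentiable_pair.
have dc x : differentiable (f \o (fun x => (g x, h x))) x.
  exact: differentiable_comp.
split=> [x|v]; first exact: dc.
apply: (@eq_Ck _ _ _ _ (fun x =>
    'D_v g x * (fun y => 'D_(1, 0) f y) (g x, h x)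
  + 'D_v h x * (fun y => 'D_(0, 1) f y) (g x, h x))) => [|x].
  apply: CkD; apply: CkM => //.
    by apply: (IH (fun y => 'D_(1, 0) f y)) => //; exact: CkW.
  by apply: (IH (fun y => 'D_(0, 1) f y)) => //; exact: CkW.
rewrite -[LHS]/('D_v (f \o (fun x => (g x, h x))) x).
rewrite (deriveE v (dc x)) (deriveE v (dg x)) (deriveE v (dh x)).
rewrite (deriveE _ (df _)) (deriveE _ (df _)) diff_comp//= diff_pair//=.
rewrite -[X in _ = X + _]/('d g x v *: _) -[X in _ = _ + X]/('d h x v *: _).
rewrite -!linearZ -linearD /=; congr ('d f _ _).
by apply: injective_projections => /=; rewrite /= ?scaler0 ?addr0 ?add0r // [_ *: _]mulr1.
Qed.

Lemma CkL V W W' k (L : {linear W -> W'}) (f : V -> W) : continuous L ->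
  Ck k f -> Ck k (fun x => L (f x)).
Proof.
move=> cL; elim: k f => [|k IH] f.
  by move=> cf x; apply: (@continuous_comp _ _ _ f L); [exact: cf|exact: cL].
move=> /CkSE[df Df].
have dL y : differentiable L y by exact: linear_differentiable.
split=> [x|v]; first by apply: (@differentiable_comp _ _ _ _ f L).
apply: (eq_Ck (IH _ (Df v))) => x; rewrite -[LHS]/('D_v (L \o f) x).
rewrite (deriveE v (differentiable_comp (df x) (dL (f x)))) (deriveE v (df x)).
by rewrite diff_comp//= diff_lin.
Qed.

Lemma smooth_derive V W (f : V -> W) v : smooth f -> smooth (fun x => 'D_v f x).
Proof. by move=> Cf k; have /CkSE[_] := Cf k.+1; exact. Qed.

Lemma smooth_differentiable V W (f : V -> W) x : smooth f -> differentiable f x.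
Proof. by move=> Cf; have /CkSE[+ _] := Cf 1%N; exact. Qed.

Lemma smooth_derivable V W (f : V -> W) x v : smooth f -> derivable f x v.
Proof. by move=> Cf; apply: diff_derivable; exact: smooth_differentiable. Qed.

Lemma smooth_continuous V W (f : V -> W) : smooth f -> continuous f.
Proof. by move=> Cf; exact: (Cf 0%N). Qed.

Lemma smooth_cst V W (c : W) : smooth (fun _ : V => c).
Proof. by move=> k; exact: Ck_cst. Qed.

Lemma smoothD V W (f g : V -> W) :
  smooth f -> smooth g -> smooth (fun x => f x + g x).
Proof. by move=> Cf Cg k; exact: CkD. Qed.

Lemma smoothM V (f g : V -> R) :
  smooth f -> smooth g -> smooth (fun x => f x * g x).
Proof. by move=> Cf Cg k; exact: CkM. Qed.

Lemma smoothZl V W (f : V -> R) (w : W) : smooth f -> smooth (fun x => f x *: w).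
Proof. by move=> Cf k; exact: CkZl. Qed.

Lemma smooth_comp V (f : R -> R) (g : V -> R) :
  smooth f -> smooth g -> smooth (fun x => f (g x)).
Proof. by move=> Cf Cg k; exact: Ck_comp. Qed.

Lemma smooth_comp2 V (f : R * R -> R) (g h : V -> R) :
  smooth f -> smooth g -> smooth h -> smooth (fun x => f (g x, h x)).
Proof. by move=> Cf Cg Ch k; exact: Ck_comp2. Qed.

Lemma smoothL V W W' (L : {linear W -> W'}) (f : V -> W) : continuous L ->
  smooth f -> smooth (fun x => L (f x)).
Proof. by move=> cL Cf k; exact: CkL. Qed.

Lemma smoothN V (f : V -> R) : smooth f -> smooth (fun x => - f x).
Proof.
move=> Cf k; apply: (eq_Ck (g := fun x => (-1) * f x)) => [|x].
  by apply: CkM => //; exact: Ck_cst.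
by rewrite mulN1r.
Qed.

Lemma smoothB V (f g : V -> R) :
  smooth f -> smooth g -> smooth (fun x => f x - g x).
Proof. by move=> Cf Cg; apply: smoothD => //; exact: smoothN. Qed.

Lemma smooth_sum V W (I : Type) (r : seq I) (P : pred I) (f : I -> V -> W) :
  (forall i, P i -> smooth (f i)) -> smooth (fun x => \sum_(i <- r | P i) f i x).
Proof.
move=> Cf k; elim: r => [|i r IH].
  by apply: (eq_Ck (Ck_cst _ _ (0 : W))) => x; rewrite big_nil.
have [Pi|Pi] := boolP (P i).
  by apply: (eq_Ck (CkD (Cf i Pi k) IH)) => x; rewrite big_cons Pi.
by apply: (eq_Ck IH) => x; rewrite big_cons (negbTE Pi).
Qed.

Lemma smooth_prod V (I : Type) (r : seq I) (P : pred I) (f : I -> V -> R) :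
  (forall i, P i -> smooth (f i)) -> smooth (fun x => \prod_(i <- r | P i) f i x).
Proof.
move=> Cf k; elim: r => [|i r IH].
  by apply: (eq_Ck (Ck_cst _ _ (1 : R))) => x; rewrite big_nil.
have [Pi|Pi] := boolP (P i).
  by apply: (eq_Ck (CkM (Cf i Pi k) IH)) => x; rewrite big_cons Pi.
by apply: (eq_Ck IH) => x; rewrite big_cons (negbTE Pi).
Qed.

Lemma smooth_linear V W (L : {linear V -> W}) : continuous L -> smooth L.
Proof.
move=> cL [//|k]; apply/CkSE; split=> [x|v]; first exact: linear_differentiable.
apply: (eq_Ck (Ck_cst _ _ (L v))) => x.
by rewrite (deriveE v (@linear_differentiable _ _ _ L x cL)) diff_lin.
Qed.

Lemma smooth_id V : smooth (fun x : V => x).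
Proof. by apply: (@smooth_linear _ _ idfun) => x; exact: cvg_id. Qed.

Lemma smooth_fst V W : smooth (@fst V W).
Proof. by apply: (@smooth_linear _ _ fst) => x; exact: cvg_fst. Qed.

Lemma smooth_snd V W : smooth (@snd V W).
Proof. by apply: (@smooth_linear _ _ snd) => x; exact: cvg_snd. Qed.

Lemma smooth_fst1 V V' W : smooth (fun z : (V * V') * W => z.1.1).
Proof.
apply: (@smoothL _ _ _ (@fst V V')); last exact: smooth_fst.
by move=> x; exact: cvg_fst.
Qed.

Lemma smooth_snd1 V V' W : smooth (fun z : (V * V') * W => z.1.2).
Proof.
apply: (@smoothL _ _ _ (@snd V V')); last exact: smooth_fst.
by move=> x; exact: cvg_snd.
Qed.

Lemma smooth_sin : smooth (@sin R).
Proof.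
suff H k : Ck k (@sin R) /\ Ck k (@cos R) by move=> k; have [] := H k.
elim: k => [|k [IHs IHc]].
  by split; [exact: continuous_sin|exact: continuous_cos].
have ds (x : R) : differentiable (@sin R) x.
  by apply/derivable1_diffP; exact: derivable_sin.
have dc (x : R) : differentiable (@cos R) x.
  by apply/derivable1_diffP; exact: derivable_cos.
split; apply/CkSE; split=> // v.
  apply: (@eq_Ck _ _ _ _ (fun x => cos x * v)) => [|x].
    by apply: CkM => //; exact: Ck_cst.
  rewrite deriveE// deriv1E; last exact: derivable_sin.
  by rewrite derive1E derive_val /= mulrC.
apply: (@eq_Ck _ _ _ _ (fun x => (- sin x) * v)) => [|x].
  apply: CkM; last exact: Ck_cst.
  apply: (@eq_Ck _ _ _ _ (fun x => (-1) * sin x)) => [|x]; last by rewrite mulN1r.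
  by apply: CkM => //; exact: Ck_cst.
rewrite deriveE// deriv1E; last exact: derivable_cos.
by rewrite derive1E derive_val /= mulrC.
Qed.

Lemma smooth_cos : smooth (@cos R).
Proof.
move=> k; apply: (eq_Ck (g := fun x => sin (x + pi / 2))) => [|x].
  apply: (smooth_comp smooth_sin); apply: smoothD; first exact: smooth_id.
  exact: smooth_cst.
by rewrite sinDpihalf.
Qed.

End SmoothCalculus.

(** * Smooth maps into 3-space, square roots and flat functions *)

Section SmoothFunctions.
Variable R : realType.
Implicit Types V W : normedModType R.

Lemma smooth_coord V n (F : V -> 'rV[R]_n) i :
  smooth F -> smooth (fun x => F x 0 i).
Proof.
move=> + k; elim: k F => [|k IH] F CF.
  move=> x; apply: (@continuous_comp _ _ _ F (fun M : 'rV[R]_n => M 0 i)).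
    exact: smooth_continuous.
  exact: coord_continuous.
apply/CkSE; split=> [x|v].
  apply: (@differentiable_comp _ _ _ _ F (fun M : 'rV[R]_n => M 0 i)).
    exact: smooth_differentiable.
  exact: differentiable_coord.
apply: (eq_Ck (IH _ (smooth_derive v CF))) => x.
by rewrite derive_mx ?mxE//; exact: smooth_derivable.
Qed.

Lemma smooth_row V n (F : V -> 'rV[R]_n.+1) :
  (forall i, smooth (fun x => F x 0 i)) -> smooth F.
Proof.
move=> CF k; have H := @smooth_sum _ _ _ _ (index_enum 'I_n.+1) xpredT
  (fun i x => F x 0 i *: delta_mx 0 i : 'rV[R]_n.+1)
  (fun i _ => smoothZl (delta_mx 0 i) (CF i)).
by apply: (eq_Ck (H k)) => x; rewrite -row_sum_delta.
Qed.

Lemma vec3E (x y z : R) : [/\ (vec3 x y z) 0 0 = x, (vec3 x y z) 0 1 = y &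
  (vec3 x y z) 0 2%:R = z].
Proof. by split; rewrite mxE. Qed.

Lemma ord3P (P : 'I_3 -> Prop) : P 0 -> P 1 -> P 2%:R -> forall i, P i.
Proof.
move=> P0 P1 P2 [[|[|[|//]]] h].
- by rewrite (_ : Ordinal h = 0)//; exact: val_inj.
- by rewrite (_ : Ordinal h = 1)//; exact: val_inj.
- by rewrite (_ : Ordinal h = 2%:R)//; exact: val_inj.
Qed.

Lemma smooth_vec3 V (f g h : V -> R) :
  smooth f -> smooth g -> smooth h -> smooth (fun x => vec3 (f x) (g x) (h x)).
Proof.
move=> Cf Cg Ch; apply: smooth_row; apply: ord3P => k.
- by apply: (eq_Ck (Cf k)) => x; have [->] := vec3E (f x) (g x) (h x).
- by apply: (eq_Ck (Cg k)) => x; have [_ ->] := vec3E (f x) (g x) (h x).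
- by apply: (eq_Ck (Ch k)) => x; have [_ _ ->] := vec3E (f x) (g x) (h x).
Qed.

Lemma smoothZ3 V (a : V -> R) (F : V -> 'rV[R]_3) :
  smooth a -> smooth F -> smooth (fun x => a x *: F x).
Proof.
move=> Ca CF; apply: smooth_row => i k.
apply: (eq_Ck (CkM (Ca k) (smooth_coord i CF k))) => x.
by rewrite mxE.
Qed.

Lemma smooth_comp2_3 V (F : R * R -> 'rV[R]_3) (a b : V -> R) :
  smooth F -> smooth a -> smooth b -> smooth (fun x => F (a x, b x)).
Proof.
move=> CF Ca Cb; apply: smooth_row => i.
exact: (smooth_comp2 (smooth_coord i CF)).
Qed.

Lemma smooth_comp_3 V (F : R -> 'rV[R]_3) (a : V -> R) :
  smooth F -> smooth a -> smooth (fun x => F (a x)).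
Proof.
move=> CF Ca; apply: smooth_row => i.
exact: (smooth_comp (smooth_coord i CF)).
Qed.

Lemma Ck_is_derive k (f f' : R -> R) :
  (forall x : R, is_derive x 1 f (f' x)) -> Ck k f' -> Ck k.+1 f.
Proof.
move=> ff' Cf'; have df x : differentiable f x.
  by apply/derivable1_diffP; exact: ex_derive.
apply/CkSE; split=> // v.
apply: (@eq_Ck _ _ _ _ _ (fun x => f' x * v)) => [|x].
  by apply: CkM => //; exact: Ck_cst.
rewrite deriveE// deriv1E; last exact: ex_derive.
by rewrite derive1E derive_val /= mulrC.
Qed.

Lemma CkV V k (f : V -> R) : (forall x, f x != 0) -> Ck k f ->
  Ck k (fun x => (f x)^-1).
Proof.
move=> f0; elim: k => [|k IH] Cf.
  by move=> x; apply: (@continuousV _ _ f x) => //; exact: Cf.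
have /CkSE[df Df] := Cf; apply/CkSE; split=> [x|v].
  by apply: differentiableV.
apply: (@eq_Ck _ _ _ _ _ (fun x => (-1) * ((f x)^-1 * (f x)^-1) * 'D_v f x)).
  have CVk := IH (CkW Cf).
  apply: CkM; last exact: Df.
  by apply: CkM; [exact: Ck_cst|exact: CkM].
move=> x; rewrite deriveV//; last exact: diff_derivable.
by rewrite -[_ *: _]/(_ * _) expr2 invfM mulN1r.
Qed.

Lemma smoothV V (f : V -> R) : (forall x, f x != 0) -> smooth f ->
  smooth (fun x => (f x)^-1).
Proof. by move=> f0 Cf k; exact: CkV. Qed.

Lemma smooth_sqrt V (f : V -> R) : (forall x, 0 < f x) -> smooth f ->
  smooth (fun x => Num.sqrt (f x)).
Proof.
move=> f0 Cf.
have ds x : differentiable (@Num.sqrt R) (f x).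
  by apply/derivable1_diffP; apply: ex_derive; exact: is_derive1_sqrt.
have df x : differentiable f x by exact: smooth_differentiable.
elim=> [|k IH].
  move=> x; apply: (@continuous_comp _ _ _ f Num.sqrt).
    exact: smooth_continuous.
  exact: sqrt_continuous.
have CV : Ck k (fun x => (2 * Num.sqrt (f x))^-1).
  apply: CkV => [x|]; first by rewrite mulf_neq0// gt_eqF// sqrtr_gt0.
  by apply: CkM => //; exact: Ck_cst.
apply/CkSE; split=> [x|v]; first exact: differentiable_comp.
apply: (@eq_Ck _ _ _ _ _ (fun x => (2 * Num.sqrt (f x))^-1 * 'D_v f x)) => [|x].
  by apply: CkM => //; exact: smooth_derive.
have dc : differentiable (Num.sqrt \o f) x by exact: differentiable_comp.
rewrite -[LHS]/('D_v (Num.sqrt \o f) x) (deriveE v dc) (deriveE v (df x)).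
rewrite diff_comp//= deriv1E; last exact/derivable1_diffP.
by rewrite derive1E derive_sqrt// [RHS]mulrC.
Qed.

Lemma smooth_atan : smooth (@atan R).
Proof.
case=> [|k]; first exact: continuous_atan.
apply: (@Ck_is_derive _ _ (fun x => (1 + x ^+ 2)^-1)); apply: smoothV => [x|].
  by rewrite gt_eqF// ltr_wpDr// sqr_ge0.
apply: smoothD; first exact: smooth_cst.
by apply: smoothM; exact: smooth_id.
Qed.

(* [flat 0] is the function exp(-1/x), flat at 0; the others occur in its
   derivatives. *)
Definition flat n (x : R) := if 0 < x then x^-1 ^+ n * expR (- x^-1) else 0.

Lemma flat_le n x : 0 <= flat n x <= n.+1`!%:R * `|x|.
Proof.
rewrite /flat; case: ltrP => [x0|_]; last by rewrite lexx mulr_ge0.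
have y0 : 0 < x^-1 by rewrite invr_gt0.
rewrite mulr_ge0 ?expR_ge0 ?exprn_ge0 ?(ltW y0)//=.
rewrite expRN ler_pdivrMr ?expR_gt0// (gtr0_norm x0).
have f0 : 0 < n.+1`!%:R :> R by rewrite ltr0n fact_gt0.
have := expR_ge1Dxn n (ltW y0); set e := expR _ => h.
have {h} : x^-1 ^+ n.+1 / n.+1`!%:R <= e by lra.
rewrite ler_pdivrMr// => h.
rewrite (_ : x^-1 ^+ n = x * x^-1 ^+ n.+1); last first.
  by rewrite exprS mulrA mulfV ?mul1r// gt_eqF.
rewrite [X in _ <= X](_ : _ = x * (e * n.+1`!%:R)); last by ring.
by rewrite ler_pM2l.
Qed.

Lemma is_derive_flat n (x : R) :
  is_derive x 1 (flat n) (flat n.+2 x - n%:R * flat n.+1 x).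
Proof.
have [x0|x0|->] := ltrgt0P x.
- apply: (@near_eq_is_derive _ _ _
    ((fun y : R => y^-1) ^+ n * (fun y : R => expR (- y^-1)))).
    near=> y; rewrite /flat ifT; first by rewrite exprfctE.
    by near: y; exact: lt_nbhsr.
  have xn0 : x != 0 by rewrite gt_eqF.
  have dV : is_derive x 1 (fun y : R => y^-1) (- (x ^- 2)).
    apply: DeriveDef; first by apply: derivableV => //; exact: derivable_id.
    by rewrite deriveV// derive_id -[LHS]/(_ * _) mulr1.
  have dN : is_derive x 1 (fun y : R => - y^-1) (x ^- 2).
    by apply: is_derive_eq; rewrite opprK.
  have dE : is_derive x 1 (fun y : R => expR (- y^-1)) (expR (- x^-1) * x ^- 2).
    exact: is_derive1_comp.
  apply: (is_derive_eq (is_deriveM (is_deriveX n dV) dE)).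
  rewrite -[_ *: _ + _]/(_ * _ + _ * (_ * _)) /flat x0.
  rewrite exprfctE -!exprVn; set z := x^-1; set e := expR _.
  by case: n => [|n]; rewrite /= !exprS; ring.
- apply: (@near_eq_is_derive _ _ _ (cst 0)).
    by near=> y; rewrite /flat ltNge ltW//=; near: y; exact: lt_nbhsl.
  rewrite /flat !ltNge !ltW//= mulr0 subr0; exact: is_derive_cst.
- have -> : flat n.+2 0 - n%:R * flat n.+1 0 = 0 by rewrite /flat ltxx mulr0 subr0.
  suff H : h^-1 *: ((flat n \o shift 0) (h *: 1) - flat n 0) @[h --> 0^'] --> (0:R).
    by apply: DeriveDef; [apply/cvg_ex; exists 0|exact: (cvg_lim _ H)].
  have f0 : 0 < n.+2`!%:R :> R by rewrite ltr0n fact_gt0.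
  apply/cvgr0Pnorm_lt => e e0; near=> h.
  have h0 : h != 0 by near: h; exact: nbhs_dnbhs_neq.
  rewrite /= /flat ltxx subr0 addr0 [h *: 1]mulr1 -[_ *: _]/(_ * _).
  (* For h > 0 the difference quotient at 0 is [flat n.+1 h], for h < 0 it is 0; both tend to 0 by
     [flat_le]. *)
  apply: (@le_lt_trans _ _ (flat n.+1 h)).
    rewrite /flat; case: ltrP => hp; last by rewrite mulr0 normr0.
    by rewrite mulrA -exprS ger0_norm// mulr_ge0 ?expR_ge0 ?exprn_ge0 ?invr_ge0 ?(ltW hp).
  have /andP[_ /le_lt_trans] := flat_le n.+1 h; apply.
  rewrite mulrC -ltr_pdivlMr//; near: h.
  by apply: dnbhs0_lt; rewrite divr_gt0.
Unshelve. all: by end_near. Qed.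

Lemma smooth_flat n : smooth (flat n).
Proof.
move=> k; elim: k n => [|k IH] n.
  move=> x; apply/differentiable_continuous/derivable1_diffP.
  exact: (@ex_derive _ _ _ _ _ _ _ (is_derive_flat n x)).
apply: (@Ck_is_derive _ _ _ (is_derive_flat n)).
apply: (@eq_Ck _ _ _ _ _ (fun x => flat n.+2 x + (- n%:R) * flat n.+1 x)).
  by apply: CkD => //; apply: CkM => //; exact: Ck_cst.
by move=> x; rewrite mulNr.
Qed.

End SmoothFunctions.

(** * Three-dimensional vectors *)

Section Vectors.
Variable R : realType.
Local Notation R3 := 'rV[R]_3.

Lemma eqZP (s t : R) : eqZ s t <-> exists k : int, s = t + k%:~R.
Proof.
split=> [/intrP[k stk]|[k ->]]; first by exists k; rewrite -stk addrC subrK.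
by rewrite /eqZ addrAC subrr add0r intr_int.
Qed.

Lemma eqZ_refl (s : R) : eqZ s s.
Proof. by apply/eqZP; exists 0; rewrite addr0. Qed.

Lemma eqZ_sym (s t : R) : eqZ s t -> eqZ t s.
Proof. by rewrite /eqZ -(opprB s t) rpredN. Qed.

Lemma eqZ_trans (t s r : R) : eqZ s t -> eqZ t r -> eqZ s r.
Proof.
move=> /eqZP[k ->] /eqZP[l ->]; apply/eqZP; exists (l + k).
by rewrite intrD addrA.
Qed.

Lemma eqZ_addz (s t : R) (k l : int) :
  eqZ (s + k%:~R) (t + l%:~R) -> eqZ s t.
Proof.
move=> h; apply: (@eqZ_trans (s + k%:~R)).
  by apply/eqZ_sym/eqZP; exists k.
by apply: (eqZ_trans h); apply/eqZP; exists l.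
Qed.

Lemma periodicZ (T : Type) (g : R -> T) : (forall t, g (t + 1) = g t) ->
  forall t (k : int), g (t + k%:~R) = g t.
Proof.
move=> g1 t k; elim/int_rect: k t => [|n IH|n IH] t; first by rewrite addr0.
  by rewrite intS intrD addrCA addrC g1 IH.
rewrite -[LHS]g1 (_ : t + _ + 1 = t + (- n%:Z)%:~R) ?IH//.
by rewrite -addrA -[1]/(1%:~R) -intrD; congr (_ + _%:~R); rewrite intS; ring.
Qed.

Lemma det_mx33 (A : 'M[R]_3) : \det A =
  A 0 0 * (A 1 1 * A 2%:R 2%:R - A 1 2%:R * A 2%:R 1)
  - A 0 1 * (A 1 0 * A 2%:R 2%:R - A 1 2%:R * A 2%:R 0)
  + A 0 2%:R * (A 1 0 * A 2%:R 1 - A 1 1 * A 2%:R 0).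
Proof.
rewrite (expand_det_row _ 0) !big_ord_recl big_ord0.
rewrite /cofactor !(expand_det_row _ 0) !big_ord_recl !big_ord0.
rewrite /cofactor !det_mx11 !mxE /=.
pose a i j := A (inord i) (inord j).
have E i j : A i j = a (i : nat) (j : nat) by rewrite /a !inord_val.
by rewrite !E /= /bump /=; ring.
Qed.

Lemma det3E (u v w : R3) : det3 u v w =
  u 0 0 * (v 0 1 * w 0 2%:R - v 0 2%:R * w 0 1)
  - u 0 1 * (v 0 0 * w 0 2%:R - v 0 2%:R * w 0 0)
  + u 0 2%:R * (v 0 0 * w 0 1 - v 0 1 * w 0 0).
Proof.
have E0 (i : 'I_(1 + (1 + 1))) j : i = 0%N :> nat ->
    col_mx u (col_mx v w) i j = u 0 j.
  by move=> i0; rewrite (_ : i = lshift _ 0) ?col_mxEu//; exact: val_inj.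
have E1 (i : 'I_(1 + (1 + 1))) j : i = 1%N :> nat ->
    col_mx u (col_mx v w) i j = v 0 j.
  move=> i1; rewrite (_ : i = rshift 1 (lshift 1 (0 : 'I_1))).
    by rewrite col_mxEd col_mxEu.
  exact: val_inj.
have E2 (i : 'I_(1 + (1 + 1))) j : i = 2%N :> nat ->
    col_mx u (col_mx v w) i j = w 0 j.
  move=> i2; rewrite (_ : i = rshift 1 (rshift 1 (0 : 'I_1))) ?col_mxEd//.
  exact: val_inj.
rewrite /det3 (det_mx33 (col_mx u (col_mx v w))).
by rewrite !(E0 0)// !(E1 1)// !(E2 2%:R).
Qed.

Definition cross (u v : R3) : R3 :=
  vec3 (u 0 1 * v 0 2%:R - u 0 2%:R * v 0 1)
       (u 0 2%:R * v 0 0 - u 0 0 * v 0 2%:R)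
       (u 0 0 * v 0 1 - u 0 1 * v 0 0).

Lemma det3_cross (u v : R3) : det3 u v (cross u v) =
  (cross u v) 0 0 ^+ 2 + (cross u v) 0 1 ^+ 2 + (cross u v) 0 2%:R ^+ 2.
Proof.
rewrite det3E /cross; set c := vec3 _ _ _; have [-> -> ->] := vec3E
  (u 0 1 * v 0 2%:R - u 0 2%:R * v 0 1) (u 0 2%:R * v 0 0 - u 0 0 * v 0 2%:R)
  (u 0 0 * v 0 1 - u 0 1 * v 0 0).
ring.
Qed.

Lemma vecP (u v : R3) : u 0 0 = v 0 0 -> u 0 1 = v 0 1 -> u 0 2%:R = v 0 2%:R ->
  u = v.
Proof. by move=> h0 h1 h2; apply/rowP; apply: ord3P. Qed.

(* Cramer's rule *)
Lemma det3_inj (u v w : R3) (x y z : R) : det3 u v w != 0 ->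
  x *: u + y *: v + z *: w = 0 -> [/\ x = 0, y = 0 & z = 0].
Proof.
move=> d0 /rowP h; have := (h 0, h 1, h 2%:R); rewrite !mxE => -[[h0 h1] h2].
have Ex : x * det3 u v w = 0.
  transitivity ((x * u 0 0 + y * v 0 0 + z * w 0 0) *
      (v 0 1 * w 0 2%:R - v 0 2%:R * w 0 1)
    - (x * u 0 1 + y * v 0 1 + z * w 0 1) *
      (v 0 0 * w 0 2%:R - v 0 2%:R * w 0 0)
    + (x * u 0 2%:R + y * v 0 2%:R + z * w 0 2%:R) *
      (v 0 0 * w 0 1 - v 0 1 * w 0 0)); first by rewrite det3E; ring.
  by rewrite h0 h1 h2 !mul0r subrr addr0.
have Ey : y * det3 u v w = 0.
  transitivity ((x * u 0 0 + y * v 0 0 + z * w 0 0) *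
      (w 0 1 * u 0 2%:R - w 0 2%:R * u 0 1)
    - (x * u 0 1 + y * v 0 1 + z * w 0 1) *
      (w 0 0 * u 0 2%:R - w 0 2%:R * u 0 0)
    + (x * u 0 2%:R + y * v 0 2%:R + z * w 0 2%:R) *
      (w 0 0 * u 0 1 - w 0 1 * u 0 0)); first by rewrite det3E; ring.
  by rewrite h0 h1 h2 !mul0r subrr addr0.
have Ez : z * det3 u v w = 0.
  transitivity ((x * u 0 0 + y * v 0 0 + z * w 0 0) *
      (u 0 1 * v 0 2%:R - u 0 2%:R * v 0 1)
    - (x * u 0 1 + y * v 0 1 + z * w 0 1) *
      (u 0 0 * v 0 2%:R - u 0 2%:R * v 0 0)
    + (x * u 0 2%:R + y * v 0 2%:R + z * w 0 2%:R) *
      (u 0 0 * v 0 1 - u 0 1 * v 0 0)); first by rewrite det3E; ring.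
  by rewrite h0 h1 h2 !mul0r subrr addr0.
move/eqP: Ex; rewrite mulf_eq0 (negbTE d0) orbF => /eqP->.
move/eqP: Ey; rewrite mulf_eq0 (negbTE d0) orbF => /eqP->.
by move/eqP: Ez; rewrite mulf_eq0 (negbTE d0) orbF => /eqP->.
Qed.

Lemma indepP (u v : R3) :
  indep u v <-> forall x y, x *: u + y *: v = 0 -> x = 0 /\ y = 0.
Proof.
have E (a : 'rV[R]_(1 + 1)) : a *m col_mx u v =
    a 0 (lshift 1 0) *: u + a 0 (rshift 1 0) *: v.
  rewrite -[a in LHS]hsubmxK mul_row_col [lsubmx a]mx11_scalar.
  by rewrite [rsubmx a]mx11_scalar !mul_scalar_mx !mxE.
split=> [/row_freeP[B uvB] x y xy|h].
  pose a : 'rV[R]_(1 + 1) := row_mx x%:M y%:M.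
  have a0 : a = 0.
    rewrite -[a]mulmx1 -uvB mulmxA E /a row_mxEl row_mxEr !mxE !eqxx !mulr1n.
    by rewrite xy mul0mx.
  have := (congr1 (fun M : 'rV_(1 + 1) => M 0 (lshift 1 0)) a0,
           congr1 (fun M : 'rV_(1 + 1) => M 0 (rshift 1 0)) a0).
  by rewrite /= /a row_mxEl row_mxEr !mxE !eqxx !mulr1n => -[-> ->].
apply/inj_row_free => a; rewrite E => /h[a0 a1].
apply/rowP => i; rewrite mxE; case: (split_ordP i) => j ->; by rewrite ord1.
Qed.

Lemma det3_indep (u v w : R3) : det3 u v w != 0 -> indep u v.
Proof.
move=> d0; apply/indepP => x y xy.
have [] := @det3_inj u v w x y 0 d0; last by [].
by rewrite xy scale0r addr0.
Qed.

Lemma indep_cross (u v : R3) : indep u v -> 0 < det3 u v (cross u v).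
Proof.
move=> /indepP uv; rewrite det3_cross lt_def !addr_ge0 ?sqr_ge0// andbT.
apply/negP; rewrite !paddr_eq0 ?addr_ge0 ?sqr_ge0// !sqrf_eq0.
rewrite /cross; have [-> -> ->] := vec3E
  (u 0 1 * v 0 2%:R - u 0 2%:R * v 0 1) (u 0 2%:R * v 0 0 - u 0 0 * v 0 2%:R)
  (u 0 0 * v 0 1 - u 0 1 * v 0 0).
rewrite !subr_eq0 => /andP[/andP[/eqP c0 /eqP c1] /eqP c2].
have h j : v 0 j = 0.
  suff : v 0 j *: u + (- u 0 j) *: v = 0 by move=> /uv[].
  apply/rowP; apply: ord3P; rewrite !mxE; move: j; apply: ord3P; try ring;
  rewrite ?(mulrC (v _ _)) ?c0 ?c1 ?c2; try ring;
  rewrite -?c0 -?c1 -?c2; ring.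
have v0 : v = 0 by apply/rowP => j; rewrite h mxE.
have [|_ /eqP] := uv 0 1; last by rewrite oner_eq0.
by rewrite v0 scale0r scaler0 addr0.
Qed.

End Vectors.

(** * Singular curves are stable under small perturbations *)

Section Stability.
Variable R : realType.
Local Notation R3 := 'rV[R]_3.

Lemma is_derive_coord (f : R -> R3) (x : R) i : derivable f x 1 ->
  is_derive x 1 (fun t => f t 0 i) (derive1 f x 0 i).
Proof.
move=> df; apply: DeriveDef; first exact: ((derivable_mxP f x 1).1 df).
by rewrite derive1E derive_mx// mxE.
Qed.

(** The intermediate point depends on the coordinate [i], so a vector increment is (x - a) times a
    row of derivatives taken at three different points, as in [chord_good]. *)
Lemma MVT_coord (f : R -> R3) (a x : R) i : (forall t, derivable f t 1) ->
  exists2 c, (a <= c <= x) || (x <= c <= a) &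
    f x 0 i - f a 0 i = derive1 f c 0 i * (x - a).
Proof.
move=> df; have cf : continuous (fun t => f t 0 i).
  move=> t; apply/differentiable_continuous/derivable1_diffP.
  exact: (@ex_derive _ _ _ _ _ _ _ (is_derive_coord i (df t))).
have [ax|xa] := leP a x.
  have [c /[!in_itv]/= /andP[ac cx] ->] := @MVT_segment _ (fun t => f t 0 i) _ a x ax
    (fun t _ => is_derive_coord i (df t)) (continuous_subspaceT cf).
  by exists c => //; rewrite ac cx.
have [c /[!in_itv]/= /andP[xc ca] h] := @MVT_segment _ (fun t => f t 0 i) _ x a
  (ltW xa) (fun t _ => is_derive_coord i (df t)) (continuous_subspaceT cf).
exists c; first by rewrite xc ca orbT.
by rewrite -[LHS]opprB h -mulrN opprB.
Qed.

Lemma between_ball (a c x y d : R) : (a <= c <= x) || (x <= c <= a) ->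
  `|a - y| < d -> `|x - y| < d -> `|c - y| < d.
Proof. by rewrite !ltr_norml => h /andP[? ?] /andP[? ?]; lra. Qed.

Lemma normv_coord (u v : R3) e i : `|u - v| < e -> `|u 0 i - v 0 i| < e.
Proof.
apply: le_lt_trans; rewrite [leRHS]/Num.Def.normr/= mx_normrE.
by apply: (le_trans _ (le_bigmax _ _ (0, i))); rewrite !mxE.
Qed.

Lemma normv_ltP (u v : R3) e : 0 < e ->
  (forall i, `|u 0 i - v 0 i| < e) -> `|u - v| < e.
Proof.
move=> e0 h; rewrite [ltLHS]/Num.Def.normr/= mx_normrE bigmax_lt//= => -[i j] _.
by rewrite !mxE/= ord1.
Qed.

Lemma subr_loop (V : zmodType) (a b c : V) : (c - a) - (c - b) + (a - b) = 0.
Proof. by rewrite opprB (addrC (c - a)) !subrKA subrr. Qed.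

Lemma derive1_shift (W : normedModType R) (g : R -> W) (c t : R) :
  derive1 (fun x => g (x + c)) t = derive1 g (t + c).
Proof. by rewrite /derive1; under eq_fun do rewrite -addrA. Qed.

Lemma derive1_periodic (W : normedModType R) (g : R -> W) :
  (forall t, g (t + 1) = g t) -> forall t, derive1 g (t + 1) = derive1 g t.
Proof. by move=> g1 t; rewrite -derive1_shift; under eq_fun do rewrite g1. Qed.

Lemma eqZ_addzl (s t : R) (k : int) : eqZ (s + k%:~R) t -> eqZ s t.
Proof. by move=> h; apply: eqZ_trans h; apply/eqZ_sym/eqZP; exists k. Qed.

Lemma near_dist_lt (P : topologicalType) (W : normedModType R) (f : P -> W)
    (p0 : P) e : {for p0, continuous f} -> 0 < e ->
  \forall p \near p0, `|f p - f p0| < e.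
Proof.
move=> cf e0; have h := cf _ (nbhsx_ballx (f p0) e e0).
near=> p; have : ball (f p0) e (f p) by near: p.
by rewrite -ball_normE/= distrC.
Unshelve. all: by end_near.
Qed.

Lemma near_ballP (P : topologicalType) (W : normedModType R) (f : P -> R -> W)
    (p0 : P) (a : R) :
  {for (p0, a), continuous (fun z : P * R => f z.1 z.2)} ->
  forall e, 0 < e -> exists2 d, 0 < d &
    \forall p \near p0, forall x, `|x - a| < d -> `|f p x - f p0 a| < e.
Proof.
move=> /cvgrPdist_lt cf e e0; have [[A B] [/= Ap Ba] AB] := cf e e0.
move/nbhs_ballP : Ba => [d /= d0 dB]; exists d => //.
apply: filterS Ap => p Ap x xd; rewrite distrC.
by apply: (AB (p, x)); split=> //=; apply: dB; rewrite /ball/= distrC.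
Qed.

Lemma det3_near (u v w : R3) : det3 u v w != 0 -> exists2 e, 0 < e &
  forall u' v' w', `|u' - u| < e -> `|v' - v| < e -> `|w' - w| < e ->
    0 < det3 u v w * det3 u' v' w'.
Proof.
move=> d0.
pose f (z : R3 * R3 * R3) := det3 u v w * (
  z.1.1 0 0 * (z.1.2 0 1 * z.2 0 2%:R - z.1.2 0 2%:R * z.2 0 1)
  - z.1.1 0 1 * (z.1.2 0 0 * z.2 0 2%:R - z.1.2 0 2%:R * z.2 0 0)
  + z.1.1 0 2%:R * (z.1.2 0 0 * z.2 0 1 - z.1.2 0 1 * z.2 0 0)).
have fE z : f z = det3 u v w * det3 z.1.1 z.1.2 z.2.
  by congr (_ * _); rewrite det3E.
have C1 : smooth (fun z : R3 * R3 * R3 => z.1.1) by exact: smooth_fst1.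
have C2 : smooth (fun z : R3 * R3 * R3 => z.1.2) by exact: smooth_snd1.
have C3 : smooth (fun z : R3 * R3 * R3 => z.2) by exact: smooth_snd.
have c1 i := smooth_coord i C1; have c2 i := smooth_coord i C2.
have c3 i := smooth_coord i C3.
have M i j k : smooth (fun z : R3 * R3 * R3 =>
    z.1.1 0 i * (z.1.2 0 j * z.2 0 k - z.1.2 0 k * z.2 0 j)).
  exact: smoothM (c1 i) (smoothB (smoothM (c2 j) (c3 k)) (smoothM (c2 k) (c3 j))).
have Cf : smooth f.
  apply: (smoothM (smooth_cst _ (det3 u v w))).
  exact: smoothD (smoothB (M 0 1 2%:R) (M 1 0 2%:R)) (M 2%:R 0 1).
have cf := @smooth_continuous _ _ _ _ Cf (u, v, w).
have f0 : 0 < f (u, v, w) by rewrite fE/= -expr2 exprn_even_gt0.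
have /nbhs_ballP[e /= e0 eB] : \forall z \near (u, v, w), 0 < f z.
  exact: (cf [set y | 0 < y] (lt_nbhsr f0)).
exists e => // u' v' w' hu hv hw.
rewrite -[X in _ < X](fE (u', v', w')).
have b : ball (u, v, w) e (u', v', w').
  by split=> /=; [split=> /=|]; rewrite -ball_normE/= distrC.
exact: (eB _ b).
Qed.

(** The setting: curves [F p], for [p] in [S], near a singular curve [F p0]. The two branches at
    chord [j] are [w p j *: V p j] apart, with [V] transverse to both tangents, so that the double
    point survives exactly when [w p j] is 0. *)
Variables (P : topologicalType) (p0 : P) (S : set P) (F : P -> R -> R3).
Variables (n : nat) (q : P -> 'I_n -> bool -> R) (w : P -> 'I_n -> R).
Variable V : P -> 'I_n -> R3.
Hypothesis dF : forall p t, S p -> derivable (F p) t 1.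
Hypothesis cF : forall t,
  {for (p0, t), continuous (fun z : P * R => F z.1 z.2)}.
Hypothesis cdF : forall t,
  {for (p0, t), continuous (fun z : P * R => derive1 (F z.1) z.2)}.
Hypothesis cq : forall j e, {for p0, continuous (fun p => q p j e)}.
Hypothesis cV : forall j, {for p0, continuous (fun p => V p j)}.
Hypothesis F1 : forall p t, S p -> F p (t + 1) = F p t.
Hypothesis FV : forall p j, S p ->
  F p (q p j false) - F p (q p j true) = w p j *: V p j.
Hypothesis sing : singular (F p0) (q p0).
Hypothesis det0 : forall j, det3 (derive1 (F p0) (q p0 j false))
  (derive1 (F p0) (q p0 j true)) (V p0 j) != 0.

Let near_derive t e (e0 : 0 < e) :=
  @near_ballP _ _ (fun p => derive1 (F p)) p0 t (@cdF t) e e0.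

Let separated p s t := F p s = F p t -> eqZ s t \/
  exists j e, [/\ w p j = 0, eqZ s (q p j e) & eqZ t (q p j (~~ e))].

Let locally_good s0 t0 := exists2 d, 0 < d & \forall p \near p0, S p ->
  forall s t, `|s - s0| < d -> `|t - t0| < d -> separated p s t.

Lemma good_apart s0 t0 : F p0 s0 != F p0 t0 -> locally_good s0 t0.
Proof.
move=> h; pose e := `|F p0 s0 - F p0 t0| / 2.
have e0 : 0 < e by rewrite divr_gt0// normr_gt0 subr_eq0.
have [d1 d10 H1] := near_ballP (@cF s0) e0.
have [d2 d20 H2] := near_ballP (@cF t0) e0.
exists (Num.min d1 d2); first by rewrite lt_min d10.
near=> p => Sp s t; rewrite !lt_min => /andP[sd _] /andP[_ td] st.
have A : `|F p0 s0 - F p s| < e.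
  by rewrite distrC; move: s sd {st}; near: p.
have B : `|F p s - F p0 t0| < e by rewrite st; move: t td {st}; near: p.
have := ler_distD (F p s) (F p0 s0) (F p0 t0).
by move: A B; rewrite /e; lra.
Unshelve. all: by end_near. Qed.

(** A coordinate of the velocity that is nonzero at [s0] stays nonzero nearby, so by the mean value
    theorem this coordinate separates distinct parameters. *)
Lemma good_diag s0 t0 : eqZ s0 t0 -> locally_good s0 t0.
Proof.
move=> /eqZP[k s0t0].
have [[_ _ dn0] _ _ _] := sing.
have /rV0Pn[i di] := dn0 s0.
pose e := `|derive1 (F p0) s0 0 i|.
have e0 : 0 < e by rewrite normr_gt0.
have [d d0 H] := near_derive s0 e0.
exists d => //; near=> p => Sp s t sd td st; left.
suff -> : s = t + k%:~R by apply/eqZP; exists k.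
apply/eqP; rewrite -subr_eq0; apply/negPn/negP => stn.
have [c cs] := @MVT_coord (F p) (t + k%:~R) s i (fun x => @dF _ x Sp).
rewrite periodicZ; last by move=> x; exact: F1.
rewrite st subrr => /esym/eqP; rewrite mulf_eq0 (negbTE stn) orbF => /eqP dc.
have cd : `|c - s0| < d.
  have td' : `|t + k%:~R - s0| < d.
    by rewrite s0t0 opprD addrACA subrr addr0.
  exact: between_ball cs td' sd.
have : `|derive1 (F p) c 0 i - derive1 (F p0) s0 0 i| < e.
  by apply: normv_coord; move: c cd {dc cs}; near: p.
by rewrite dc sub0r normrN /e ltxx.
Unshelve. all: by end_near. Qed.

(** Near the chord, F p s = F p t reads (s - q false) A - (t - q true) B + w V = 0, where [A], [B],
    [V] are close to the two tangents and the transverse vector at [p0]. They are still independent,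
    so all three coefficients vanish. *)
Lemma chord_good j : exists2 d, 0 < d & \forall p \near p0, S p ->
  forall s t, `|s - q p0 j false| < d -> `|t - q p0 j true| < d ->
  F p s = F p t -> [/\ w p j = 0, s = q p j false & t = q p j true].
Proof.
have [e e0 H] := det3_near (det0 j).
have [d1 d10 H1] := near_derive (q p0 j false) e0.
have [d2 d20 H2] := near_derive (q p0 j true) e0.
pose d := Num.min d1 d2 / 3.
have m0 : 0 < Num.min d1 d2 by rewrite lt_min d10.
have d0 : 0 < d by rewrite divr_gt0.
exists d => //; near=> p => Sp s t sd td st.
have qd b : `|q p j b - q p0 j b| < d.
  case: b; near: p.
    exact: (near_dist_lt (@cq j true) d0).
  exact: (near_dist_lt (@cq j false) d0).
have H12 b x : `|x - q p0 j b| < Num.min d1 d2 ->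
    `|derive1 (F p) x - derive1 (F p0) (q p0 j b)| < e.
  case: b; rewrite lt_min => /andP[xd1 xd2].
    by move: x xd2 {xd1}; near: p.
  by move: x xd1 {xd2}; near: p.
have lin b x : `|x - q p0 j b| < d -> exists2 A : R3,
    F p x - F p (q p j b) = (x - q p j b) *: A &
    `|A - derive1 (F p0) (q p0 j b)| < e.
  move=> xd; have c i := cid2 (@MVT_coord (F p) (q p j b) x i (fun x => @dF _ x Sp)).
  exists (\row_i derive1 (F p) (s2val (c i)) 0 i).
    by apply/rowP => i; rewrite !mxE mulrC; exact: (s2valP' (c i)).
  apply: normv_ltP => // i; rewrite mxE; apply: normv_coord; apply: H12.
  have := s2valP (c i); set y := s2val _ => yx.
  have dm : d <= Num.min d1 d2 by rewrite /d; lra.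
  exact: (lt_le_trans (between_ball yx (qd b) xd)).
have [A sA Ae] := lin false s sd; have [B tB Be] := lin true t td.
have Ve : `|V p j - V p0 j| < e.
  by near: p; exact: (near_dist_lt (@cV j) e0).
have dn0 : det3 A B (V p j) != 0.
  have := H _ _ _ Ae Be Ve.
  by apply: contraTneq => ->; rewrite mulr0 ltxx.
have z0 : (s - q p j false) *: A + (- (t - q p j true)) *: B + w p j *: V p j = 0.
  rewrite scaleNr -sA -tB -(@FV p j Sp) st.
  exact: subr_loop.
have [/eqP + /eqP + ->] := det3_inj dn0 z0.
by rewrite oppr_eq0 !subr_eq0 => /eqP -> /eqP ->.
Unshelve. all: by end_near. Qed.

Lemma singular_near : \forall p \near p0, S p ->
  [/\ forall t, derive1 (F p) t != 0,
     forall s t, F p s = F p t -> eqZ s t \/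
       exists j e, [/\ w p j = 0, eqZ s (q p j e) & eqZ t (q p j (~~ e))] &
     forall j, 0 < det3 (derive1 (F p0) (q p0 j false))
        (derive1 (F p0) (q p0 j true)) (V p0 j) *
      det3 (derive1 (F p) (q p j false)) (derive1 (F p) (q p j true)) (V p j)].
Proof.
have loc s0 t0 : locally_good s0 t0.
  have [/eqP h|h] := boolP (F p0 s0 == F p0 t0); last exact: good_apart.
  have [_ _ inj _] := sing.
  have [/good_diag//|[j [e [/eqZP[k sk] /eqZP[l tl]]]]] := (inj s0 t0).1 h.
  have [d d0 H] := chord_good j; exists d => //; near=> p => Sp s t sd td st.
  have sE : F p (s - k%:~R) = F p s.
    by rewrite -mulrNz periodicZ// => x; exact: F1.
  have tE : F p (t - l%:~R) = F p t.
    by rewrite -mulrNz periodicZ// => x; exact: F1.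
  have {}sd : `|s - k%:~R - q p0 j e| < d.
    by rewrite -addrA -opprD [_%:~R + _]addrC -sk.
  have {}td : `|t - l%:~R - q p0 j (~~ e)| < d.
    by rewrite -addrA -opprD [_%:~R + _]addrC -tl.
  have Hp : forall s t, `|s - q p0 j false| < d -> `|t - q p0 j true| < d ->
    F p s = F p t -> [/\ w p j = 0, s = q p j false & t = q p j true].
    by move: Sp; near: p.
  have sZ x : eqZ (s - k%:~R) x -> eqZ s x by rewrite -mulrNz; exact: eqZ_addzl.
  have tZ x : eqZ (t - l%:~R) x -> eqZ t x by rewrite -mulrNz; exact: eqZ_addzl.
  right; exists j, e; case: e sd td {sk tl} => sd td.
    have [w0 t' s'] := Hp _ _ td sd (etrans tE (etrans (esym st) (esym sE))).
    by split=> //; [apply: sZ; rewrite s'|apply: tZ; rewrite t'];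
      exact: eqZ_refl.
  have [w0 s' t'] := Hp _ _ sd td (etrans sE (etrans st (esym tE))).
  by split=> //; [apply: sZ; rewrite s'|apply: tZ; rewrite t'];
    exact: eqZ_refl.
(* The local statements hold near every pair of parameters; the compact square [0, 1] x [0, 1]
   represents all pairs modulo 1 and makes the neighbourhood of [p0] uniform. *)
have cK : compact (`[0 : R, 1] `*` `[0 : R, 1]).
  by apply: compact_setX; exact: segment_compact.
have N1 : \forall p \near p0, forall x, (`[0 : R, 1] `*` `[0 : R, 1]) x ->
    S p -> derive1 (F p) x.1 != 0 /\ separated p x.1 x.2.
  have /compact_near_coveringP := cK; apply=> -[s0 t0] _.
  have [d d0 H] := loc s0 t0.
  have [[_ _ /(_ s0) dn0] _ _ _] := sing.
  have e0 : 0 < `|derive1 (F p0) s0| by rewrite normr_gt0.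
  have [d1 d10 H1] := near_derive s0 e0.
  pose dm := Num.min d d1; have dm0 : 0 < dm by rewrite lt_min d0.
  exists ([set x | `|x.1 - s0| < dm /\ `|x.2 - t0| < dm],
    [set p | (S p -> forall s t, `|s - s0| < d -> `|t - t0| < d -> separated p s t) /\
     forall x, `|x - s0| < d1 -> `|derive1 (F p) x - derive1 (F p0) s0| <
       `|derive1 (F p0) s0|]).
    split; last by apply: filterI.
    apply/nbhs_ballP; exists dm => // -[s t] [/= hs ht].
    by split; rewrite distrC.
  move=> [[s t] p] [/= [hs ht] [Hg Hd]] Sp; move: hs ht; rewrite !lt_min.
  move=> /andP[hs hs1] /andP[ht _]; split; last exact: Hg.
  apply: contraTneq (Hd s hs1) => ->.
  by rewrite sub0r normrN ltxx.
have N2 : \forall p \near p0, forall j, S p ->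
    0 < det3 (derive1 (F p0) (q p0 j false))
        (derive1 (F p0) (q p0 j true)) (V p0 j) *
      det3 (derive1 (F p) (q p j false)) (derive1 (F p) (q p j true)) (V p j).
  apply: filter_forall => j; have [e e0 H] := det3_near (det0 j).
  have [d1 d10 H1] := near_derive (q p0 j false) e0.
  have [d2 d20 H2] := near_derive (q p0 j true) e0.
  near=> p => Sp; apply: H.
  - suff : `|q p j false - q p0 j false| < d1 by move: (q p j false); near: p.
    by near: p; exact: (near_dist_lt (@cq j false) d10).
  - suff : `|q p j true - q p0 j true| < d2 by move: (q p j true); near: p.
    by near: p; exact: (near_dist_lt (@cq j true) d20).
  - by near: p; exact: (near_dist_lt (@cV j) e0).
apply: filterS2 N1 N2 => p n1 n2 Sp.
have fl (x : R) : 0 <= x - (Num.floor x)%:~R <= 1.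
  by have := floor_itv x; rewrite intrD => /andP[? ?]; apply/andP; split; lra.
split.
- move=> t; have [|//|+ _] := n1 (t - (Num.floor t)%:~R, 0).
    by split; rewrite /= in_itv/= ?fl ?lexx ?ler01.
  by rewrite /= -mulrNz periodicZ// => x; apply: derive1_periodic => y; exact: F1.
- move=> s t st.
  have [|//|_] := n1 (s - (Num.floor s)%:~R, t - (Num.floor t)%:~R).
    by split; rewrite /= in_itv/= ?fl.
  have FZ x (k : int) : F p (x + k%:~R) = F p x.
    by apply: periodicZ => y; exact: F1.
  rewrite /separated/= -!mulrNz (FZ s) (FZ t) => /(_ st)[h|[j [e [w0 hs ht]]]].
    by left; exact: eqZ_addz h.
  by right; exists j, e; split=> //; [exact: eqZ_addzl hs|exact: eqZ_addzl ht].
- by move=> j; exact: n2.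
Unshelve. all: by end_near. Qed.

End Stability.

(** * Pushing one branch off at each double point *)

Section Perturbation.
Variable R : realType.
Local Notation R3 := 'rV[R]_3.

Lemma sin_piz (k : int) : sin (pi * k%:~R) = 0 :> R.
Proof.
have H (n : nat) : sin (pi * n%:R) = 0 :> R.
  elim: n => [|n IH]; first by rewrite mulr0 sin0.
  by rewrite -natr1 mulrDr mulr1 sinDpi IH oppr0.
case: k => n; first exact: H.
by rewrite NegzE mulrNz mulrN sinN (H n.+1) oppr0.
Qed.

Lemma sin_pi_eq0 (x : R) : sin (pi * x) = 0 <-> x \is a Num.int.
Proof.
split=> [|/intrP[k ->]]; last exact: sin_piz.
set k := Num.floor x; move=> sx.
have /andP[k0 k1] : 0 <= x - k%:~R < 1.
  by have := floor_itv x; rewrite intrD -/k => /andP[? ?]; apply/andP; split; lra.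
have s0 : sin (pi * (x - k%:~R)) = 0.
  by rewrite mulrBr sinB sx mul0r sin_piz mulr0 subrr.
have [x0|x0] := eqVneq (x - k%:~R) 0.
  by apply/intrP; exists k; apply/eqP; rewrite -subr_eq0 x0.
have : 0 < sin (pi * (x - k%:~R)).
  have y0 : 0 < x - k%:~R by rewrite lt_def x0.
  by apply: sin_gt0_pi; rewrite mulr_gt0 ?pi_gt0//= gtr_pMr ?pi_gt0.
by rewrite s0 ltxx.
Qed.

Definition distinct n (q : 'I_n -> bool -> R) :=
  forall i e j e', eqZ (q i e) (q j e') -> i = j /\ e = e'.

(* Among all the parameters [q j e], only [q i false] is not a zero. *)
Definition beta n (q : 'I_n -> bool -> R) (i : 'I_n) (t : R) : R :=
  \prod_(x : 'I_n * bool | x != (i, false))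
    (sin (pi * (t - q x.1 x.2)) * sin (pi * (t - q x.1 x.2))).

(** Under t + 1 each sine changes sign and its square does not, whatever the number of factors. *)
Lemma beta_periodic n (q : 'I_n -> bool -> R) i t :
  beta q i (t + 1) = beta q i t.
Proof.
apply: eq_bigr => x _.
by rewrite addrAC mulrDr mulr1 sinDpi mulrNN.
Qed.

Lemma beta_eq0 n (q : 'I_n -> bool -> R) i j e : (j, e) != (i, false) ->
  beta q i (q j e) = 0.
Proof.
move=> je; apply/eqP; rewrite prodf_seq_eq0; apply/hasP; exists (j, e).
  by rewrite mem_index_enum.
by rewrite je /= subrr mulr0 sin0 mulr0.
Qed.

Lemma beta_gt0 n (q : 'I_n -> bool -> R) i : distinct q ->
  0 < beta q i (q i false).
Proof.
move=> dq; apply: prodr_gt0 => -[j e] /= je.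
rewrite -expr2 lt_def sqr_ge0 andbT sqrf_eq0; apply/eqP => /sin_pi_eq0 h.
have [ij e0] := dq _ _ _ _ (h : eqZ (q i false) (q j e)).
by move: je; rewrite ij e0 eqxx.
Qed.

Definition pushdir (g : R -> R3) n (q : 'I_n -> bool -> R) j : R3 :=
  cross (derive1 g (q j false)) (derive1 g (q j true)).

(** A push-off at all double points at once: [u 0 j] moves the branch at [q j false] along the
    normal to the two tangents, while the zeros of [beta] keep all other parameters of double points
    in place. A zero entry keeps the double point, and the sign of a nonzero one is the sign of the
    resolution. *)
Definition pert n (g : R -> R3) (q : 'I_n -> bool -> R) (u : 'rV[R]_n) (t : R) : R3 :=
  g t + \sum_j (u 0 j * beta q j t) *: pushdir g q j.

Lemma pert0 n (g : R -> R3) (q : 'I_n -> bool -> R) : pert g q 0 = g.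
Proof.
apply/funext => t; rewrite /pert big1 ?addr0// => j _.
by rewrite mxE mul0r scale0r.
Qed.

Lemma pert_periodic n (g : R -> R3) (q : 'I_n -> bool -> R) u :
  (forall t, g (t + 1) = g t) -> forall t, pert g q u (t + 1) = pert g q u t.
Proof.
move=> g1 t; rewrite /pert g1; congr (_ + _); apply: eq_bigr => j _.
by rewrite beta_periodic.
Qed.

Lemma pert_false n (g : R -> R3) (q : 'I_n -> bool -> R) u j :
  pert g q u (q j false) =
  g (q j false) + (u 0 j * beta q j (q j false)) *: pushdir g q j.
Proof.
rewrite /pert (bigD1 j)//= big1 ?addr0// => i ij.
by rewrite beta_eq0 ?mulr0 ?scale0r// xpair_eqE negb_and eq_sym ij.
Qed.

Lemma pert_true n (g : R -> R3) (q : 'I_n -> bool -> R) u j :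
  pert g q u (q j true) = g (q j true).
Proof.
rewrite /pert big1 ?addr0// => i _.
by rewrite beta_eq0 ?mulr0 ?scale0r// xpair_eqE negb_and orbT.
Qed.

Lemma smooth_cross (V : normedModType R) (u v : V -> R3) :
  smooth u -> smooth v -> smooth (fun x => cross (u x) (v x)).
Proof.
move=> Cu Cv; have cu i := smooth_coord i Cu; have cv i := smooth_coord i Cv.
by apply: smooth_vec3; apply: smoothB; apply: smoothM.
Qed.

(** The velocity in time is a directional derivative of the joint map, so it inherits the smoothness
    of that map. *)
Lemma derive1_joint (V W : normedModType R) (G : V * R -> W) p t :
  derive1 (fun t => G (p, t)) t = 'D_(0, 1) G (p, t).
Proof.
have E : (fun h : R => h^-1 *:
      (((fun t => G (p, t)) \o shift t) (h *: (1 : R)) - G (p, t))) =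
    (fun h : R => h^-1 *: ((G \o shift (p, t)) (h *: (0, 1 : R)) - G (p, t))).
  apply/funext => h /=; congr (_ *: (G _ - _)).
  by apply: injective_projections; rewrite /= ?scaler0 ?add0r.
by rewrite derive1E /derive E.
Qed.

Lemma smooth_derive_joint (V W : normedModType R) (G : V * R -> W) :
  smooth G -> smooth (fun z : V * R => derive1 (fun t => G (z.1, t)) z.2).
Proof.
move=> CG k.
apply: (@eq_Ck _ _ _ _ _ (fun z => 'D_(0 : V, 1 : R) G z)) => [|[p t]].
  exact: smooth_derive.
by rewrite derive1_joint.
Qed.

Lemma smooth_family_derive (V : normedModType R) (H : R -> R -> R3) (a b : V -> R) :
  smooth_family H -> smooth a -> smooth b ->
  smooth (fun x => derive1 (H (a x)) (b x)).
Proof.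
move=> CH Ca Cb k.
apply: (@eq_Ck _ _ _ _ _ (fun x => 'D_(0 : R, 1 : R) (fun z => H z.1 z.2) (a x, b x))).
  exact: (smooth_comp2_3 (smooth_derive _ CH) Ca Cb).
by move=> x; rewrite -derive1_joint.
Qed.

Lemma smooth_family_app (V : normedModType R) (H : R -> R -> R3) (a b : V -> R) :
  smooth_family H -> smooth a -> smooth b -> smooth (fun x => H (a x) (b x)).
Proof. by move=> CH Ca Cb; exact: (smooth_comp2_3 CH Ca Cb). Qed.

Lemma smooth_sum3 (V : normedModType R) n (a : 'I_n -> V -> R) (F : 'I_n -> V -> R3) :
  (forall j, smooth (a j)) -> (forall j, smooth (F j)) ->
  smooth (fun x => \sum_j a j x *: F j x).
Proof. by move=> Ca CF; apply: smooth_sum => j _; exact: smoothZ3. Qed.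

Lemma smooth_beta (V : normedModType R) n (Q : V -> 'I_n -> bool -> R) i (t : V -> R) :
  (forall j e, smooth (fun x => Q x j e)) -> smooth t ->
  smooth (fun x => beta (Q x) i (t x)).
Proof.
move=> CQ Ct; apply: smooth_prod => x _.
suff C : smooth (fun y => sin (pi * (t y - Q y x.1 x.2))) by exact: smoothM.
apply: (smooth_comp (@smooth_sin R)); apply: smoothM; first exact: smooth_cst.
by apply: smoothB.
Qed.

Lemma smooth_pert (V : normedModType R) n (H : R -> R -> R3)
    (Q : R -> 'I_n -> bool -> R) (a t : V -> R) (u : V -> 'rV[R]_n) :
  smooth_family H -> (forall j e, smooth (fun x => Q x j e)) ->
  smooth a -> smooth t -> (forall j, smooth (fun x => u x 0 j)) ->
  smooth (fun x => pert (H (a x)) (Q (a x)) (u x) (t x)).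
Proof.
move=> CH CQ Ca Ct Cu; have CQa j e : smooth (fun x => Q (a x) j e).
  exact: (smooth_comp (CQ j e)).
apply: smoothD; first exact: smooth_family_app.
apply: smooth_sum3 => j; first by apply: smoothM => //; exact: smooth_beta.
by apply: smooth_cross; apply: smooth_family_derive.
Qed.

End Perturbation.

(** * Singularity of perturbed curves, uniformly along a path *)

Section PerturbedKnots.
Variable R : realType.
Local Notation R3 := 'rV[R]_3.

Lemma singular_distinct n g (q : 'I_n -> bool -> R) : singular g q -> distinct q.
Proof. by move=> []. Qed.

Lemma singular_chord n g (q : 'I_n -> bool -> R) j : singular g q ->
  g (q j false) = g (q j true).
Proof.
by move=> [_ _ inj _]; apply/inj; right; exists j, false; split; exact: eqZ_refl.
Qed.

Lemma singularI n g (q : 'I_n -> bool -> R) : immersed_circle g -> distinct q ->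
  (forall j, g (q j false) = g (q j true)) ->
  (forall s t, g s = g t -> eqZ s t \/
     exists j e, eqZ s (q j e) /\ eqZ t (q j (~~ e))) ->
  (forall j, indep (derive1 g (q j false)) (derive1 g (q j true))) ->
  singular g q.
Proof.
move=> gi dq gq inj ind; split=> // s t; split; first exact: inj.
have gZ x y : eqZ x y -> g x = g y.
  by move=> /eqZP[k ->]; rewrite periodicZ//; case: gi.
move=> [/gZ//|[j [e [/gZ -> /gZ ->]]]].
by case: e => /=; rewrite ?gq.
Qed.

Lemma det3Z (u v w : R3) a : det3 u v (a *: w) = a * det3 u v w.
Proof. by rewrite !det3E !mxE; ring. Qed.

Lemma det3N (u v w : R3) : det3 u v (- w) = - det3 u v w.
Proof. by rewrite -scaleN1r det3Z mulN1r. Qed.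

Lemma det3C (u v w : R3) : det3 v u w = - det3 u v w.
Proof. by rewrite !det3E; ring. Qed.

(** The last clause keeps the orientation of tangents and push direction, from which the sign is
    read when a further double point is opened. *)
Definition pert_ok n (g : R -> R3) (q : 'I_n -> bool -> R) (u : 'rV[R]_n) :=
  [/\ forall t, derive1 (pert g q u) t != 0,
      forall s t, pert g q u s = pert g q u t -> eqZ s t \/
       exists j e, [/\ u 0 j = 0, eqZ s (q j e) & eqZ t (q j (~~ e))] &
      forall j, 0 < det3 (derive1 (pert g q u) (q j false))
         (derive1 (pert g q u) (q j true)) (pushdir g q j)].

Lemma singular_near_smooth (P : normedModType R) (p0 : P) (S : set P)
    (F : P -> R -> R3) n (q : P -> 'I_n -> bool -> R) (w : P -> 'I_n -> R)
    (V : P -> 'I_n -> R3) :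
  smooth (fun z : P * R => F z.1 z.2) ->
  (forall j e, smooth (fun p => q p j e)) ->
  (forall j, {for p0, continuous (fun p => V p j)}) ->
  (forall p t, S p -> F p (t + 1) = F p t) ->
  (forall p j, S p -> F p (q p j false) - F p (q p j true) = w p j *: V p j) ->
  singular (F p0) (q p0) ->
  (forall j, 0 < det3 (derive1 (F p0) (q p0 j false))
    (derive1 (F p0) (q p0 j true)) (V p0 j)) ->
  \forall p \near p0, S p -> [/\ forall t, derive1 (F p) t != 0,
     forall s t, F p s = F p t -> eqZ s t \/
       exists j e, [/\ w p j = 0, eqZ s (q p j e) & eqZ t (q p j (~~ e))] &
     forall j, 0 < det3 (derive1 (F p) (q p j false))
       (derive1 (F p) (q p j true)) (V p j)].
Proof.
move=> CF Cq cV F1 FV sg d0.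
have dF p t : derivable (F p) t 1.
  apply/derivable1_diffP.
  apply: (@differentiable_comp _ _ _ _ (fun t => (p, t)) (fun z => F z.1 z.2)).
    exact: differentiable_pair.
  exact: smooth_differentiable.
have := @singular_near R P p0 S F n q w V (fun p t _ => dF p t)
  (fun t => @smooth_continuous _ _ _ _ CF (p0, t))
  (fun t => @smooth_continuous _ _ _ _ (smooth_derive_joint CF) (p0, t))
  (fun j e => @smooth_continuous _ _ _ _ (Cq j e) p0) cV F1 FV sg
  (fun j => lt0r_neq0 (d0 j)).
apply: filterS => p + Sp => /(_ Sp)[A B C]; split=> // j.
by have := C j; rewrite pmulr_rgt0.
Qed.

Lemma smooth_slice (V : normedModType R) n (g : R -> R3) (q : 'I_n -> bool -> R)
    (t : V -> R) (u : V -> 'rV[R]_n) :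
  smooth g -> smooth t -> (forall j, smooth (fun x => u x 0 j)) ->
  smooth (fun x => pert g q (u x) (t x)).
Proof.
move=> Cg Ct Cu.
apply: (@smooth_pert _ _ _ (fun _ => g) (fun _ => q) (fun _ => 0)) => //.
- exact: (smooth_comp_3 Cg (@smooth_snd _ _ _)).
- by move=> j e; exact: smooth_cst.
- exact: smooth_cst.
Qed.

Lemma pert_singular n m g (q : 'I_n -> bool -> R) u (l : 'I_m -> 'I_n) :
  singular g q -> pert_ok g q u -> injective l ->
  (forall j, u 0 j = 0 <-> exists k, j = l k) ->
  singular (pert g q u) (fun k => q (l k)).
Proof.
move=> sg [dn0 inj dt] li ul; have [[Cg g1 _] dq _ _] := sg.
apply: singularI.
- split=> //; last exact: pert_periodic.
  apply: smooth_slice => //; first exact: smooth_id.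
  by move=> j; exact: smooth_cst.
- by move=> i e j e' /dq[/li -> ->].
- move=> j; rewrite pert_false pert_true (singular_chord _ sg).
  have [_ ->] := ul (l j); last by exists j.
  by rewrite mul0r scale0r addr0.
- move=> s t /inj[|[j [e [/ul[k ->] ? ?]]]]; first by left.
  by right; exists k, e.
- by move=> j; apply: (@det3_indep _ _ _ (pushdir g q (l j))); rewrite gt_eqF.
Qed.

Lemma perturb n H (Q : R -> 'I_n -> bool -> R) : sing_path H Q ->
  exists2 d : R, 0 < d & forall s (u : 'rV[R]_n), 0 <= s <= 1 -> `|u| < d ->
    pert_ok (H s) (Q s) u.
Proof.
move=> [CH CQ sing].
suff /nbhs_ballP[d /= d0 dB] : \forall u \near (0 : 'rV[R]_n),
    forall s, `[0, 1]%classic s -> 0 <= s <= 1 -> pert_ok (H s) (Q s) u.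
  exists d => // s u s01 ud; apply: dB => //.
  by rewrite -ball_normE/= sub0r normrN.
(* Stability at a time [s0] holds jointly in (s, u); compactness of [0, 1] yields one bound on [u]
   for the whole path. *)
have nc := (compact_near_coveringP _).1 (@segment_compact R 0 1).
apply: (nc _ (nbhs (0 : 'rV[R]_n))
  (fun u s => 0 <= s <= 1 -> pert_ok (H s) (Q s) u)) => s0.
rewrite /= in_itv/= => s01.
pose F (p : R * 'rV[R]_n) := pert (H p.1) (Q p.1) p.2.
(* The factor [beta] goes into the transverse vector, so that the gap coefficient is the entry of
   [u] itself. *)
pose V (p : R * 'rV[R]_n) j :=
  beta (Q p.1) j (Q p.1 j false) *: pushdir (H p.1) (Q p.1) j.
have C1 : smooth (@fst R 'rV[R]_n) by exact: smooth_fst.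
have C11 : smooth (fun z : (R * 'rV[R]_n) * R => z.1.1) by exact: smooth_fst1.
have C12 j : smooth (fun z : (R * 'rV[R]_n) * R => z.1.2 0 j).
  by apply: smooth_coord; exact: smooth_snd1.
have CJ : smooth (fun z : (R * 'rV[R]_n) * R => F z.1 z.2).
  by apply: smooth_pert => //; exact: smooth_snd.
have CQ1 j e : smooth (fun p : R * 'rV[R]_n => Q p.1 j e).
  exact: (smooth_comp (CQ j e)).
have CV j : smooth (fun p : R * 'rV[R]_n => V p j).
  apply: smoothZ3; first exact: smooth_beta.
  by apply: smooth_cross; apply: smooth_family_derive.
have P0 : F (s0, 0) = H s0 by exact: pert0.
have sg := sing s0 s01.
have d0 j : 0 < det3 (derive1 (F (s0, 0)) (Q s0 j false))
     (derive1 (F (s0, 0)) (Q s0 j true)) (V (s0, 0) j).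
  rewrite P0 det3Z mulr_gt0//; first exact/beta_gt0/singular_distinct/sg.
  by apply: indep_cross; have [] := sg.
have := @singular_near_smooth (R * 'rV[R]_n)%type (s0, 0)
  [set p | 0 <= p.1 <= 1] F n (fun p => Q p.1) (fun p j => p.2 0 j) V CJ CQ1
  (fun j => @smooth_continuous _ _ _ _ (CV j) (s0, 0)).
case.
- move=> p t p01; apply: pert_periodic => x.
  by have [[_ + _] _ _ _] := sing p.1 p01; apply.
- move=> p j p01; rewrite /F pert_false pert_true.
  rewrite (singular_chord _ (sing p.1 p01)) addrAC subrr add0r /V.
  by rewrite scalerA.
- by rewrite P0.
- exact: d0.
move=> [A B] nAB AB; exists (A, B); first exact: nAB.
move=> [s u] su s1; have [dn inj dt] := AB (s, u) su s1.
split; [exact: dn|exact: inj|move=> j].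
have := dt j; rewrite /V/= det3Z pmulr_rgt0//.
by apply/beta_gt0/singular_distinct/sing.
Qed.

End PerturbedKnots.

(** * Opening a double point *)

Section Openings.
Variable R : realType.
Local Notation R3 := 'rV[R]_3.
Local Notation sg s := (bsign R s).

(** [opens] on bare curves and parameters: the knot records at the two ends are left out, which
    serves both complexes at once. *)
Definition ropens n (i : 'I_n.+1) (s : bool) (g : R -> R3)
    (q : 'I_n.+1 -> bool -> R) (H : R -> R -> R3) : Prop :=
  [/\ smooth_family H, H 0 = g,
      forall u, 0 < u <= 1 -> singular (H u) (fun j => q (fintype.lift i j)) &
      0 < (if s then 1 else -1) *
        det3 (derive1 g (q i false)) (derive1 g (q i true))
             (derive1 (fun u => H u (q i false) - H u (q i true)) 0)].

Lemma bsignM s : sg s * sg s = 1.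
Proof. by case: s; rewrite /bsign ?mulr1// mulrNN mulr1. Qed.

Lemma bsign_norm s : `|sg s| = 1.
Proof. by case: s; rewrite /bsign ?normrN normr1. Qed.

Lemma derive1_linear (v : R3) (c : R) x : derive1 (fun x => (x * c) *: v) x = c *: v.
Proof.
rewrite derive1E; apply/rowP => i.
have d : derivable (fun x : R => (x * c) *: v) x 1.
  apply: smooth_derivable; apply: smoothZl.
  by apply: smoothM; [exact: smooth_id|exact: smooth_cst].
rewrite derive_mx// !mxE.
under eq_fun do rewrite mxE -mulrA.
by rewrite -derive1E derive1Mr ?derive1_id ?mul1r.
Qed.

Lemma smooth_comp2_snd (P : normedModType R) (F : P -> R -> R3) p :
  smooth (fun z : P * R => F z.1 z.2) -> smooth (F p).
Proof.
move=> CF; suff H k (G : P * R -> R3) : Ck k G -> Ck k (fun t => G (p, t)).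
  by move=> k; exact: (H k _ (CF k)).
have dp (t : R) : differentiable (fun t : R => (p, t)) t.
  exact: differentiable_pair.
elim: k G => [|k IH] G.
  move=> cG t; apply: (@continuous_comp _ _ _ (fun t => (p, t)) G).
    exact: differentiable_continuous.
  exact: cG.
move=> /CkSE[dG DG]; apply/CkSE; split=> [t|v].
  exact: (@differentiable_comp _ _ _ _ (fun t => (p, t)) G).
apply: (eq_Ck (IH _ (DG (0, v)))) => t.
have dc : differentiable (G \o (fun t => (p, t))) t by exact: differentiable_comp.
rewrite -[LHS]/('D_v (G \o (fun t => (p, t))) t) (deriveE v dc) (deriveE _ (dG _)).
rewrite diff_comp//= diff_pair//= diff_cst; congr ('d G _ (_, _)).
by rewrite -(deriveE v (smooth_differentiable t (@smooth_id _ R))) derive_id.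
Qed.

(** The entry at the opened point runs linearly from 0 to [r] times the sign, so the branches
    separate with velocity a positive multiple of that sign times the normal. The map [l] allows
    other double points to be opened already, as the commutation of faces requires. *)
Lemma opens_pert n m g (q : 'I_n -> bool -> R) (u : 'rV[R]_n)
    (l : 'I_m.+1 -> 'I_n) (i : 'I_m.+1) s (r : R) :
  singular g q -> injective l -> (forall j, u 0 j = 0 <-> exists k, j = l k) ->
  0 < r -> (forall x, 0 <= x <= 1 ->
    pert_ok g q (u + (x * (r * sg s)) *: delta_mx 0 (l i))) ->
  ropens i s (pert g q u) (fun k => q (l k))
    (fun x => pert g q (u + (x * (r * sg s)) *: delta_mx 0 (l i))).
Proof.
move=> sing li ul r0 ok.
have s0 : sg s != 0 by rewrite -normr_eq0 bsign_norm oner_eq0.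
have E x j : (u + (x * (r * sg s)) *: delta_mx 0 (l i)) 0 j =
    u 0 j + x * (r * sg s) * (j == l i)%:R.
  by rewrite !mxE eqxx andTb.
have ui : u 0 (l i) = 0 by apply/ul; exists i.
have [[Cg _ _] _ _ _] := sing.
split.
- apply: smooth_slice => //; first exact: smooth_snd.
  move=> j; under eq_fun do rewrite E.
  apply: smoothD; first exact: smooth_cst.
  apply: smoothM; last exact: smooth_cst.
  by apply: smoothM; [exact: smooth_fst|exact: smooth_cst].
- by rewrite mul0r scale0r addr0.
- move=> x /andP[x0 x1].
  have okx := ok x; rewrite (ltW x0) x1 in okx.
  apply: (pert_singular (l := fun k => l (fintype.lift i k)) sing (okx isT)).
    by move=> k k' /li/lift_inj.
  move=> j; rewrite E; have [->|ji] := eqVneq j (l i).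
    rewrite ui add0r mulr1; split=> [/eqP|[k /li ik]].
      by rewrite !mulf_eq0 (gt_eqF x0) (gt_eqF r0) (negbTE s0).
    by have := neq_lift i k; rewrite -ik eqxx.
  rewrite mulr0 addr0 ul; split=> [[k jk]|[k ->]]; last by exists (fintype.lift i k).
  have [k' k'k|ik] := unliftP i k; first by exists k'; rewrite -k'k.
  by move: ji; rewrite jk ik eqxx.
- have ok0 := ok 0; rewrite lexx ler01 mul0r scale0r addr0 in ok0.
  have [_ _ /(_ (l i)) dt] := ok0 isT.
  have b0 := beta_gt0 (l i) (singular_distinct sing).
  rewrite (_ : (fun x => _) = fun x =>
    (x * (r * sg s * beta q (l i) (q (l i) false))) *: pushdir g q (l i)); last first.
    apply/funext => x; rewrite pert_false pert_true E ui eqxx mulr1 add0r.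
    rewrite (singular_chord _ sing) addrAC subrr add0r.
    by congr (_ *: _); ring.
  rewrite derive1_linear det3Z -[if s then _ else _]/(sg s).
  rewrite [ltRHS](_ : _ = (sg s * sg s) * (r * beta q (l i) (q (l i) false) *
    det3 (derive1 (pert g q u) (q (l i) false))
      (derive1 (pert g q u) (q (l i) true)) (pushdir g q (l i)))); last by ring.
  by rewrite bsignM mul1r !mulr_gt0.
Qed.

(** Dividing the separation of two branches by [u] gives a direction known to be continuous at 0 and
    no more. Hence the stability theorem asks of the transverse vectors only continuity at [p0]. *)
Lemma cvg_growth (f : R -> R3) (f0 : f 0 = 0) (df : derivable f 0 1) :
  {for (0 : R), continuous
    (fun u : R => if u == 0 then derive1 f 0 else u^-1 *: f u)}.
Proof.
apply/continuous_withinNx; rewrite /= eqxx derive1E.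
have H : h^-1 *: ((f \o shift 0) (h *: (1 : R)) - f 0) @[h --> 0^'] --> 'D_1 f 0.
  exact: df.
apply: cvg_trans H; apply: near_eq_cvg; near=> h.
have h0 : h != 0 by near: h; exact: nbhs_dnbhs_neq.
by rewrite (negbTE h0) f0 subr0 /= addr0 [h *: 1]mulr1.
Unshelve. all: by end_near. Qed.

Lemma det3D (u v w w' : R3) : det3 u v (w + w') = det3 u v w + det3 u v w'.
Proof. by rewrite !det3E !mxE; ring. Qed.

Lemma smooth_separation (H : R -> R -> R3) a b : smooth_family H ->
  smooth (fun u => H u a - H u b).
Proof.
move=> CH; apply: smooth_row => j k.
apply: (@eq_Ck _ _ _ _ _ (fun u => H u a 0 j - H u b 0 j)).
  apply: smoothB; apply: smooth_coord; apply: (smooth_family_app CH);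
    by [exact: smooth_id|exact: smooth_cst].
by move=> u; rewrite !mxE.
Qed.

(* At the opened double point both summands move with a velocity on the same
   side of the plane of the tangents, so a mixture of them still opens it. *)
Lemma interp n (i : 'I_n.+1) s g q H : singular g q -> ropens i s g q H ->
  exists2 d : R, 0 < d & forall x u, 0 <= x <= 1 -> 0 < u < d -> u <= 1 ->
    singular (fun t => (1 - x) *: H u t +
       x *: pert g q ((u * sg s) *: delta_mx 0 i) t)
      (fun j => q (fintype.lift i j)).
Proof.
move=> sing [CH H0 singH sgn]; have [[Cg g1 _] dq _ _] := sing.
have s0 : sg s != 0 by rewrite -normr_eq0 bsign_norm oner_eq0.
pose D u := H u (q i false) - H u (q i true).
have CD : smooth D by exact: smooth_separation.
have D0 : D 0 = 0 by rewrite /D H0 (singular_chord _ sing) subrr.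
pose V1 (u : R) := if u == 0 then derive1 D 0 else u^-1 *: D u.
have DV1 u : D u = u *: V1 u.
  rewrite /V1; case: eqVneq => [->|u0]; first by rewrite scale0r D0.
  by rewrite scalerA divff// scale1r.
have cV1 : {for (0 : R), continuous V1}.
  by apply: cvg_growth => //; exact: smooth_derivable.
have E u j : ((u * sg s) *: delta_mx 0 i : 'rV[R]_n.+1) 0 j =
    u * sg s * (j == i)%:R by rewrite !mxE.
pose F (p : R * R) t := (1 - p.1) *: H p.2 t +
   p.1 *: pert g q ((p.2 * sg s) *: delta_mx 0 i) t.
pose b := beta q i (q i false).
have b0 : 0 < b by exact: beta_gt0.
(* The gap coefficient at [i] is [p.2 * sg s]. As the square of the sign is 1, the sign in front of
   [V1] recovers the separation [p.2 *: V1 p.2] of [H], and it gives both summands determinants that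
   are not negative. *)
pose V (p : R * R) j := if j == i
  then (sg s * (1 - p.1)) *: V1 p.2 + (p.1 * b) *: pushdir g q i
  else pushdir g q j.
(* Periodicity and the surviving double points of [H u] are known for [u] in [0, 1] only. *)
pose S := [set p : R * R | 0 <= p.1 <= 1 /\ 0 <= p.2 <= 1].
have H1 u : 0 <= u <= 1 -> forall t, H u (t + 1) = H u t.
  move=> /andP[u0 u1]; move: u0; rewrite le_eqVlt => /predU1P[<-|u0].
    by rewrite H0.
  by have [[_ + _] _ _ _] := singH u (introT andP (conj u0 u1)).
have Hj u k : 0 <= u <= 1 ->
    H u (q (fintype.lift i k) false) = H u (q (fintype.lift i k) true).
  move=> /andP[u0 u1]; move: u0; rewrite le_eqVlt => /predU1P[<-|u0].
    by rewrite H0; exact: singular_chord sing.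
  exact: (singular_chord k (singH u (introT andP (conj u0 u1)))).
have nc := (compact_near_coveringP _).1 (@segment_compact R 0 1).
have : \forall u \near (0 : R), forall x, `[0, 1]%classic x ->
    0 <= x <= 1 -> 0 < u <= 1 -> singular (F (x, u)) (fun j => q (fintype.lift i j)).
  apply: (nc _ (nbhs (0 : R)) (fun u x => 0 <= x <= 1 -> 0 < u <= 1 ->
    singular (F (x, u)) (fun j => q (fintype.lift i j)))) => x0.
  rewrite /= in_itv/= => x01.
  have CF : smooth (fun z : (R * R) * R => F z.1 z.2).
    have C11 : smooth (fun z : (R * R) * R => z.1.1) by exact: smooth_fst1.
    have C12 : smooth (fun z : (R * R) * R => z.1.2) by exact: smooth_snd1.
    apply: smoothD.
      apply: smoothZ3; first by apply: smoothB => //; exact: smooth_cst.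
      by apply: (smooth_family_app CH) => //; exact: smooth_snd.
    apply: smoothZ3 => //; apply: smooth_slice => //; first exact: smooth_snd.
    move=> j; under eq_fun do rewrite E.
    by do 2![apply: smoothM; last exact: smooth_cst].
  have F0 : F (x0, 0) = g.
    apply/funext => t; rewrite /F /= H0 mul0r scale0r pert0 -scalerDl subrK.
    by rewrite scale1r.
  have := @singular_near_smooth _ (R * R)%type (x0, 0) S F n.+1 (fun p => q)
    (fun p j => if j == i then p.2 * sg s else 0) V CF
    (fun j e => @smooth_cst _ _ _ (q j e)).
  case.
  - move=> j; rewrite /V; case: eqP => _; last exact: cvg_cst.
    have c1 : {for (x0, 0), continuous (fun p : R * R => p.1)} by exact: cvg_fst.
    have c2 : {for (x0, 0), continuous (fun p : R * R => V1 p.2)}.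
      apply: (@continuous_comp _ _ _ snd V1); last exact: cV1.
      exact: cvg_snd.
    apply: continuousD.
      have c3 : {for (x0, 0), continuous (fun p : R * R => sg s * (1 - p.1))}.
        apply: continuousM; first exact: cvg_cst.
        by apply: continuousB => //; exact: cvg_cst.
      exact: (continuousZ c3 c2).
    apply: continuousZr_tmp; apply: continuousM => //; exact: cvg_cst.
  - move=> p t [p1 p2]; rewrite /F H1//; congr (_ + _ *: _).
    exact: pert_periodic.
  - move=> p j [p1 p2]; rewrite /F pert_false pert_true E /V.
    have [->|ji] := eqVneq j i.
      rewrite (singular_chord _ sing) mulr1 -/b opprD addrACA -!scalerBr.
      rewrite -/(D p.2) DV1 addrAC subrr add0r !scalerDr !scalerA.
      congr (_ *: _ + _ *: _); last by ring.
      by rewrite mulrA -[p.2 * sg s * sg s]mulrA bsignM mulr1 mulrC.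
    rewrite mulr0 mul0r !scale0r addr0.
    case: (unliftP i j) ji => [k ->|-> /eqP//] _.
    by rewrite Hj// (singular_chord _ sing) subrr.
  - by rewrite F0.
  - move=> j; rewrite F0 /V/=; have [->|ji] := eqVneq j i.
      rewrite /V1 eqxx.
      have dp := indep_cross (let: And4 _ _ _ h := sing in h i).
      move: sgn; rewrite -/D -[if s then _ else _]/(sg s) => sgn.
      rewrite det3D !det3Z.
      rewrite (_ : sg s * (1 - x0) * _ = (1 - x0) *
        (sg s * det3 (derive1 g (q i false)) (derive1 g (q i true))
          (derive1 D 0))); last by ring.
      move: dp; rewrite -/(pushdir g q i) => dp.
      case/andP: x01 => x00 x01; move: x00; rewrite le_eqVlt => /predU1P[<-|x00].
        by rewrite subr0 mul1r !mul0r addr0.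
      apply: ltr_wpDl; first by rewrite mulr_ge0 ?subr_ge0// ltW.
      by rewrite !mulr_gt0.
    by apply: indep_cross; have [] := sing.
  move=> [A B] [/= nA nB] AB; exists (A, B) => // -[x u] /= [Ax Bu] xx /andP[u0 u1].
  have u01 : 0 <= u <= 1 by rewrite ltW.
  have [dn inj dt] := AB (x, u) (conj Ax Bu) (conj xx u01).
  have wi : u * sg s != 0 by rewrite mulf_neq0// gt_eqF.
  apply: singularI.
  - split=> //; last first.
      move=> t; rewrite /F H1//; congr (_ + _ *: _).
      exact: pert_periodic.
    exact: (@smooth_comp2_snd (R * R)%type F (x, u) CF).
  - by move=> k e k' e' /dq[/lift_inj -> ->].
  - move=> k; rewrite /F pert_false pert_true E Hj// (singular_chord _ sing).
    by rewrite eq_sym (negbTE (neq_lift _ _)) mulr0 mul0r scale0r addr0.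
  - move=> a c /inj[|[j [e [/= + ? ?]]]]; first by left.
    case: eqVneq => [_ /eqP|ji _]; first by rewrite (negbTE wi).
    right; case: (unliftP i j) ji => [k jk|->]; last by rewrite eqxx.
    by move=> _; exists k, e; rewrite -jk.
  - move=> k; apply: (@det3_indep _ _ _ (V (x, u) (fintype.lift i k))).
    by rewrite gt_eqF.
move=> /nbhs_ballP[d /= d0 dB]; exists d => // x u xx /andP[u0 ud] u1.
apply: (dB u) => //; last by rewrite u0.
by rewrite -ball_normE/= sub0r normrN gtr0_norm.
Qed.

End Openings.

(** * Representatives of cubes *)

Section Representatives.
Variable R : realType.
Local Notation R3 := 'rV[R]_3.
Local Notation sg s := (bsign R s).

Definition based (c : cube_complex) : bool := if c is CKb then true else false.

Definition good (b : bool) n g (q : 'I_n -> bool -> R) (t : R) : Prop :=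
  singular g q /\ (b -> met_in_order t q).

(* The parameter [t] of the base point is irrelevant for [CK0]. *)
Definition rep (c : cube_complex) n : cube R c n -> (R -> R3) ->
    ('I_n -> bool -> R) -> R -> Prop :=
  match c with
  | CK0 => fun x g q t => exists K : sknot R n,
      [/\ class0 K = x, curve K = g & double_at g (dpt K) q]
  | CKb => fun x g q t => exists K : bknot R n,
      [/\ classb K = x, curve K = g & double_at g (dpt K) q] /\
      (g t = bpt K /\ met_in_order t q)
  end.

Definition conf n := ((R -> R3) * ('I_n -> bool -> R) * R)%type.

(** Isotopies of curves with chosen parameters. The Boolean imposes the order seen from the base
    point, so that one argument covers both complexes. *)
Definition step (b : bool) n (a a' : conf n) : Prop := exists H Q (T : R -> R),
  [/\ sing_path H Q, smooth T,
      forall u, 0 <= u <= 1 -> b -> met_in_order (T u) (Q u),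
      (H 0, Q 0, T 0) = a & (H 1, Q 1, T 1) = a'].

Definition req (b : bool) n := clos_refl_sym_trans (conf n) (@step b n).

Lemma met_lift n (i : 'I_n.+1) t (q : 'I_n.+1 -> bool -> R) : met_in_order t q ->
  met_in_order t (fun j => q (fintype.lift i j)).
Proof.
move=> [m1 m2]; split=> [j|j k jk]; first exact: m1.
by apply: m2; rewrite /= ltnNge leq_bump2 -ltnNge.
Qed.

Lemma rep_good c n (x : cube R c n) g q t : rep x g q t -> good (based c) g q t.
Proof.
by case: c x => [x [K [_ _ [sg0 _]]]|x [K [[_ _ [sg0 _]] [_ mo]]]].
Qed.

Lemma rep_exists c n g (q : 'I_n -> bool -> R) t : good (based c) g q t ->
  exists x : cube R c n, rep x g q t.
Proof.
case: c => [[sing _]|[sing mo]].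
  pose K := SKnot (ex_intro _ q (conj sing (fun i => erefl (g (q i false))))).
  by exists (class0 K), K; split.
pose K := SKnot (ex_intro _ q (conj sing (fun i => erefl (g (q i false))))).
have P : exists t0 q0, [/\ curve K t0 = g t, double_at (curve K) (dpt K) q0 &
    met_in_order t0 q0] by exists t, q; split=> //; exact: mo.
by exists (classb (BKnot P)), (BKnot P); split; [split|split=> //; exact: mo].
Qed.

Lemma rep_ex c n (x : cube R c n) : exists g q t, rep x g q t.
Proof.
case: c x => x.
  have [q dq] := sknotP (repr0 x); exists (curve (repr0 x)), q, 0, (repr0 x).
  by split=> //; rewrite /class0 /repr0 reprK.
have [t [q [ct dq mo]]] := bknotP (reprb x).
exists (curve (reprb x)), q, t, (reprb x).
by split=> //; split=> //; rewrite /classb /reprb reprK.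
Qed.

Lemma class0P n (K K' : sknot R n) : class0 K = class0 K' <->
  clos_refl_sym_trans _ (@isotopic R n) K K'.
Proof.
rewrite /class0; split=> [/eqmodP/asboolP//|h].
by apply/eqmodP/asboolP.
Qed.

Lemma classbP n (K K' : bknot R n) : classb K = classb K' <->
  clos_refl_sym_trans _ (@bisotopic R n) K K'.
Proof.
rewrite /classb; split=> [/eqmodP/asboolP//|h].
by apply/eqmodP/asboolP.
Qed.

Lemma rep_step c n (x x' : cube R c n) g q t g' q' t' :
  rep x g q t -> rep x' g' q' t' -> step (based c) (g, q, t) (g', q', t') ->
  x = x'.
Proof.
case: c x x' => x x'.
  move=> [K [<- <- dK]] [K' [<- <- dK']] [H [Q [T [sH _ _ [H0 Q0 _] [H1 Q1 _]]]]].
  apply/class0P/rst_step; exists H, Q; split=> //.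
    by rewrite H0 Q0.
  by rewrite H1 Q1.
move=> [K [[<- <- dK] [bK _]]] [K' [[<- <- dK'] [bK' _]]].
move=> [H [Q [T [sH sT mo [H0 Q0 T0] [H1 Q1 T1]]]]].
apply/classbP/rst_step; exists H, Q, T; split=> //.
- split=> //; first by rewrite H0 Q0.
  by rewrite H1 Q1.
- by move=> u u01; exact: mo.
- by rewrite T0.
- by rewrite T1.
Qed.

Lemma step_good (b : bool) n (a a' : conf n) : step b a a' ->
  good b a.1.1 a.1.2 a.2 /\ good b a'.1.1 a'.1.2 a'.2.
Proof.
move=> [H [Q [T [[_ _ sH] _ mo <- <-]]]] /=.
have h0 : 0 <= (0 : R) <= 1 by rewrite lexx ler01.
have h1 : 0 <= (1 : R) <= 1 by rewrite lexx ler01.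
by split; (split; [exact: sH|exact: mo]).
Qed.

Lemma step_const (b : bool) n H (q : 'I_n -> bool -> R) t : smooth_family H ->
  (forall u, 0 <= u <= 1 -> singular (H u) q) -> (b -> met_in_order t q) ->
  step b (H 0, q, t) (H 1, q, t).
Proof.
move=> CH sH mo; exists H, (fun=> q), (fun=> t); split=> //.
- by split=> // i e; exact: smooth_cst.
- exact: smooth_cst.
Qed.

Lemma step_refl (b : bool) n g (q : 'I_n -> bool -> R) t : good b g q t ->
  step b (g, q, t) (g, q, t).
Proof.
move=> [sing mo]; apply: (@step_const b n (fun=> g)) => //.
have [[Cg _ _] _ _ _] := sing.
exact: (smooth_comp_3 Cg (@smooth_snd _ _ _)).
Qed.

Lemma req_good (b : bool) n (a a' : conf n) : req b a a' ->
  good b a.1.1 a.1.2 a.2 <-> good b a'.1.1 a'.1.2 a'.2.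
Proof.
elim=> // [{}a {}a' /step_good[]//|{}a {}a' _ ->//|{}a b' {}a' _ -> _ ->//].
Qed.

Lemma req_rep c n (a a' : conf n) : req (based c) a a' ->
  forall x x' : cube R c n,
  rep x a.1.1 a.1.2 a.2 -> rep x' a'.1.1 a'.1.2 a'.2 -> x = x'.
Proof.
elim=> [{}a {}a' st|{}a|{}a {}a' _ IH|{}a d {}a' rad IH1 _ IH2] x x' rx rx'.
- by apply: (rep_step rx rx'); case: a a' st {rx rx'} => -[? ?] ? [[? ?] ?].
- by apply: (rep_step rx rx'); apply: step_refl; exact: rep_good rx.
- by rewrite (IH x' x).
(* The intermediate triple is good, hence represents some cube, through which the two equalities are
   chained. *)
- have gd := (req_good rad).1 (rep_good rx).
  have [y ry] := rep_exists gd.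
  by rewrite (IH1 x y)// (IH2 y x').
Qed.

Lemma smooth_family_reparam H (a : R -> R) :
  smooth_family H -> smooth a -> smooth_family (fun u => H (a u)).
Proof.
move=> CH Ca; apply: (smooth_family_app CH); last exact: smooth_snd.
exact: (smooth_comp Ca (@smooth_fst _ _ _)).
Qed.

Lemma smooth_affine (a c : R) : smooth (fun u => a + c * u).
Proof.
apply: smoothD; first exact: smooth_cst.
by apply: smoothM; [exact: smooth_cst|exact: smooth_id].
Qed.

(** Every opening ends, up to isotopy, at a small standard push-off: run [H] back from 1 to a small
    [u], then mix [H u] linearly with the push-off by [interp]. *)
Lemma opens_req (b : bool) n (i : 'I_n.+1) s g q t H : good b g q t ->
  ropens i s g q H -> exists2 d : R, 0 < d & forall u, 0 < u < d ->
    req b (H 1, fun j => q (fintype.lift i j), t)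
     (pert g q ((u * sg s) *: delta_mx 0 i), fun j => q (fintype.lift i j), t).
Proof.
move=> [sing mo] op; have [CH H0 sH _] := op.
have [d d0 dH] := interp sing op.
have mol : b -> met_in_order t (fun j => q (fintype.lift i j)).
  by move=> /mo/met_lift; exact.
exists (Num.min d 1); first by rewrite lt_min d0 ltr01.
move=> u; rewrite lt_min => /andP[u0 /andP[ud u1]].
apply: (@rst_trans _ _ _ (H u, fun j => q (fintype.lift i j), t)).
  have -> : H 1 = H (1 + (u - 1) * 0) by rewrite mulr0 addr0.
  have -> : H u = H (1 + (u - 1) * 1) by rewrite mulr1 addrC subrK.
  apply/rst_step; apply: (@step_const b n (fun x => H (1 + (u - 1) * x))) => //.
    by apply: smooth_family_reparam => //; exact: smooth_affine.
  move=> x /andP[x0 x1]; apply: sH; apply/andP; split; nra.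
apply/rst_step; have [[Cg _ _] _ _ _] := sing.
pose G x y := (1 - x) *: H u y + x *: pert g q ((u * sg s) *: delta_mx 0 i) y.
have -> : H u = G 0.
  by apply/funext => y; rewrite /G subr0 scale1r scale0r addr0.
have -> : pert g q ((u * sg s) *: delta_mx 0 i) = G 1.
  by apply/funext => y; rewrite /G subrr scale1r scale0r add0r.
apply: step_const => //; last by move=> x x01; apply: dH; rewrite // ?u0// ltW.
apply: smoothD; apply: smoothZ3; try exact: smooth_fst.
- by apply: smoothB; [exact: smooth_cst|exact: smooth_fst].
- by apply: (smooth_family_app CH); [exact: smooth_cst|exact: smooth_snd].
- by apply: smooth_slice => // [|j]; [exact: smooth_snd|exact: smooth_cst].
Qed.

Lemma norm_delta n (i : 'I_n) (x d : R) : `|x| < d ->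
  `|x *: delta_mx 0 i : 'rV[R]_n| < d.
Proof.
move=> xd; rewrite [ltLHS]/Num.Def.normr/= mx_normrE bigmax_lt//=.
  exact: le_lt_trans xd.
move=> -[k j] _; rewrite !mxE/= ord1 eqxx/=; case: eqP => _.
  by rewrite mulr1.
by rewrite mulr0 normr0; exact: le_lt_trans xd.
Qed.

Lemma delta_supp n (i : 'I_n.+1) (a : R) j : a != 0 ->
  (a *: delta_mx 0 i : 'rV[R]_n.+1) 0 j = 0 <-> exists k, j = fintype.lift i k.
Proof.
move=> a0; rewrite !mxE eqxx/=; case: (unliftP i j) => [k ->|->].
  rewrite eq_sym (negbTE (neq_lift _ _)) mulr0.
  by split=> // _; exists k.
rewrite eqxx mulr1; split=> [/eqP|[k ik]]; first by rewrite (negbTE a0).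
by have := neq_lift i k; rewrite -ik eqxx.
Qed.

(** Both openings are replaced by push-offs of a common size [u], small enough for the whole path;
    pushing off along the path then joins the two ends. *)
Lemma opens_path (b : bool) n (i : 'I_n.+1) s (H : R -> R -> R3)
    (Q : R -> 'I_n.+1 -> bool -> R) (T : R -> R) (H1 H2 : R -> R -> R3) :
  sing_path H Q -> smooth T ->
  (forall u, 0 <= u <= 1 -> b -> met_in_order (T u) (Q u)) ->
  ropens i s (H 0) (Q 0) H1 -> ropens i s (H 1) (Q 1) H2 ->
  req b (H1 1, fun j => Q 0 (fintype.lift i j), T 0)
        (H2 1, fun j => Q 1 (fintype.lift i j), T 1).
Proof.
move=> sH CT mo op1 op2; have [CH CQ sing] := sH.
have h0 : 0 <= (0 : R) <= 1 by rewrite lexx ler01.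
have h1 : 0 <= (1 : R) <= 1 by rewrite lexx ler01.
have g0 : good b (H 0) (Q 0) (T 0) by split; [exact: sing|exact: mo].
have g1 : good b (H 1) (Q 1) (T 1) by split; [exact: sing|exact: mo].
have [d1 d10 r1] := opens_req g0 op1; have [d2 d20 r2] := opens_req g1 op2.
have [d3 d30 ok] := perturb sH.
pose u := Num.min d1 (Num.min d2 d3) / 2.
have m0 : 0 < Num.min d1 (Num.min d2 d3) by rewrite !lt_min d10 d20.
have u0 : 0 < u by rewrite divr_gt0.
have um : u < Num.min d1 (Num.min d2 d3) by rewrite /u; lra.
move: um; rewrite !lt_min => /andP[ud1 /andP[ud2 ud3]].
have s0 : sg s != 0 by rewrite -normr_eq0 bsign_norm oner_eq0.
apply: rst_trans (r1 u _) _; first by rewrite u0.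
apply: rst_trans (rst_sym _ _ _ _ (r2 u _)); last by rewrite u0.
apply/rst_step; pose G x := pert (H x) (Q x) ((u * sg s) *: delta_mx 0 i).
exists G, (fun x j => Q x (fintype.lift i j)), T; split=> //.
- split.
  + apply: smooth_pert => //; [exact: smooth_fst|exact: smooth_snd|].
    by move=> j; exact: smooth_cst.
  + by move=> j e; exact: CQ.
  + move=> x x01; apply: pert_singular; first exact: sing.
    * by apply: ok => //; apply: norm_delta; rewrite normrM bsign_norm mulr1 gtr0_norm.
    * exact: lift_inj.
    * by move=> j; apply: delta_supp; rewrite mulf_neq0// gt_eqF.
- by move=> x x01 /mo h; apply: met_lift; exact: h.
Qed.

End Representatives.

(** * Change of the parameters of the double points *)

Section Faces.
Variable R : realType.
Local Notation R3 := 'rV[R]_3.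
Local Notation sg s := (bsign R s).

(** The double points of a curve determine their parameters modulo 1 and up to exchanging the two
    branches at each of them. *)
Definition relabel n (q q' : 'I_n -> bool -> R) :=
  forall i, exists e, forall e', eqZ (q' i e') (q i (e (+) e')).

Lemma relabel_lift n (i : 'I_n.+1) (q q' : 'I_n.+1 -> bool -> R) :
  relabel q q' ->
  relabel (fun j => q (fintype.lift i j)) (fun j => q' (fintype.lift i j)).
Proof. by move=> qq' j; exact: qq'. Qed.

Lemma eqZ_periodic (T : Type) (g : R -> T) s t :
  (forall t, g (t + 1) = g t) -> eqZ s t -> g s = g t.
Proof. by move=> g1 /eqZP[k ->]; exact: periodicZ. Qed.

Lemma indepC (u v : R3) : indep u v -> indep v u.
Proof.
move=> /indepP uv; apply/indepP => x y xy.
by have [] := uv y x; rewrite // addrC.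
Qed.

Lemma singular_relabel n g (q q' : 'I_n -> bool -> R) :
  relabel q q' -> singular g q -> singular g q'.
Proof.
move=> qq' sing; have [gi dq inj ind] := sing; have [Cg g1 _] := gi.
have dg1 := derive1_periodic g1.
apply: singularI; first exact: gi.
- move=> i e j e'; have [a ha] := qq' i; have [c hc] := qq' j => ee'.
  have [ij] : i = j /\ a (+) e = c (+) e'.
    apply: dq; apply: eqZ_trans (eqZ_sym (ha e)) _.
    exact: eqZ_trans ee' (hc e').
  subst j; have [_ /addbI ->//] : i = i /\ a (+) e = a (+) e'.
  apply: dq; apply: eqZ_trans (eqZ_sym (ha e)) _.
  exact: eqZ_trans ee' (ha e').
- move=> j; have [e he] := qq' j.
  rewrite (eqZ_periodic g1 (he false)) (eqZ_periodic g1 (he true)).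
  have := singular_chord j sing.
  by case: e {he} => /=.
- move=> s t /inj[|[j [e [se te]]]]; first by left.
  right; have [a ha] := qq' j; exists j, (a (+) e); split.
    apply: (eqZ_trans se); apply: eqZ_sym; apply: (eqZ_trans (ha _)).
    by rewrite addbA addbb addFb; exact: eqZ_refl.
  apply: (eqZ_trans te); apply: eqZ_sym; apply: (eqZ_trans (ha _)).
  by rewrite -addbN addbA addbb addFb; exact: eqZ_refl.
- move=> j; have [e he] := qq' j.
  rewrite (eqZ_periodic dg1 (he false)) (eqZ_periodic dg1 (he true)).
  case: e {he} => /=; last exact: ind.
  exact/indepC/ind.
Qed.

(** An opening is controlled only for 0 <= u <= 1, while [derive1] is two-sided; derivability lets
    the derivative be computed from the right. *)
Lemma derive1_right0 (f : R -> R3) : derivable f 0 1 ->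
  (forall u, 0 <= u <= 1 -> f u = 0) -> derive1 f 0 = 0.
Proof.
move=> df f0; rewrite derive1E.
rewrite /derive cvg_at_rightE//; apply: lim_near_cst => //.
near=> h; rewrite /= addr0 [h *: 1]mulr1 f0; last first.
  by apply/andP; split; apply: ltW; near: h;
    [exact: nbhs_right_gt|exact: nbhs_right_lt].
by rewrite f0 ?subrr ?scaler0// lexx ler01.
Unshelve. all: by end_near. Qed.

Lemma double_relabel n g p (q q' : 'I_n -> bool -> R) :
  double_at g p q -> double_at g p q' -> relabel q q'.
Proof.
move=> [sing pq] [sing' pq'] i.
have [_ dq inj _] := sing; have [_ dq' _ _] := sing'.
have E e : g (q' i e) = g (q i false).
  rewrite -pq pq'; case: e => //.
  by rewrite (singular_chord _ sing').
have F e : exists e', eqZ (q' i e) (q i e').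
  have /inj[h|[j [e' [h1 h2]]]] := E e; first by exists false.
  have [ij _] := dq _ _ _ _ h2; subst j.
  by exists e'.
have [a ha] := F false; have [c hc] := F true.
exists a => -[]; last by rewrite addbF.
rewrite addbT; suff -> : ~~ a = c by [].
case: (a =P c) => [ac|]; last by case: (a); case: (c).
have [_ //] : i = i /\ false = true.
by apply: dq'; apply: (eqZ_trans ha); rewrite ac; exact: eqZ_sym.
Qed.

End Faces.

(** * Existence and uniqueness of faces *)

Section FaceTheory.
Variable R : realType.
Local Notation R3 := 'rV[R]_3.
Local Notation sg s := (bsign R s).

Lemma derive1_right_eq (f h : R -> R3) : derivable f 0 1 -> derivable h 0 1 ->
  (forall u, 0 <= u <= 1 -> f u = h u) -> derive1 f 0 = derive1 h 0.
Proof.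
move=> df dh fh.
have z : derive1 (f - h) 0 = 0.
  apply: derive1_right0; first exact: derivableB.
  by move=> u u01; rewrite -[LHS]/(f u - h u) fh// subrr.
rewrite (derive1E (f - h) 0) (deriveB df dh) in z.
by apply/eqP; rewrite (derive1E f 0) (derive1E h 0) -subr_eq0 z.
Qed.

(** Exchanging the branches swaps the two tangents and reverses their relative velocity, so the
    determinant keeps its sign; integral shifts of the parameters are absorbed by periodicity. *)
Lemma ropens_relabel n (i : 'I_n.+1) s (g : R -> R3) (q q' : 'I_n.+1 -> bool -> R)
    (H : R -> R -> R3) :
  singular g q -> relabel q q' ->
  ropens i s g q H -> ropens i s g q' H.
Proof.
move=> sing qq' [CH H0 sH sgn]; have [[_ g1 _] _ _ _] := sing.
have dg1 := derive1_periodic g1.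
split; [exact: CH|exact: H0| |].
  move=> u u01; apply: (@singular_relabel _ _ _ (fun j => q (fintype.lift i j))).
    exact: relabel_lift.
  exact: sH.
have H1 u : 0 <= u <= 1 -> forall t, H u (t + 1) = H u t.
  move=> /andP[u0 u1]; move: u0; rewrite le_eqVlt => /predU1P[<-|u0].
    by rewrite H0.
  by have [[_ + _] _ _ _] := sH u (introT andP (conj u0 u1)).
have dD a b : derivable (fun u => H u a - H u b) 0 1.
  by apply: smooth_derivable; exact: smooth_separation.
have [e he] := qq' i.
rewrite (eqZ_periodic dg1 (he false)) (eqZ_periodic dg1 (he true)).
pose D u := H u (q i false) - H u (q i true).
pose D' u := H u (q' i false) - H u (q' i true).
have E u : 0 <= u <= 1 -> D' u = if e then - D u else D u.
  move=> u01; have Hu := H1 u u01; rewrite /D' /D.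
  rewrite (eqZ_periodic Hu (he false)) (eqZ_periodic Hu (he true)).
  by case: (e) => //=; rewrite opprB.
have dD' : derivable D' 0 1 by exact: dD.
have dD0 : derivable D 0 1 by exact: dD.
rewrite -/D in sgn; rewrite -/D'; case: e he E => he E /=; last first.
  by rewrite (derive1_right_eq dD' dD0 E).
have dND : derivable (- D) 0 1 by exact: derivableN.
rewrite (derive1_right_eq dD' dND E) (derive1E (- D) 0) (deriveN dD0).
by rewrite -(derive1E D 0) det3C det3N opprK.
Qed.

Lemma met_eqZ n (t : R) (q : 'I_n -> bool -> R) j e : met_in_order t q -> ~ eqZ t (q j e).
Proof.
move=> [/(_ j)[h1 h2 h3] _] /eqZP[k tk].
have /andP[a b] : t < q j e < t + 1.
  by case: e {tk} => /=; [rewrite h3 andbT; exact: lt_trans h2|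
    rewrite h1; exact: lt_trans h3].
have : k%:~R < (0 : R) by lra.
have : (-1)%:~R < k%:~R :> R by rewrite mulrN1z; lra.
by rewrite ltrz0 ltr_int; lia.
Qed.

Lemma rep_relabel c n (x x' : cube R c n) g (q q' : 'I_n -> bool -> R) t t' :
  relabel q q' ->
  good (based c) g q' t' -> (based c -> eqZ t t') ->
  rep x g q t -> rep x' g q' t' -> x = x'.
Proof.
move=> qq' gd' tt' rx rx'.
have chord p : double_at g p q -> double_at g p q'.
  move=> [sing pq]; split; first exact: (singular_relabel qq').
  have [[_ g1 _] _ _ _] := sing.
  move=> i; rewrite pq; have [e he] := qq' i.
  rewrite (eqZ_periodic g1 (he false)); case: (e) => //=.
  exact: (singular_chord i sing).
suff : rep x g q' t'.
  by move=> r; apply: (rep_step r rx'); exact: step_refl.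
case: c x x' gd' tt' rx rx' => x x' [sing' mo'] tt'.
  by move=> [K [Kx Kg dK]] _; exists K; split=> //; exact: chord.
move=> [K [[Kx Kg dK] [bK mo]]] _; exists K; split; first by split=> //; exact: chord.
split; last exact: mo'.
rewrite -bK; apply: esym; apply: eqZ_periodic (tt' isT).
by have [[]] := sing'.
Qed.

Lemma face_rep c n i s (x : cube R c n.+1) (y : cube R c n) :
  cube_face i s x y <-> exists g q t H, [/\ rep x g q t, ropens i s g q H &
    rep y (H 1) (fun j => q (fintype.lift i j)) t].
Proof.
case: c x y => x y; split.
- move=> [K [K' [Kx Ky [H [q [CH [H0 dK] [H1 dK'] sH sgn]]]]]].
  exists (curve K), q, 0, H; split; [by exists K| |].
  + by split; [exact: CH|exact: H0|exact: sH|exact: sgn].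
  + by exists K'; rewrite H1; split.
- move=> [g [q [t [H [[K [Kx Kg dK]] [CH H0 sH sgn] [K' [Ky Kg' dK']]]]]]].
  exists K, K'; split; [exact: Kx|exact: Ky|exists H, q].
  rewrite /opens Kg Kg'; split; [exact: CH|by split|by split|exact: sH|exact: sgn].
- move=> [K [K' [Kx Ky [H [q [t [[CH [H0 dK] [H1 dK'] sH sgn] mo bK bK']]]]]]].
  exists (curve K), q, t, H; split; [by exists K| |].
  + by split; [exact: CH|exact: H0|exact: sH|exact: sgn].
  + by exists K'; rewrite H1; split; split=> //; exact: met_lift.
- move=> [g [q [t [H [[K [[Kx Kg dK] [bK mo]] [CH H0 sH sgn]
    [K' [[Ky Kg' dK'] [bK' mo']]]]]]]]].
  exists K, K'; split; [exact: Kx|exact: Ky|exists H, q, t].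
  rewrite /opens Kg Kg'; split; [|exact: mo|exact: bK|exact: bK'].
  by split; [exact: CH|split|split|exact: sH|exact: sgn].
Qed.

Lemma opens_exists n g (q : 'I_n.+1 -> bool -> R) i s : singular g q ->
  exists H, ropens i s g q H.
Proof.
move=> sing; have [[Cg _ _] _ _ _] := sing.
have sp : sing_path (fun=> g) (fun=> q).
  split=> //; last by move=> k e; exact: smooth_cst.
  exact: (smooth_comp_3 Cg (@smooth_snd _ _ _)).
have [d d0 ok] := perturb sp.
have h0 : 0 <= (0 : R) <= 1 by rewrite lexx ler01.
exists (fun x => pert g q (0 + (x * (d / 2 * sg s)) *: delta_mx 0 i)).
rewrite -[g in ropens _ _ g](pert0 g q).
apply: (@opens_pert _ _ _ _ _ _ id) => //; last first.
- move=> x x01; apply: (ok 0) => //; rewrite add0r; apply: norm_delta.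
  rewrite !normrM bsign_norm mulr1 !ger0_norm; move: x01 => /andP[]; nra.
- by rewrite divr_gt0.
- by move=> j; rewrite mxE; split=> // _; exists j.
Qed.

Lemma face_exists c n i s (x : cube R c n.+1) : exists y, cube_face i s x y.
Proof.
have [g [q [t rx]]] := rep_ex x; have [sing mo] := rep_good rx.
have [H op] := opens_exists i s sing; have [_ _ sH _] := op.
have gd : good (based c) (H 1) (fun j => q (fintype.lift i j)) t.
  split; first by apply: sH; rewrite lexx ltr01.
  by move=> /mo/met_lift; exact.
have [y ry] := rep_exists gd.
by exists y; apply/face_rep; exists g, q, t, H.
Qed.

(** Uniqueness of faces amounts to this relation between any two triples that represent one cube. It
    composes along chains of isotopies because every good triple has openings. *)
Definition same_end c n (a a' : conf R n.+1) := forall i s H H' (y y' : cube R c n),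
  ropens i s a.1.1 a.1.2 H -> ropens i s a'.1.1 a'.1.2 H' ->
  rep y (H 1) (fun j => a.1.2 (fintype.lift i j)) a.2 ->
  rep y' (H' 1) (fun j => a'.1.2 (fintype.lift i j)) a'.2 -> y = y'.

Lemma same_end_step c n (a a' : conf R n.+1) : step (based c) a a' ->
  same_end c a a'.
Proof.
move=> [H [Q [T [sH CT mo <- <-]]]] i s H1 H2 y y' /= o1 o2 r1 r2.
exact: (req_rep (opens_path sH CT mo o1 o2) r1 r2).
Qed.

Lemma same_end_relabel c n g (q q' : 'I_n.+1 -> bool -> R) t t' : relabel q q' ->
  good (based c) g q t -> good (based c) g q' t' ->
  (based c -> eqZ t t') -> same_end c (g, q, t) (g, q', t').
Proof.
move=> qq' gd gd' tt' i s H H' y y' /= o1 o2 r1 r2.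
have o1' := ropens_relabel gd.1 qq' o1.
have [_ _ sH _] := o1'.
have gl : good (based c) (H 1) (fun j => q' (fintype.lift i j)) t'.
  split; first by apply: sH; rewrite lexx ltr01.
  by case: gd' => _ mo /mo/met_lift; exact.
have [y2 ry2] := rep_exists gl.
rewrite (rep_relabel (relabel_lift i qq') gl tt' r1 ry2).
exact: (same_end_step (step_refl gd') o1' o2 ry2 r2).
Qed.

Lemma same_end_trans c n (a d a' : conf R n.+1) :
  good (based c) d.1.1 d.1.2 d.2 ->
  same_end c a d -> same_end c d a' -> same_end c a a'.
Proof.
move=> [sing mo] ad da i s H H' y y' o1 o2 r1 r2.
have [H'' op] := opens_exists i s sing; have [_ _ sH _] := op.
have gl : good (based c) (H'' 1) (fun j => d.1.2 (fintype.lift i j)) d.2.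
  split; first by apply: sH; rewrite lexx ltr01.
  by move=> /mo/met_lift; exact.
have [y2 ry2] := rep_exists gl.
by rewrite (ad _ _ _ _ _ _ o1 op r1 ry2) (da _ _ _ _ _ _ op o2 ry2 r2).
Qed.

Lemma same_end_sym c n (a a' : conf R n.+1) : same_end c a a' -> same_end c a' a.
Proof.
by move=> h i s H H' y y' o1 o2 r1 r2; apply/esym; exact: (h _ _ _ _ _ _ o2 o1 r2 r1).
Qed.

(** Induction on the generated equivalence. Each isotopy comes with its own parameters, which may
    differ from those chosen for the knots at its ends; a relabelling is inserted on either side. *)
Lemma rep_same_end c n (x : cube R c n.+1) g q t g' q' t' :
  rep x g q t -> rep x g' q' t' -> same_end c (g, q, t) (g', q', t').
Proof.
case: c x => x.
  move=> [K [Kx <- dK]] [K' [Kx' <- dK']].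
  have : class0 K = class0 K' by rewrite Kx Kx'.
  move=> /class0P h; elim: h q t q' t' {Kx Kx'} dK dK'.
  + move=> {}K {}K' [H [Q [sH [H0 d0] [H1 d1]]]] q t q' t' dK dK'.
    apply: (@same_end_trans _ _ _ (curve K, Q 0, 0)).
    * by split=> //; case: d0.
    * apply: same_end_relabel => //; first exact: double_relabel dK d0.
        by split=> //; case: dK.
      by split=> //; case: d0.
    apply: (@same_end_trans _ _ _ (curve K', Q 1, 0)).
    * by split=> //; case: d1.
    * apply: same_end_step; exists H, Q, (fun=> 0); rewrite H0 H1; split=> //.
      exact: smooth_cst.
    apply: same_end_relabel => //; first exact: double_relabel d1 dK'.
      by split=> //; case: d1.
    by split=> //; case: dK'.
  + move=> {}K q t q' t' dK dK'; apply: same_end_relabel => //.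
    * exact: double_relabel dK dK'.
    * by split=> //; case: dK.
    * by split=> //; case: dK'.
  + by move=> {}K {}K' _ IH q t q' t' dK dK'; apply/same_end_sym/IH.
  + move=> {}K K1 {}K' _ IH1 _ IH2 q t q' t' dK dK'.
    have [q1 d1] := sknotP K1.
    apply: (@same_end_trans _ _ _ (curve K1, q1, 0)).
    * by split=> //; case: d1.
    * exact: IH1.
    * exact: IH2.
move=> [K [[Kx <- dK] [bK mo]]] [K' [[Kx' <- dK'] [bK' mo']]].
have : classb K = classb K' by rewrite Kx Kx'.
have rel (L : bknot R n.+1) q1 t1 q2 t2 : double_at (curve L) (dpt L) q1 ->
  double_at (curve L) (dpt L) q2 -> curve L t1 = bpt L -> curve L t2 = bpt L ->
  met_in_order t1 q1 -> met_in_order t2 q2 ->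
  same_end CKb (curve L, q1, t1) (curve L, q2, t2).
  move=> d1 d2 b1 b2 m1 m2; apply: same_end_relabel.
  - exact: double_relabel d1 d2.
  - by split=> //; case: d1.
  - by split=> //; case: d2.
  (* A base point is no double point, so its parameter is determined modulo 1. *)
  - move=> _; have [[_ _ inj _] _] := d1.
    have /inj[//|[j [e [h _]]]] : curve L t1 = curve L t2 by rewrite b1 b2.
    by case: (met_eqZ m1 h).
move=> /classbP h; elim: h q t q' t' {Kx Kx'} dK bK mo dK' bK' mo'.
+ move=> {}K {}K' [H [Q [T [[sH [H0 d0] [H1 d1]] CT moT b0 b1]]]].
  move=> q t q' t' dK bK mo dK' bK' mo'.
  have h0 : 0 <= (0 : R) <= 1 by rewrite lexx ler01.
  have h1 : 0 <= (1 : R) <= 1 by rewrite lexx ler01.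
  apply: (@same_end_trans _ _ _ (curve K, Q 0, T 0)).
  * by split=> [|_]; [case: d0|exact: moT].
  * by apply: rel => //; exact: moT.
  apply: (@same_end_trans _ _ _ (curve K', Q 1, T 1)).
  * by split=> [|_]; [case: d1|exact: moT].
  * apply: same_end_step; exists H, Q, T; rewrite H0 H1; split=> // u u01 _.
    exact: moT.
  by apply: rel => //; exact: moT.
+ by move=> {}K q t q' t' dK bK mo dK' bK' mo'; apply: rel.
+ by move=> {}K {}K' _ IH q t q' t' dK bK mo dK' bK' mo'; apply/same_end_sym/IH.
+ move=> {}K K1 {}K' _ IH1 _ IH2 q t q' t' dK bK mo dK' bK' mo'.
  have [t1 [q1 [b1 d1 m1]]] := bknotP K1.
  apply: (@same_end_trans _ _ _ (curve K1, q1, t1)).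
  * by split=> //; case: d1.
  * exact: IH1.
  * exact: IH2.
Qed.

Lemma face_uniq c n i s (x : cube R c n.+1) y y' :
  cube_face i s x y -> cube_face i s x y' -> y = y'.
Proof.
move=> /face_rep[g [q [t [H [rx op ry]]]]] /face_rep[g' [q' [t' [H' [rx' op' ry']]]]].
exact: (rep_same_end rx rx' op op' ry ry').
Qed.

End FaceTheory.

(** * The relative cocycle of an invariant *)

Section Commutation.
Variable R : realType.
Local Notation R3 := 'rV[R]_3.
Local Notation sg s := (bsign R s).

Lemma lift_lift0 n (j : 'I_n.+1) (k : 'I_n) :
  fintype.lift (fintype.lift ord0 j) (fintype.lift ord0 k) =
  fintype.lift ord0 (fintype.lift j k).
Proof. by apply: val_inj; rewrite /= /bump /= !add1n ltnS; case: leqP. Qed.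

Lemma lift_lift00 n (j : 'I_n.+1) :
  fintype.lift (fintype.lift ord0 j) ord0 = ord0 :> 'I_n.+2.
Proof. exact: val_inj. Qed.

Lemma ropens_rep c n (x : cube R c n.+1) g q t i s H :
  rep x g q t -> ropens i s g q H -> forall y : cube R c n,
  rep y (H 1) (fun j => q (fintype.lift i j)) t -> cube_face i s x y.
Proof. by move=> rx op y ry; apply/face_rep; exists g, q, t, H. Qed.

Lemma ropens_end c n (x : cube R c n.+1) g q t i s H :
  rep x g q t -> ropens i s g q H -> exists y : cube R c n,
  rep y (H 1) (fun j => q (fintype.lift i j)) t.
Proof.
move=> rx [_ _ sH _]; have [_ mo] := rep_good rx.
apply: rep_exists; split; first by apply: sH; rewrite lexx ltr01.
by move=> /mo/met_lift; exact.
Qed.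

(** One push-off with two nonzero entries realises both orders of resolving: the entries are
    switched on one after the other, and the final curve is literally the same. *)
Lemma face_commute n (x : X0 R n.+2) (j : 'I_n.+1) s s' : exists y y' z,
  [/\ face0 (fintype.lift ord0 j) s x y, face0 ord0 s' x y',
      face0 ord0 s' y z & face0 j s y' z].
Proof.
have [g [q [t rx]]] := rep_ex (x : cube R CK0 n.+2).
have [sing _] := rep_good rx; have [[Cg _ _] _ _ _] := sing.
have sp : sing_path (fun=> g) (fun=> q).
  split=> //; last by move=> k e; exact: smooth_cst.
  exact: (smooth_comp_3 Cg (@smooth_snd _ _ _)).
have [d d0 ok0] := perturb sp.
have h0 : 0 <= (0 : R) <= 1 by rewrite lexx ler01.
have ok u : `|u| < d -> pert_ok g q u by exact: (ok0 0 u h0).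
(* Each push stays below d / 2, so two together stay below [d]. *)
pose r := d / 4%:R; have r0 : 0 < r by rewrite divr_gt0.
pose j' := fintype.lift ord0 j.
have nr (w : R) (b : bool) : 0 <= w <= 1 -> `|w * (r * sg b)| < d / 2.
  move=> /andP[x0 x1]; rewrite (normrM w) (normrM r) bsign_norm mulr1.
  by rewrite (ger0_norm x0) (gtr0_norm r0) /r; nra.
have n1 : forall (w : R) b (i : 'I_n.+2), 0 <= w <= 1 ->
    `|(w * (r * sg b)) *: delta_mx 0 i : 'rV[R]_n.+2| < d / 2.
  by move=> w b i w01; apply: norm_delta; exact: nr.
have h1 : 0 <= (1 : R) <= 1 by rewrite lexx ler01.
have s0 b : r * sg b != 0.
  apply: mulf_neq0; first by rewrite gt_eqF.
  by rewrite -normr_eq0 bsign_norm oner_eq0.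
have n1' : forall b (i : 'I_n.+2), `|(r * sg b) *: delta_mx 0 i : 'rV[R]_n.+2| < d / 2.
  by move=> b i; have := n1 1 b i h1; rewrite mul1r.
have n2 : forall b b' (i i' : 'I_n.+2) (w : R), 0 <= w <= 1 ->
    `|(r * sg b) *: delta_mx 0 i + (w * (r * sg b')) *: delta_mx 0 i'
      : 'rV[R]_n.+2| < d.
  move=> b b' i i' w w01; apply: (le_lt_trans (ler_normD _ _)).
  by rewrite [ltRHS]splitr ltrD// n1.
have first_open : forall b (i : 'I_n.+2),
    ropens i b g q (fun x => pert g q (0 + (x * (r * sg b)) *: delta_mx 0 i)).
  move=> b i; rewrite -[g in ropens _ _ g](pert0 g q).
  apply: (@opens_pert _ _ _ _ _ _ id) => //.
    by move=> k; rewrite mxE; split=> // _; exists k.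
  move=> x' x01; apply: ok; rewrite add0r; apply: lt_trans (n1 _ _ _ x01) _.
  by rewrite ltr_pdivrMr// ltr_pMr// ltr1n.
have second_open : forall b b' (i : 'I_n.+2) (k : 'I_n.+1),
    ropens k b' (pert g q ((r * sg b) *: delta_mx 0 i))
      (fun l => q (fintype.lift i l))
      (fun x => pert g q ((r * sg b) *: delta_mx 0 i +
         (x * (r * sg b')) *: delta_mx 0 (fintype.lift i k))).
  move=> b b' i k; apply: (@opens_pert _ _ _ _ _ _ (fintype.lift i)) => //.
  - exact: lift_inj.
  - by move=> l; exact: delta_supp.
  - by move=> x' x01; apply: ok; exact: n2.
have [y ry] := ropens_end rx (first_open s j').
have [y' ry'] := ropens_end rx (first_open s' ord0).
have fy := ropens_rep rx (first_open s j') ry.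
have fy' := ropens_rep rx (first_open s' ord0) ry'.
rewrite add0r mul1r in ry; rewrite add0r mul1r in ry'.
have [z rz] := ropens_end ry (second_open s s' j' ord0).
have fz := ropens_rep ry (second_open s s' j' ord0) rz.
have fz' : cube_face (c := CK0) j s y' z.
  apply: (ropens_rep ry' (second_open s' s ord0 j)).
  have Eq : (fun k : 'I_n => q (fintype.lift j' (fintype.lift ord0 k))) =
      (fun k => q (fintype.lift ord0 (fintype.lift j k))).
    by apply/funext => k; rewrite lift_lift0.
  move: rz => /=; rewrite {}Eq !mul1r /j' lift_lift00.
  rewrite [X in pert g q X]addrC; exact (fun h => h).
exists y, y', z; split; [exact: fy|exact: fy'|exact: fz|exact: fz'].
Qed.

End Commutation.

(** * Linear extension over the free module *)

Section FreeGroup.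
Variable K : choiceType.
Implicit Types (phi : K -> rat) (D : {freeg K / rat}).

Lemma fgliftU phi x : fglift (phi : K -> rat^o) << x >> = phi x.
Proof. by rewrite liftU scale1r. Qed.

Lemma fgliftB (M : lmodType rat) (phi : K -> M) D D' :
  fglift phi (D - D') = fglift phi D - fglift phi D'.
Proof. exact: (lift_is_additive phi). Qed.

Lemma fglift0 (M : lmodType rat) (phi : K -> M) : fglift phi 0 = 0.
Proof. by rewrite -(subrr 0) fgliftB subrr. Qed.

Lemma fgliftN (M : lmodType rat) (phi : K -> M) D : fglift phi (- D) = - fglift phi D.
Proof. by rewrite -sub0r fgliftB fglift0 sub0r. Qed.

Lemma fgliftD (M : lmodType rat) (phi : K -> M) D D' :
  fglift phi (D + D') = fglift phi D + fglift phi D'.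
Proof. by rewrite -{1}[D']opprK fgliftB fgliftN opprK. Qed.

Lemma fglift_sum (M : lmodType rat) (phi : K -> M) (I : Type) (r : seq I)
    (F : I -> {freeg K / rat}) :
  fglift phi (\sum_(i <- r) F i) = \sum_(i <- r) fglift phi (F i).
Proof.
elim: r => [|i r IH]; first by rewrite !big_nil fglift0.
by rewrite !big_cons fgliftD IH.
Qed.

Lemma freegZ (a k : rat) (x : K) : a *: << k *g x >> = << a * k *g x >>.
Proof. by apply/eqP/freeg_eqP => y; rewrite coeffZ !coeffU mulrA. Qed.

Lemma fgliftE (M : lmodType rat) (phi : K -> M) D :
  fglift phi D = \sum_(z <- dom D) coeff z D *: phi z.
Proof.
rewrite -[in LHS](freeg_sumE D) fglift_sum.
by apply: eq_bigr => z _; rewrite liftU.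
Qed.

Lemma fgliftZ (M : lmodType rat) (phi : K -> M) a D :
  fglift phi (a *: D) = a *: fglift phi D.
Proof.
rewrite -[in LHS](freeg_sumE D) scaler_sumr fglift_sum fgliftE scaler_sumr.
by apply: eq_bigr => z _; rewrite freegZ liftU scalerA.
Qed.

End FreeGroup.

(** * The extended invariant as a relative cocycle *)

Section Cochains.
Variable R : realType.

Lemma cochain_scalar (X : nat -> choiceType) n (phi : X n -> rat) :
  scalar (cochain_of phi).
Proof. by move=> a D D'; rewrite /cochain_of fgliftD fgliftZ. Qed.

Lemma face_chainE c n (i : 'I_n.+1) s (x : cube R c n.+1) y :
  cube_face i s x y -> face_chain (@cube_face R c) i s x = << y >>.
Proof.
move=> xy; rewrite /face_chain; case: pselect => [h|[]]; last by exists y.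
by rewrite (face_uniq (projT2 (cid h)) xy).
Qed.

Lemma dfaceE c n (i : 'I_n.+1) (x : cube R c n.+1) y y' :
  cube_face i true x y -> cube_face i false x y' ->
  dface (@cube_face R c) i x = << y >> - << y' >>.
Proof. by move=> xy xy'; rewrite /dface (face_chainE xy) (face_chainE xy'). Qed.

Lemma extend_ord0 (v : X0 R 0 -> rat) n (x : X0 R n.+1) y y' :
  face0 ord0 true x y -> face0 ord0 false x y' ->
  extend v x = extend v y - extend v y'.
Proof.
move=> xy xy'; rewrite /= -/(cube_face (c := CK0)).
have -> := @dfaceE CK0 n ord0 x y y' xy xy'.
by rewrite /cochain_of fgliftB !fgliftU.
Qed.

(** [extend] resolves the first double point. For another one, both are resolved in turn and the
    four double resolutions are regrouped by [face_commute]. *)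
Lemma extend_face (v : X0 R 0 -> rat) n (i : 'I_n.+1) (x : X0 R n.+1) y y' :
  face0 i true x y -> face0 i false x y' ->
  extend v x = extend v y - extend v y'.
Proof.
elim: n i x y y' => [|n IH] i x y y' xy xy'.
  have i0 : i = ord0 := ord1 i; rewrite i0 in xy xy'.
  exact: (extend_ord0 v xy xy').
case: (unliftP ord0 i) xy xy' => [j ->|->] xy xy'; last exact: (extend_ord0 v xy xy').
have [yt [y't [zt [a1 b1 c1 d1]]]] := face_commute x j true true.
have [yt2 [y'f [ztf [a2 b2 c2 d2]]]] := face_commute x j true false.
have [yf [y't2 [zft [a3 b3 c3 d3]]]] := face_commute x j false true.
have [yf2 [y'f2 [zff [a4 b4 c4 d4]]]] := face_commute x j false false.
have U := @face_uniq R CK0.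
rewrite (U _ _ _ _ _ _ xy a1) (U _ _ _ _ _ _ xy' a3).
rewrite (U _ _ _ _ _ _ a2 a1) in c2; rewrite (U _ _ _ _ _ _ a4 a3) in c4.
rewrite (U _ _ _ _ _ _ b3 b1) in d3; rewrite (U _ _ _ _ _ _ b4 b2) in d4.
rewrite (extend_ord0 v b1 b2) (IH _ _ _ _ d1 d3) (IH _ _ _ _ d2 d4).
by rewrite (extend_ord0 v c1 c2) (extend_ord0 v c3 c4); ring.
Qed.

Lemma rep_forget c n (x : cube R c n) g q t :
  rep x g q t -> rep (forget x : cube R CK0 n) g q t.
Proof.
case: c x => // x [K [[Kx Kg dK] _]] /=; exists (bsknot K); split=> //.
have : classb K = classb (reprb x) by rewrite Kx /classb /reprb reprK.
move=> /classbP h; apply/class0P.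
elim: h => {Kx Kg dK} [{}K K' [H [Q [T [pK _ _ _ _]]]]|{}K|{}K K' _ IH|
    {}K K1 K' _ IH1 _ IH2].
- by apply: rst_step; exists H, Q.
- exact: rst_refl.
- exact: rst_sym.
- exact: rst_trans IH1 IH2.
Qed.

Lemma face_forget c n i s (x : cube R c n.+1) (y : cube R c n) :
  cube_face i s x y -> face0 i s (forget x) (forget y).
Proof.
move=> /face_rep[g [q [t [H [rx op ry]]]]].
exact: (ropens_rep (rep_forget rx) op (rep_forget ry)).
Qed.

(** This gives both properties of the cochain. A degenerate cube has a direction in which [dface] is
    0, so the value on it is 0; and the value on a boundary is a combination of extensions to knots
    with one more double point, where the invariant vanishes. *)
Lemma cochain_dface c n (v : X0 R 0 -> rat) (i : 'I_n.+1) (x : cube R c n.+1) :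
  vassiliev_cochain v (dface (@cube_face R c) i x) = extend v (forget x).
Proof.
have [y xy] := face_exists i true x; have [y' xy'] := face_exists i false x.
rewrite (dfaceE xy xy') /vassiliev_cochain /cochain_of fgliftB !fgliftU.
by rewrite (extend_face v (face_forget xy) (face_forget xy')).
Qed.

Lemma cochainE c n (v : X0 R 0 -> rat) (D : chain (cube R c) n) :
  vassiliev_cochain v D = \sum_(x <- dom D) coeff x D * extend v (forget x) :> rat.
Proof. exact: (fgliftE (fun K : cube R c n => extend v (forget K) : rat^o)). Qed.

Lemma vassiliev_rel_cochain c n (v : X0 R 0 -> rat) :
  rel_cochain (@cube_face R c) (@vassiliev_cochain R c n v).
Proof.
split; first exact: cochain_scalar.
move=> D Ddeg; rewrite cochainE big_seq big1// => x /Ddeg dx.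
suff -> : extend v (forget x) = 0 by rewrite mulr0.
case: n D Ddeg x dx => // n D _ x [i dx].
by rewrite -(cochain_dface v i) dx /vassiliev_cochain /cochain_of fglift0.
Qed.

Lemma vassiliev_cocycle c n (v : X0 R 0 -> rat) : vassiliev n v ->
  cocycle (@cube_face R c) (@vassiliev_cochain R c n v).
Proof.
move=> hv D; rewrite /boundary fgliftE /vassiliev_cochain /cochain_of.
rewrite fglift_sum big1// => x _; rewrite fgliftZ.
rewrite (_ : fglift _ _ = 0) ?scaler0// fglift_sum big1// => i _.
rewrite fgliftZ -[fglift _ _]/(@vassiliev_cochain R c n v _) cochain_dface.
by rewrite hv scaler0.
Qed.

End Cochains.

(** * Closed two-strand braids *)

Section ClosedBraids.
Variable R : realType.
Local Notation R3 := 'rV[R]_3.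

(* Cylindrical coordinates centred on a core circle of radius 3: the angle in
   turns, the radial deviation and the height. *)
Definition cyl (x a b : R) : R3 :=
  vec3 ((3%:R + a) * cos (2 * pi * x)) b ((3%:R + a) * sin (2 * pi * x)).

Lemma cos2pi (x : R) : cos (2 * pi * x) = 1 - 2 * (sin (pi * x) * sin (pi * x)).
Proof.
rewrite -mulrA mulr_natl cosD -!expr2.
by have := cos2Dsin2 (pi * x); rewrite !expr2; lra.
Qed.

Lemma sin2pi_z (x : R) (k : int) : sin (2 * pi * (x + k%:~R)) = sin (2 * pi * x).
Proof.
rewrite mulrDr sinD [cos (2 * pi * k%:~R)]cos2pi sin_piz mulr0 mulr0 subr0 mulr1.
rewrite (_ : 2 * pi * k%:~R = pi * (k + k)%:~R) ?sin_piz ?mulr0 ?addr0//.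
by rewrite intrD; ring.
Qed.

Lemma cos2pi_z (x : R) (k : int) : cos (2 * pi * (x + k%:~R)) = cos (2 * pi * x).
Proof.
have sk : sin (pi * (x + k%:~R)) * sin (pi * (x + k%:~R)) =
    sin (pi * x) * sin (pi * x).
  rewrite mulrDr sinD sin_piz mulr0 addr0 mulrACA -expr2.
  have := cos2Dsin2 (pi * k%:~R : R).
  by rewrite sin_piz !expr2 mul0r addr0 => ->; rewrite mulr1.
by rewrite !cos2pi sk.
Qed.

Lemma cyl_z x (k : int) a b : cyl (x + k%:~R) a b = cyl x a b.
Proof. by rewrite /cyl cos2pi_z sin2pi_z. Qed.

Lemma cs_eqZ (x x' : R) : cos (2 * pi * x) = cos (2 * pi * x') ->
  sin (2 * pi * x) = sin (2 * pi * x') -> eqZ x x'.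
Proof.
move=> hc hs; rewrite /eqZ -sin_pi_eq0.
have : cos (2 * pi * (x - x')) = 1.
  by rewrite mulrBr cosB hc hs -!expr2 cos2Dsin2.
rewrite cos2pi => h1; have : sin (pi * (x - x')) ^+ 2 = 0 by rewrite expr2; lra.
by move/eqP; rewrite sqrf_eq0 => /eqP.
Qed.

Lemma cyl_inj x a b x' a' b' : 0 < 3%:R + a -> 0 < 3%:R + a' ->
  cyl x a b = cyl x' a' b' -> [/\ eqZ x x', a = a' & b = b'].
Proof.
move=> a0 a'0 h.
have := (congr1 (fun M : R3 => M 0 0) h, congr1 (fun M : R3 => M 0 1) h,
  congr1 (fun M : R3 => M 0 2%:R) h).
rewrite /cyl; have [-> -> ->] := vec3E ((3%:R + a) * cos (2 * pi * x)) b
  ((3%:R + a) * sin (2 * pi * x)).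
have [-> -> ->] := vec3E ((3%:R + a') * cos (2 * pi * x')) b'
  ((3%:R + a') * sin (2 * pi * x')).
move=> -[[hc hb] hs].
have n1 := cos2Dsin2 (2 * pi * x); have n2 := cos2Dsin2 (2 * pi * x').
have sq : (3%:R + a) ^+ 2 = (3%:R + a') ^+ 2.
  transitivity (((3%:R + a) * cos (2 * pi * x)) ^+ 2 +
    ((3%:R + a) * sin (2 * pi * x)) ^+ 2); first by rewrite !exprMn -mulrDr n1 mulr1.
  by rewrite hc hs !exprMn -mulrDr n2 mulr1.
have aa : 3%:R + a = 3%:R + a'.
  by apply/eqP; rewrite -(eqrXn2 (n := 2))// ?sq// ltW.
have an0 : 3%:R + a' != 0 by rewrite gt_eqF.
move: hc hs; rewrite aa => /(mulfI an0) hc /(mulfI an0) hs.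
split=> //; last by lra.
exact: cs_eqZ.
Qed.

Definition strand (w : R -> R * R) (x : R) : R3 := cyl x (w x).1 (w x).2.

Definition dstrand (w dw : R -> R * R) (x : R) : R3 :=
  vec3 ((dw x).1 * cos (2 * pi * x) - (3%:R + (w x).1) * (2 * pi) * sin (2 * pi * x))
    (dw x).2
    ((dw x).1 * sin (2 * pi * x) + (3%:R + (w x).1) * (2 * pi) * cos (2 * pi * x)).

Lemma is_derive_vec3 (f g h : R -> R) (x df dg dh : R) :
  is_derive x 1 f df -> is_derive x 1 g dg -> is_derive x 1 h dh ->
  is_derive x 1 (fun t => vec3 (f t) (g t) (h t)) (vec3 df dg dh).
Proof.
move=> Df Dg Dh.
have E i : (fun t => vec3 (f t) (g t) (h t) 0 i) =
    (fun t => nth 0 [:: f t; g t; h t] i) by apply/funext => t; rewrite mxE.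
have d : derivable (fun t => vec3 (f t) (g t) (h t)) x 1.
  apply/derivable_mxP => i j; rewrite (ord1 i) E; move: j.
  by apply: ord3P => /=; exact: ex_derive.
apply: DeriveDef => //; rewrite derive_mx//; apply/rowP => j; rewrite !mxE E.
by move: j; apply: ord3P => /=; exact: derive_val.
Qed.

Lemma is_derive_scale (c x : R) : is_derive x 1 (fun x => c * x) c.
Proof.
apply: (is_derive_eq (is_deriveM (is_derive_cst c x 1) (is_derive_id x (1 : R)))).
by rewrite -[LHS]/(c * 1 + x * 0) mulr1 mulr0 addr0.
Qed.

Lemma is_derive_cos2pi (x : R) :
  is_derive x 1 (fun x => cos (2 * pi * x)) (- (2 * pi) * sin (2 * pi * x)).
Proof.
have d := is_derive_scale (2 * pi) x.
apply: (is_derive_eq (@is_derive1_comp _ cos (fun x => 2 * pi * x) x _ _ _ d)).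
by rewrite mulrC mulrN mulNr.
Qed.

Lemma is_derive_sin2pi (x : R) :
  is_derive x 1 (fun x => sin (2 * pi * x)) (2 * pi * cos (2 * pi * x)).
Proof.
have d := is_derive_scale (2 * pi) x.
apply: (is_derive_eq (@is_derive1_comp _ sin (fun x => 2 * pi * x) x _ _ _ d)).
by rewrite mulrC.
Qed.

Lemma is_derive_strand w dw (x : R) : is_derive x 1 (fun x => (w x).1) (dw x).1 ->
  is_derive x 1 (fun x => (w x).2) (dw x).2 ->
  is_derive x 1 (strand w) (dstrand w dw x).
Proof.
move=> d1 d2; have dc := is_derive_cos2pi x; have ds := is_derive_sin2pi x.
have d2w : is_derive x 1 (fun x => 3%:R + (w x).1) (dw x).1.
  by apply: (is_derive_eq (is_deriveD (is_derive_cst (3%:R : R) x 1) d1)); rewrite add0r.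
apply: is_derive_vec3 => //.
  apply: (is_derive_eq (is_deriveM d2w dc)).
  by rewrite -[_ *: _ + _]/(_ * _ + _ * _); ring.
apply: (is_derive_eq (is_deriveM d2w ds)).
by rewrite -[_ *: _ + _]/(_ * _ + _ * _); ring.
Qed.

Lemma smooth_strand (V : normedModType R) (a b x : V -> R) :
  smooth a -> smooth b -> smooth x -> smooth (fun y => cyl (x y) (a y) (b y)).
Proof.
move=> Ca Cb Cx; have C2 : smooth (fun y => 2 * pi * x y).
  by apply: smoothM => //; exact: smooth_cst.
have Ca2 : smooth (fun y => 3%:R + a y) by apply: smoothD => //; exact: smooth_cst.
apply: smooth_vec3 => //; apply: smoothM => //.
  exact: (smooth_comp (@smooth_cos R)).
exact: (smooth_comp (@smooth_sin R)).
Qed.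

(** The component along the core circle is 2 pi (3 + a), which is positive for a radial offset a >=
    -1. *)
Lemma dstrand_neq0 w dw x : -1 <= (w x).1 -> dstrand w dw x != 0.
Proof.
move=> w1; apply/eqP => h.
have := (congr1 (fun M : R3 => M 0 0) h, congr1 (fun M : R3 => M 0 2%:R) h).
rewrite /dstrand [vec3 _ _ _ 0 0]mxE [vec3 _ _ _ 0 2%:R]mxE !mxE /= => -[hx hz].
have n1 := cos2Dsin2 (2 * pi * x).
set c := cos _ in hx hz n1; set s := sin _ in hx hz n1.
have : (3%:R + (w x).1) * (2 * pi) * (c ^+ 2 + s ^+ 2) = 0.
  transitivity (((dw x).1 * s + (3%:R + (w x).1) * (2 * pi) * c) * c
     - ((dw x).1 * c - (3%:R + (w x).1) * (2 * pi) * s) * s); first by ring.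
  by rewrite hx hz !mul0r subrr.
rewrite n1 mulr1 => /eqP; rewrite gt_eqF//.
by rewrite !mulr_gt0 ?pi_gt0//; lra.
Qed.

End ClosedBraids.

(** * Closed curves with antiperiodic offset *)

Section BraidKnots.
Variable R : realType.
Local Notation R3 := 'rV[R]_3.

Lemma derive1_compr (f : R -> R3) (g : R -> R) (t c : R) : smooth f ->
  is_derive t 1 g c -> derive1 (fun t => f (g t)) t = c *: derive1 f (g t).
Proof.
move=> Cf gc; have df x : differentiable f x by exact: smooth_differentiable.
have dg : differentiable g t by apply/derivable1_diffP; exact: ex_derive.
have dc : differentiable (f \o g) t by exact: differentiable_comp.
rewrite derive1E -[LHS]/('D_1 (f \o g) t) (deriveE (1 : R) dc).
rewrite diff_comp//= -(deriveE (1 : R) dg) (_ : 'D_1 _ t = c).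
  by rewrite -[X in 'd f _ X]mulr1 linearZ/= -(deriveE (1 : R) (df _)) -derive1E.
exact: derive_val.
Qed.

Definition dw (w : R -> R * R) (x : R) : R * R :=
  (derive1 (fun x => (w x).1) x, derive1 (fun x => (w x).2) x).

Definition smooth2 (w : R -> R * R) :=
  smooth (fun x => (w x).1) /\ smooth (fun x => (w x).2).

Lemma derive1_strand w x : smooth2 w -> derive1 (strand w) x = dstrand w (dw w) x.
Proof.
move=> [C1 C2]; rewrite derive1E; apply: derive_val; apply: is_derive_strand.
  by rewrite /dw/= derive1E; apply: derivableP; exact: smooth_derivable.
by rewrite /dw/= derive1E; apply: derivableP; exact: smooth_derivable.
Qed.

Lemma smooth_strand1 w : smooth2 w -> smooth (strand w).
Proof. by move=> [C1 C2]; apply: smooth_strand => //; exact: smooth_id. Qed.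

Definition opp2 (v : R * R) : R * R := (- v.1, - v.2).

Definition antiperiodic (w : R -> R * R) := forall x, w (x + 1) = opp2 (w x).

Lemma antiperiodicZ w x (k : int) : antiperiodic w ->
  w (x + k%:~R) = w x /\ (exists l : int, k = l + l) \/
  w (x + k%:~R) = opp2 (w x) /\ (exists l : int, k = l + l + 1).
Proof.
move=> aw; have ev (l : int) y : w (y + (l + l)%:~R) = w y.
  have per t : w (2 * (t + 1)) = w (2 * t).
    rewrite (_ : 2 * (t + 1) = 2 * t + 1 + 1); last by ring.
    by rewrite !aw /opp2 /= !opprK; case: (w (2 * t)).
  have := periodicZ per (y / 2) l.
  rewrite mulrDr mulrCA mulfV ?mulr1 ?pnatr_eq0// intrD.
  by rewrite (_ : l%:~R + l%:~R = 2 * l%:~R)//; ring.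
have [[l ->]|[l ->]] : (exists l : int, k = l + l) \/ (exists l : int, k = l + l + 1).
  have := divz_eq k 2; set m := (k %/ 2)%Z.
  have : ((k %% 2)%Z = 0) \/ ((k %% 2)%Z = 1) by lia.
  by case=> -> ->; [left; exists m; lia|right; exists m; lia].
  by left; split=> //; exists l.
right; split; last by exists l.
by rewrite intrD addrA aw ev.
Qed.

(** The strands at [w] and [- w] meet where [w] vanishes: the zeros are the double points, and a
    nonzero derivative there makes them transverse. *)
Definition braid N (w : R -> R * R) (z : 'I_N -> R) : Prop :=
  [/\ smooth2 w /\ antiperiodic w, forall x, -1 <= (w x).1,
      forall x, w x = (0, 0) <-> exists k, eqZ x (z k),
      forall k, dw w (z k) != (0, 0) &
      (forall k, 0 < z k < 1) /\ injective z].

(* For an antiperiodic [w], the strands at [w] and [- w] form this one curve,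
   which goes round the axis twice. *)
Definition bknot_curve (w : R -> R * R) (t : R) : R3 := strand w (2 * t).

(** The curve is at the angle 2 t, so its two passages through a double point are half a period
    apart. *)
Definition chords N (z : 'I_N -> R) (k : 'I_N) (e : bool) : R :=
  if e then z k / 2 + 2^-1 else z k / 2.

Lemma smooth_bknot w : smooth2 w -> smooth (bknot_curve w).
Proof.
move=> Cw; apply: (smooth_comp_3 (smooth_strand1 Cw)).
by apply: smoothM; [exact: smooth_cst|exact: smooth_id].
Qed.

Lemma derive1_bknot w t : smooth2 w ->
  derive1 (bknot_curve w) t = 2 *: dstrand w (dw w) (2 * t).
Proof.
move=> Cw; rewrite -derive1_strand//.
exact: (derive1_compr (smooth_strand1 Cw) (is_derive_scale 2 t)).
Qed.

Lemma dw_anti w x : smooth2 w -> antiperiodic w -> dw w (x + 1) = opp2 (dw w x).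
Proof.
move=> [C1 C2] aw.
have H (f : R -> R) : smooth f -> (forall x, f (x + 1) = - f x) ->
    derive1 f (x + 1) = - derive1 f x.
  move=> Cf af; have df : derivable f x 1 by exact: smooth_derivable.
  rewrite -(derive1N df) /derive1.
  rewrite (_ : (fun h => _) = (fun h : R => h^-1 *: ((- f) (h + x) - (- f) x)))//.
  by apply/funext => h; rewrite addrA !af.
rewrite /dw /opp2 /=; congr (_, _).
  by apply: H => // y; rewrite aw.
by apply: H => // y; rewrite aw.
Qed.

Lemma chords_distinct N (z : 'I_N -> R) : (forall k, 0 < z k < 1) ->
  injective z -> distinct (chords z).
Proof.
move=> z01 zi i e j e' /eqZP[k]; have := z01 i; have := z01 j.
move=> /andP[j0 j1] /andP[i0 i1] h.
have K : z i - z j = 2 * k%:~R + (e'%:R - e%:R).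
  by move: h; rewrite /chords; case: e; case: e' => h /=; lra.
have k0 : k = 0.
  have : (-1)%:~R < k%:~R :> R.
    by rewrite mulrN1z; move: K; case: e {h}; case: e' => /=; lra.
  have : k%:~R < 1%:~R :> R.
    by rewrite -[1%:~R]/(1 : R); move: K; case: e {h}; case: e' => /=; lra.
  by rewrite !ltr_int; lia.
move: K; rewrite k0 mulr0 add0r.
case: e {h}; case: e' => /= h; try by exfalso; lra.
  by split=> //; apply: zi; lra.
by split=> //; apply: zi; lra.
Qed.

(** At a double point the two tangents share the component 6 pi along the core and have opposite
    transverse parts. Against a transverse vector, the determinant is thus 12 pi times a planar
    one. *)
Lemma det3_dstrand w dw1 dw2 x v1 v2 : w x = (0, 0) -> dw2 = opp2 dw1 ->
  det3 (dstrand w (fun=> dw1) x) (dstrand w (fun=> dw2) x)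
    (vec3 (v1 * cos (2 * pi * x)) v2 (v1 * sin (2 * pi * x))) =
  12%:R * pi * (dw1.2 * v1 - dw1.1 * v2).
Proof.
move=> w0 ->; rewrite det3E !mxE /= w0 /=.
have := cos2Dsin2 (2 * pi * x); set c := cos _; set s := sin _ => n1.
transitivity (12%:R * pi * (dw1.2 * v1 - dw1.1 * v2) * (c ^+ 2 + s ^+ 2)).
  by ring.
by rewrite n1 mulr1.
Qed.

Lemma bknot_chord w t : antiperiodic w -> w (2 * t) = (0, 0) ->
  bknot_curve w (t + 2^-1) = bknot_curve w t.
Proof.
move=> aw w0; rewrite /bknot_curve /strand.
rewrite (_ : 2 * (t + 2^-1) = 2 * t + 1); last by field.
by rewrite aw w0 /opp2 /= oppr0; exact: (cyl_z _ 1).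
Qed.

Lemma dstrand_next w x : smooth2 w -> antiperiodic w -> w x = (0, 0) ->
  dstrand w (dw w) (x + 1) = dstrand w (fun=> opp2 (dw w x)) x.
Proof.
move=> Cw aw w0; rewrite /dstrand dw_anti// aw w0 /opp2 /= oppr0.
by rewrite -[x + 1]/(x + 1%:~R) cos2pi_z sin2pi_z.
Qed.

Lemma det3ZZ (u v w : R3) a b : det3 (a *: u) (b *: v) w = a * b * det3 u v w.
Proof. by rewrite !det3E !mxE; ring. Qed.

Lemma braid_singular N w (z : 'I_N -> R) : braid w z ->
  singular (bknot_curve w) (chords z).
Proof.
move=> [[Cw aw] w1 w0 d0 [z01 zi]].
have wz k : w (z k) = (0, 0) by apply/w0; exists k; exact: eqZ_refl.
have q2 k : 2 * chords z k false = z k by rewrite /chords; field.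
have pos x : 0 < 3%:R + (w x).1 by have := w1 x; lra.
apply: singularI.
- split; first exact: smooth_bknot.
    move=> t; rewrite /bknot_curve /strand.
    rewrite (_ : 2 * (t + 1) = 2 * t + 2%:~R); last by rewrite -[2%:~R]/(2 : R); ring.
    rewrite cyl_z; have [[-> _]//|[_ [l]]] := antiperiodicZ (2 * t) 2 aw.
    by lia.
  by move=> t; rewrite derive1_bknot// scaler_eq0 pnatr_eq0/= dstrand_neq0.
- exact: chords_distinct.
- move=> j; rewrite [chords z j true](_ : _ = chords z j false + 2^-1)//.
  by rewrite bknot_chord// q2.
- move=> s t; rewrite /bknot_curve /strand => /(cyl_inj (pos _) (pos _))[st h1 h2].
  have hw : w (2 * s) = w (2 * t) by rewrite [LHS]surjective_pairing h1 h2
    -surjective_pairing.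
  have /eqZP[k sk] := st; rewrite sk in hw.
  (* The angles 2 s and 2 t differ by an integer. If it is even, the parameters agree modulo 1; if
     it is odd, w = - w there, and the point is double. *)
  have [[_ [l kl]]|[wo [l kl]]] := antiperiodicZ (2 * t) k aw.
    by left; apply/eqZP; exists l; move: sk; rewrite kl intrD; lra.
  right; have : w (2 * t) = (0, 0).
    have := hw; rewrite wo /opp2; case: (w (2 * t)) => a b /= [ha hb].
    by congr (_, _); lra.
  move=> /w0[j /eqZP[m tm]]; exists j.
  (* The parity of [m] tells on which of the two branches [t] lies. *)
  have [[m' mm]|[m' mm]] : (exists m', m = m' + m') \/ (exists m', m = m' + m' + 1).
    by have [[_ ?]|[_ ?]] := antiperiodicZ 0 m aw; [left|right].
    exists true; split; apply/eqZP; rewrite /chords /=.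
      by exists (m' + l); move: sk tm; rewrite kl mm !intrD; lra.
    by exists m'; move: tm; rewrite mm !intrD; lra.
  exists false; split; apply/eqZP; rewrite /chords /=.
    by exists (m' + l + 1); move: sk tm; rewrite kl mm !intrD; lra.
  by exists m'; move: tm; rewrite mm !intrD; lra.
(* The third vector is the derivative of [w] after a quarter turn, which makes the determinant a
   positive multiple of its squared length. *)
- move=> j; apply: (@det3_indep _ _ _
    (vec3 ((dw w (z j)).2 * cos (2 * pi * z j)) (- (dw w (z j)).1)
      ((dw w (z j)).2 * sin (2 * pi * z j)))).
  rewrite !derive1_bknot// q2.
  rewrite (_ : 2 * chords z j true = z j + 1); last by rewrite /chords; field.
  rewrite dstrand_next// det3ZZ (det3_dstrand _ _ (wz j) erefl).
  set a := (dw w (z j)).1; set b := (dw w (z j)).2.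
  have : 0 < a * a + b * b.
    rewrite lt_def addr_ge0 ?andbT -?expr2 ?sqr_ge0// paddr_eq0 ?sqr_ge0//.
    rewrite !sqrf_eq0; apply: contra (d0 j) => /andP[/eqP a0 /eqP b0].
    by rewrite [dw w (z j)]surjective_pairing -/a -/b a0 b0.
  move=> ab; rewrite gt_eqF// !mulr_gt0 ?pi_gt0//.
  by rewrite mulrN opprK addrC.
Qed.

Lemma chords_met N (z : 'I_N -> R) : (forall k, 0 < z k < 1) ->
  (forall i j : 'I_N, (i < j)%N -> z i < z j) -> met_in_order 0 (chords z).
Proof.
move=> z01 zi; split=> [i|i j /zi]; last by rewrite /chords; lra.
by have /andP[? ?] := z01 i; rewrite /chords; split; lra.
Qed.

End BraidKnots.

(** * Twisted ladders *)

Section TwistedLadders.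
Variable R : realType.
Local Notation R3 := 'rV[R]_3.
Local Notation sg s := (bsign R s).

Lemma convex_gt0 (u a b : R) : 0 <= u -> u <= 1 -> 0 < a -> 0 < b ->
  0 < (1 - u) * a + u * b.
Proof.
move=> u0 u1 a0 b0; have [->|un] := eqVneq u 1.
  by rewrite subrr mul0r add0r mul1r.
apply: ltr_wpDr; first by rewrite mulr_ge0// ltW.
by rewrite mulr_gt0// subr_gt0 lt_def eq_sym un.
Qed.

Definition ladder N (z : 'I_N -> R) : Prop :=
  (forall k, 0 < z k < 1) /\ forall i j : 'I_N, (i < j)%N -> z i < z j.

Lemma ladder_inj N (z : 'I_N -> R) : ladder z -> injective z.
Proof.
move=> [_ zi] i j ij; have [/zi|/zi|h] := ltngtP i j; last exact: val_inj.
  by rewrite ij ltxx.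
by rewrite ij ltxx.
Qed.

Lemma ladder_lift N (z : 'I_N.+1 -> R) i : ladder z ->
  ladder (fun j => z (fintype.lift i j)).
Proof.
move=> [z01 zi]; split=> [k|k l kl]; first exact: z01.
by apply: zi; rewrite /= ltnNge leq_bump2 -ltnNge.
Qed.

(** The offset of K(N, m) is this product times a rotating unit vector. For a ladder [z] its zeros
    are simple and lie at the [z k] modulo 1; a full turn multiplies it by (-1)^N. *)
Definition Pz N (z : 'I_N -> R) (x : R) : R := \prod_k sin (pi * (x - z k)).

Lemma smooth_Pz (V : normedModType R) N (z : V -> 'I_N -> R) (x : V -> R) :
  (forall k, smooth (fun v => z v k)) -> smooth x ->
  smooth (fun v => Pz (z v) (x v)).
Proof.
move=> Cz Cx; apply: smooth_prod => k _; apply: (smooth_comp (@smooth_sin R)).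
by apply: smoothM; [exact: smooth_cst|exact: smoothB].
Qed.

Lemma smooth_Pz1 N (z : 'I_N -> R) : smooth (Pz z).
Proof.
apply: (@smooth_Pz R N (fun=> z)) => [k|]; [exact: smooth_cst|exact: smooth_id].
Qed.

Lemma Pz_next N (z : 'I_N -> R) x : Pz z (x + 1) = (-1) ^+ N * Pz z x.
Proof.
transitivity (\prod_k - sin (pi * (x - z k))).
  by apply: eq_bigr => k _; rewrite addrAC mulrDr mulr1 sinDpi.
by rewrite prodrN card_ord.
Qed.

Lemma Pz_le1 N (z : 'I_N -> R) x : `|Pz z x| <= 1.
Proof.
apply: (big_ind (fun y => `|y| <= 1)) => [|a b ha hb|k _].
- by rewrite normr1.
- by rewrite normrM mulr_ile1.
- by rewrite ler_norml sin_geN1 sin_le1.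
Qed.

Lemma Pz_eq0 N (z : 'I_N -> R) x : Pz z x = 0 <-> exists k, eqZ x (z k).
Proof.
split=> [/eqP|[k /sin_pi_eq0 h]].
  rewrite prodf_seq_eq0 => /hasP[k _] /= /eqP /sin_pi_eq0 h.
  by exists k.
by rewrite /Pz (bigD1 k)//= h mul0r.
Qed.

Lemma Pz_lift N (z : 'I_N.+1 -> R) i x :
  Pz z x = sin (pi * (x - z i)) * Pz (fun j => z (fintype.lift i j)) x.
Proof. by rewrite /Pz (bigD1_ord i). Qed.

Lemma derive1M (f g : R -> R) x : derivable f x 1 -> derivable g x 1 ->
  derive1 (fun x => f x * g x) x = f x * derive1 g x + g x * derive1 f x.
Proof. by move=> df dg; rewrite !derive1E (deriveM df dg). Qed.

Lemma derive1_sinpi (z x : R) :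
  derive1 (fun x => sin (pi * (x - z))) x = pi * cos (pi * (x - z)).
Proof.
have d1 : is_derive x 1 (fun x : R => x - z) 1.
  apply: (is_derive_eq (is_deriveB (is_derive_id x (1 : R)) (is_derive_cst z x 1))).
  by rewrite subr0.
have d2 : is_derive x 1 (fun x : R => pi * (x - z)) pi.
  apply: (is_derive_eq (is_deriveM (is_derive_cst (pi : R) x 1) d1)).
  by rewrite -[LHS]/(pi * 1 + (x - z) * 0) mulr1 mulr0 addr0.
rewrite derive1E; apply: derive_val.
apply: (is_derive_eq (@is_derive1_comp _ sin (fun x => pi * (x - z)) x _ _ _ d2)).
by rewrite mulrC.
Qed.

Lemma derive1_Pz N (z : 'I_N.+1 -> R) i :
  derive1 (Pz z) (z i) = pi * Pz (fun j => z (fintype.lift i j)) (z i).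
Proof.
rewrite (_ : Pz z = fun x => sin (pi * (x - z i)) *
  Pz (fun j => z (fintype.lift i j)) x); last by apply/funext => x; exact: Pz_lift.
rewrite derive1M.
- by rewrite derive1_sinpi subrr mulr0 sin0 mul0r add0r cos0 mulr1 mulrC.
- apply: smooth_derivable; apply: (smooth_comp (@smooth_sin R)).
  apply: smoothM; first exact: smooth_cst.
  by apply: smoothB; [exact: smooth_id|exact: smooth_cst].
- exact/smooth_derivable/smooth_Pz1.
Qed.

Lemma Pz_other N (z : 'I_N.+1 -> R) i : ladder z ->
  Pz (fun j => z (fintype.lift i j)) (z i) != 0.
Proof.
move=> lz; have [z01 _] := lz; apply/eqP => /Pz_eq0[k /eqZP[l h]].
have /andP[a0 a1] := z01 i; have /andP[b0 b1] := z01 (fintype.lift i k).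
have l0 : l = 0.
  have : (-1)%:~R < l%:~R :> R by rewrite mulrN1z; lra.
  have : l%:~R < 1%:~R :> R by rewrite -[1%:~R]/(1 : R); lra.
  by rewrite !ltr_int; lia.
have /(ladder_inj lz) ik : z i = z (fintype.lift i k) by rewrite h l0 addr0.
by have := neq_lift i k; rewrite -ik eqxx.
Qed.

Definition mul2 (P : R -> R) (f : R -> R * R) (x : R) : R * R :=
  (P x * (f x).1, P x * (f x).2).

Lemma smooth2_mul P f : smooth P -> smooth2 f -> smooth2 (mul2 P f).
Proof. by move=> CP [C1 C2]; split; apply: smoothM. Qed.

Lemma dw_ladder N (z : 'I_N.+1 -> R) f i : smooth2 f -> dw (mul2 (Pz z) f) (z i) =
  (pi * Pz (fun j => z (fintype.lift i j)) (z i) * (f (z i)).1,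
   pi * Pz (fun j => z (fintype.lift i j)) (z i) * (f (z i)).2).
Proof.
move=> [C1 C2]; have dP : derivable (Pz z) (z i) 1 by exact/smooth_derivable/smooth_Pz1.
have P0 : Pz z (z i) = 0 by apply/Pz_eq0; exists i; exact: eqZ_refl.
rewrite /dw /mul2 /= !derive1M//; try exact: smooth_derivable.
by rewrite P0 !mul0r !add0r derive1_Pz; congr (_, _); rewrite mulrC.
Qed.

(** The sign that [f] takes after one turn is opposite to that of [Pz], so the product is
    antiperiodic and the strands close up to one curve. The bound on the norm keeps the radial
    offset above -1. *)
Lemma braid_ladder N (z : 'I_N -> R) f : ladder z -> smooth2 f ->
  (forall x, f (x + 1) = (- (-1) ^+ N * (f x).1, - (-1) ^+ N * (f x).2)) ->
  (forall x, 0 < (f x).1 ^+ 2 + (f x).2 ^+ 2 <= 1) ->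
  braid (mul2 (Pz z) f) z.
Proof.
move=> lz Cf f1 fn; have sN : (-1) ^+ N * (-1) ^+ N = 1 :> R.
  by rewrite -exprMn mulrNN mulr1 expr1n.
split.
- split; first by apply: smooth2_mul => //; exact: smooth_Pz1.
  move=> x; rewrite /mul2 /opp2 f1 Pz_next /=.
  congr (_, _).
    transitivity (- ((-1) ^+ N * (-1) ^+ N * (Pz z x * (f x).1))); first by ring.
    by rewrite sN mul1r.
  transitivity (- ((-1) ^+ N * (-1) ^+ N * (Pz z x * (f x).2))); first by ring.
  by rewrite sN mul1r.
- move=> x; rewrite /mul2 /=; suff : `|Pz z x * (f x).1| <= 1.
    by rewrite ler_norml => /andP[].
  rewrite normrM mulr_ile1 ?Pz_le1//.
  have /andP[_ h] := fn x; rewrite -(ler_pXn2r (n := 2)) ?nnegrE//.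
  rewrite expr1n -normrX ger0_norm ?sqr_ge0//.
  by apply: le_trans h; rewrite lerDl sqr_ge0.
- move=> x; rewrite -Pz_eq0 /mul2; split=> [[h1 h2]|->]; last by rewrite !mul0r.
  apply/eqP; apply: contraT => P0.
  have /andP[+ _] := fn x.
  move/eqP: h1; rewrite mulf_eq0 (negbTE P0) => /eqP ->.
  by move/eqP: h2; rewrite mulf_eq0 (negbTE P0) => /eqP ->; rewrite expr0n addr0 ltxx.
- case: N z lz f1 {sN} => [z _ _ []//|N z lz f1 k].
  rewrite (dw_ladder z k Cf); apply/eqP => -[h1 h2].
  have P0 : pi * Pz (fun j => z (fintype.lift k j)) (z k) != 0.
    by rewrite mulf_neq0 ?Pz_other// gt_eqF// pi_gt0.
  have /andP[+ _] := fn (z k).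
  move/eqP: h1; rewrite mulf_eq0 (negbTE P0) => /eqP ->.
  by move/eqP: h2; rewrite mulf_eq0 (negbTE P0) => /eqP ->; rewrite expr0n addr0 ltxx.
- by have [z01 _] := lz; split=> //; exact: ladder_inj.
Qed.

Definition phase (m : int) (a x : R) : R := pi * m%:~R * x + a.

Definition uvec (m : int) (a x : R) : R * R := (cos (phase m a x), sin (phase m a x)).

Lemma phase_next m a x : phase m a (x + 1) = phase m a x + pi * m%:~R.
Proof. by rewrite /phase; ring. Qed.

Lemma uvec_next m a x : uvec m a (x + 1) =
  (cos (pi * m%:~R) * (uvec m a x).1, cos (pi * m%:~R) * (uvec m a x).2).
Proof.
rewrite /uvec phase_next cosD sinD sin_piz !mulr0 subr0 addr0 /=.
by congr (_, _); rewrite mulrC.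
Qed.

Lemma smooth_phase (V : normedModType R) m (a x : V -> R) : smooth a -> smooth x ->
  smooth (fun v => phase m (a v) (x v)).
Proof.
move=> Ca Cx; apply: smoothD => //.
by apply: smoothM => //; exact: smooth_cst.
Qed.

Lemma smooth_cosphase (V : normedModType R) m (a x : V -> R) : smooth a -> smooth x ->
  smooth (fun v => cos (phase m (a v) (x v))).
Proof. by move=> Ca Cx; apply: (smooth_comp (@smooth_cos R)); exact: smooth_phase. Qed.

Lemma smooth_sinphase (V : normedModType R) m (a x : V -> R) : smooth a -> smooth x ->
  smooth (fun v => sin (phase m (a v) (x v))).
Proof. by move=> Ca Cx; apply: (smooth_comp (@smooth_sin R)); exact: smooth_phase. Qed.

Lemma smooth2_uvec m a : smooth2 (uvec m a).
Proof.
split; [apply: smooth_cosphase|apply: smooth_sinphase];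
  by [exact: smooth_cst|exact: smooth_id].
Qed.

Lemma uvec_norm m a x : (uvec m a x).1 ^+ 2 + (uvec m a x).2 ^+ 2 = 1.
Proof. exact: cos2Dsin2. Qed.

(** That m - N is odd, written as the sign required in [braid_ladder]. *)
Definition parity (m : int) N := cos (pi * m%:~R) = - (-1) ^+ N :> R.

Lemma kbraid m a N (z : 'I_N -> R) : parity m N -> ladder z ->
  braid (mul2 (Pz z) (uvec m a)) z.
Proof.
move=> mN lz; apply: braid_ladder => //; first exact: smooth2_uvec.
  by move=> x; rewrite uvec_next mN.
by move=> x; rewrite uvec_norm ltr01 lexx.
Qed.

(* [x] is the class of K(N, m). *)
Definition isK c N (m : int) (x : cube R c N) : Prop := exists a (z : 'I_N -> R),
  ladder z /\ rep x (bknot_curve (mul2 (Pz z) (uvec m a))) (chords z) 0.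

Lemma braid_good b N w (z : 'I_N -> R) : braid w z -> ladder z ->
  good b (bknot_curve w) (chords z) 0.
Proof.
move=> bw [z01 zi]; split; first exact: braid_singular.
by move=> _; exact: chords_met.
Qed.

Lemma isK_exists c N m : parity m N -> exists x : cube R c N, isK m x.
Proof.
move=> mN; pose z (k : 'I_N) : R := k.+1%:R / N.+1%:R.
have N0 : 0 < N.+1%:R :> R by rewrite ltr0n.
have lz : ladder z.
  split=> [k|i j ij]; rewrite /z.
    by rewrite divr_gt0//= ltr_pdivrMr// mul1r ltr_nat ltnS ltn_ord.
  by rewrite ltr_pM2r ?invr_gt0// ltr_nat ltnS.
have [x rx] := rep_exists (c := c) (braid_good (based c) (kbraid 0 mN lz) lz).
by exists x, 0, z.
Qed.

Lemma smooth_bknot2 (V : normedModType R) (w1 w2 : R * R -> R) (u t : V -> R) :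
  smooth w1 -> smooth w2 -> smooth u -> smooth t ->
  smooth (fun v => bknot_curve (fun x => (w1 (u v, x), w2 (u v, x))) (t v)).
Proof.
move=> C1 C2 Cu Ct; have C2t : smooth (fun v => 2 * t v).
  by apply: smoothM => //; exact: smooth_cst.
apply: smooth_strand => //; first exact: (smooth_comp2 C1 Cu C2t).
exact: (smooth_comp2 C2 Cu C2t).
Qed.

(** Ladders form a convex set, so interpolating [a] and [z] linearly is an isotopy, and the order
    seen from the base point at 0 persists all along. *)
Lemma isK_uniq c N m (x x' : cube R c N) : parity m N -> isK m x -> isK m x' -> x = x'.
Proof.
move=> mN [a [z [lz rx]]] [a' [z' [lz' rx']]].
pose A (u : R) := (1 - u) * a + u * a'; pose Z (u : R) k := (1 - u) * z k + u * z' k.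
have CA : smooth A.
  apply: smoothD; (apply: smoothM; last exact: smooth_cst).
    by apply: smoothB; [exact: smooth_cst|exact: smooth_id].
  exact: smooth_id.
have CZ k : smooth (fun u => Z u k).
  apply: smoothD; (apply: smoothM; last exact: smooth_cst).
    by apply: smoothB; [exact: smooth_cst|exact: smooth_id].
  exact: smooth_id.
have lZ u : 0 <= u <= 1 -> ladder (Z u).
  move=> /andP[u0 u1]; have [z01 zi] := lz; have [z01' zi'] := lz'.
  split=> [k|i j ij]; rewrite /Z.
    have /andP[h1 h2] := z01 k; have /andP[h1' h2'] := z01' k.
    have c1 := convex_gt0 u0 u1 h1 h1'.
    have c2 : 0 < (1 - u) * (1 - z k) + u * (1 - z' k).
      by apply: convex_gt0; rewrite ?subr_gt0.
    by apply/andP; split; lra.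
  have c3 : 0 < (1 - u) * (z j - z i) + u * (z' j - z' i).
    by apply: convex_gt0; rewrite ?subr_gt0; [| |exact: zi|exact: zi'].
  by lra.
pose w1 (p : R * R) := Pz (Z p.1) p.2 * cos (phase m (A p.1) p.2).
pose w2 (p : R * R) := Pz (Z p.1) p.2 * sin (phase m (A p.1) p.2).
have CA1 : smooth (fun p : R * R => A p.1) by exact: (smooth_comp CA (@smooth_fst _ _ _)).
have CP : smooth (fun p : R * R => Pz (Z p.1) p.2).
  apply: smooth_Pz; last exact: smooth_snd.
  by move=> k; exact: (smooth_comp (CZ k) (@smooth_fst _ _ _)).
have C1 : smooth w1.
  by apply: smoothM => //; apply: smooth_cosphase => //; exact: smooth_snd.
have C2 : smooth w2.
  by apply: smoothM => //; apply: smooth_sinphase => //; exact: smooth_snd.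
apply: (rep_step rx rx').
exists (fun u => bknot_curve (mul2 (Pz (Z u)) (uvec m (A u)))),
  (fun u => chords (Z u)), (fun=> 0).
have Z0 : Z 0 = z by apply/funext => k; rewrite /Z subr0 mul1r mul0r addr0.
have Z1 : Z 1 = z' by apply/funext => k; rewrite /Z subrr mul1r mul0r add0r.
have A0 : A 0 = a by rewrite /A subr0 mul1r mul0r addr0.
have A1 : A 1 = a' by rewrite /A subrr mul1r mul0r add0r.
rewrite Z0 Z1 A0 A1; split=> //.
- split.
  + exact: (smooth_bknot2 C1 C2 (@smooth_fst _ _ _) (@smooth_snd _ _ _)).
  + move=> k e; rewrite /chords; case: e; last first.
      by apply: smoothM => //; exact: smooth_cst.
    apply: smoothD; last exact: smooth_cst.
    by apply: smoothM => //; exact: smooth_cst.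
  + by move=> u u01; apply: braid_singular; apply: kbraid => //; exact: lZ.
- exact: smooth_cst.
- by move=> u u01 _; have [z01 zi] := lZ u u01; exact: chords_met.
Qed.

End TwistedLadders.

(** * Unfolding a double point into a half twist *)

Section LadderFaces.
Variable R : realType.
Local Notation R3 := 'rV[R]_3.
Local Notation sg s := (bsign R s).

Definition shift_twist (m : int) (s : bool) : int := m + (if s then 1 else -1).

Lemma cos_shift m (s : bool) :
  cos (pi * (shift_twist m s)%:~R) = - cos (pi * m%:~R) :> R.
Proof.
rewrite /shift_twist intrD mulrDr; case: s => /=.
  by rewrite mulr1 cosDpi.
by rewrite mulrN1z mulrN1 cosB cospi sinpi mulr0 addr0 mulrN1.
Qed.

Lemma parity_shift m N s : parity R m N.+1 -> parity R (shift_twist m s) N.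
Proof. by rewrite /parity cos_shift exprS mulN1r opprK => ->. Qed.

(* At [u = 1] this is a rotating unit vector again. *)
Definition unfold_dir m a (zi : R) s (u x : R) : R * R :=
  (sin (pi * (x - zi)) * cos (phase m a x)
     + u * sg s * (cos (pi * (x - zi)) * sin (phase m a x)),
   sin (pi * (x - zi)) * sin (phase m a x)
     - u * sg s * (cos (pi * (x - zi)) * cos (phase m a x))).

Lemma unfold_dir0 m a N (z : 'I_N.+1 -> R) i s :
  mul2 (Pz (fun j => z (fintype.lift i j))) (unfold_dir m a (z i) s 0) =
  mul2 (Pz z) (uvec m a).
Proof.
apply/funext => x; rewrite /mul2 (Pz_lift z i) /unfold_dir /uvec /=.
by congr (_, _); ring.
Qed.

Lemma unfold_dir1 m a zi s : unfold_dir m a zi s 1 =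
  uvec (shift_twist m s) (a - sg s * (pi * zi + pi / 2)).
Proof.
apply/funext => x; rewrite /unfold_dir /uvec.
have -> : phase (shift_twist m s) (a - sg s * (pi * zi + pi / 2)) x =
    if s then phase m a x + pi * (x - zi) - pi / 2
    else phase m a x - pi * (x - zi) + pi / 2.
  rewrite /phase /shift_twist intrD /bsign; case: s => /=; first by ring.
  by rewrite mulrN1z; ring.
case: s => /=; rewrite /bsign.
  rewrite cosBpihalf sinBpihalf sinD cosD; congr (_, _); ring.
rewrite cosDpihalf sinDpihalf sinB cosB; congr (_, _); ring.
Qed.

Lemma unfold_dir_norm m a zi s u x :
  (unfold_dir m a zi s u x).1 ^+ 2 + (unfold_dir m a zi s u x).2 ^+ 2 =
  sin (pi * (x - zi)) ^+ 2 + u ^+ 2 * cos (pi * (x - zi)) ^+ 2.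
Proof.
rewrite /unfold_dir /=; have := cos2Dsin2 (phase m a x).
set c := cos (phase m a x); set d := sin (phase m a x) => n1.
transitivity ((sin (pi * (x - zi)) ^+ 2 +
   u ^+ 2 * (sg s * sg s) * cos (pi * (x - zi)) ^+ 2) * (c ^+ 2 + d ^+ 2)).
  by ring.
by rewrite n1 bsignM !mulr1.
Qed.

Lemma unfold_dir_next m a zi s u x : unfold_dir m a zi s u (x + 1) =
  (- cos (pi * m%:~R) * (unfold_dir m a zi s u x).1,
   - cos (pi * m%:~R) * (unfold_dir m a zi s u x).2).
Proof.
rewrite /unfold_dir phase_next [cos (phase m a x + _)]cosD.
rewrite [sin (phase m a x + _)]sinD sin_piz addrAC !mulrDr mulr1 sinDpi cosDpi.
by congr (_, _) => /=; ring.
Qed.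

Lemma smooth_unfold m a zi s :
  smooth (fun p : R * R => (unfold_dir m a zi s p.1 p.2).1) /\
  smooth (fun p : R * R => (unfold_dir m a zi s p.1 p.2).2).
Proof.
have Cx : smooth (fun p : R * R => pi * (p.2 - zi)).
  apply: smoothM; first exact: smooth_cst.
  by apply: smoothB; [exact: smooth_snd|exact: smooth_cst].
have Cs := smooth_comp (@smooth_sin R) Cx; have Cc := smooth_comp (@smooth_cos R) Cx.
have Ca : smooth (fun p : R * R => a) by exact: smooth_cst.
have Pc := smooth_cosphase m Ca (@smooth_snd R R R).
have Ps := smooth_sinphase m Ca (@smooth_snd R R R).
have Cu : smooth (fun p : R * R => p.1 * sg s).
  by apply: smoothM; [exact: smooth_fst|exact: smooth_cst].
split.
  by apply: smoothD; [exact: smoothM|apply: smoothM => //; exact: smoothM].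
by apply: smoothB; [exact: smoothM|apply: smoothM => //; exact: smoothM].
Qed.

Lemma unfold_braid m a N (z : 'I_N.+1 -> R) i s u : parity R m N.+1 -> ladder z ->
  0 < u <= 1 ->
  braid (mul2 (Pz (fun j => z (fintype.lift i j))) (unfold_dir m a (z i) s u))
    (fun j => z (fintype.lift i j)).
Proof.
move=> mN lz /andP[u0 u1]; apply: braid_ladder; first exact: ladder_lift.
- have [C1 C2] := smooth_unfold m a (z i) s.
  by split; [apply: (smooth_comp2 C1)|apply: (smooth_comp2 C2)];
    by [exact: smooth_cst|exact: smooth_id].
- by move=> x; rewrite unfold_dir_next mN exprS mulN1r opprK.
- move=> x; rewrite unfold_dir_norm.
  have := cos2Dsin2 (pi * (x - z i)); set c := cos _; set d := sin _ => n1.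
  have c2 : 0 <= c ^+ 2 by exact: sqr_ge0.
  have d2 : 0 <= d ^+ 2 by exact: sqr_ge0.
  have u2 : 0 < u ^+ 2 by exact: exprn_gt0.
  have u21 : u ^+ 2 <= 1 by exact: exprn_ile1 (ltW u0) u1.
  have uc : 0 <= u ^+ 2 * c ^+ 2 by rewrite mulr_ge0// ltW.
  apply/andP; split; last by nra.
  have [d0|dn] := eqVneq (d ^+ 2) 0.
    by rewrite d0 add0r mulr_gt0// lt_def c2 andbT; apply/eqP => c0; lra.
  by apply: ltr_pwDl => //; rewrite lt_def dn.
Qed.

(** At [z i] only the term with [u] remains. It is perpendicular to the direction (c, d) in which
    the strands cross, and opposite on the other branch, so the branches move apart symmetrically
    and at constant speed. *)
Lemma ladder_opens m a N (z : 'I_N.+1 -> R) i s : parity R m N.+1 -> ladder z ->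
  ropens i s (bknot_curve (mul2 (Pz z) (uvec m a))) (chords z)
    (fun u => bknot_curve
      (mul2 (Pz (fun j => z (fintype.lift i j))) (unfold_dir m a (z i) s u))).
Proof.
move=> mN lz; set P := Pz (fun j => z (fintype.lift i j)).
have [C1 C2] := smooth_unfold m a (z i) s.
have CP : smooth (fun p : R * R => P p.2).
  exact: (smooth_comp (smooth_Pz1 _) (@smooth_snd R R R)).
split.
- exact: (smooth_bknot2 (smoothM CP C1) (smoothM CP C2) (@smooth_fst R R R)
    (@smooth_snd R R R)).
- by rewrite unfold_dir0.
- by move=> u u01; apply: braid_singular; exact: unfold_braid.
have [Cw aw] : smooth2 (mul2 (Pz z) (uvec m a)) /\ antiperiodic (mul2 (Pz z) (uvec m a)).
  by have [] := kbraid a mN lz.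
have q2 : 2 * chords z i false = z i by rewrite /chords; field.
have q2' : 2 * chords z i true = z i + 1 by rewrite /chords; field.
have w0 : mul2 (Pz z) (uvec m a) (z i) = (0, 0).
  rewrite /mul2 (_ : Pz z (z i) = 0) ?mul0r//.
  by apply/Pz_eq0; exists i; exact: eqZ_refl.
set c := cos (phase m a (z i)); set d := sin (phase m a (z i)).
pose v1 := P (z i) * sg s * d; pose v2 := - (P (z i) * sg s * c).
pose V := vec3 (v1 * cos (2 * pi * z i)) v2 (v1 * sin (2 * pi * z i)).
have wz u : mul2 P (unfold_dir m a (z i) s u) (z i) = (u * v1, u * v2).
  rewrite /mul2 /unfold_dir subrr mulr0 sin0 cos0 -/c -/d /v1 /v2 /=.
  by congr (_, _); ring.
have wz' u : mul2 P (unfold_dir m a (z i) s u) (z i + 1) = (- (u * v1), - (u * v2)).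
  have -> : mul2 P (unfold_dir m a (z i) s u) (z i + 1) =
      opp2 (mul2 P (unfold_dir m a (z i) s u) (z i)); last by rewrite wz.
  rewrite /mul2 unfold_dir_next /P Pz_next mN exprS mulN1r opprK /opp2.
  have sN : (-1) ^+ N * (-1) ^+ N = 1 :> R by rewrite -exprMn mulrNN mulr1 expr1n.
  move: (unfold_dir m a (z i) s u (z i)) (Pz _ _) => F p /=; congr (_, _).
    by transitivity (- ((-1) ^+ N * (-1) ^+ N * (p * F.1))); [ring|rewrite sN mul1r].
  by transitivity (- ((-1) ^+ N * (-1) ^+ N * (p * F.2))); [ring|rewrite sN mul1r].
rewrite (_ : (fun u => _) = fun u => (u * 2) *: V); last first.
  apply/funext => u; rewrite /bknot_curve /strand q2 q2' wz wz' /=.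
  rewrite -[z i + 1]/(z i + 1%:~R) cyl_z /cyl /V; apply: vecP; rewrite !mxE /=; ring.
rewrite derive1_linear det3Z !derive1_bknot// q2 q2' dstrand_next// det3ZZ.
rewrite (det3_dstrand _ _ w0 erefl) (dw_ladder z i (smooth2_uvec m a)).
rewrite -/P -[if s then _ else _]/(sg s) /uvec -/c -/d /= /v1 /v2.
have P2 : 0 < P (z i) ^+ 2 by rewrite exprn_even_gt0//= Pz_other.
(* 96 = 2 * 2 * 2 * 12: each velocity gives 2 because the angle is 2 t, the symmetric separation
   gives 2, and [det3_dstrand] gives 12 pi. The other pi is from the derivative of [Pz]. *)
rewrite [ltRHS](_ : _ = (sg s * sg s) * (96%:R * pi * pi * (P (z i) ^+ 2) *
   (c ^+ 2 + d ^+ 2))); last by ring.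
rewrite bsignM mul1r cos2Dsin2 mulr1; apply: mulr_gt0 => //.
by rewrite !mulr_gt0 ?pi_gt0.
Qed.

Lemma isK_face c N m (x : cube R c N.+1) i s y : parity R m N.+1 -> isK m x ->
  cube_face i s x y -> isK (shift_twist m s) y.
Proof.
move=> mN [a [z [lz rx]]] xy; have op := ladder_opens a i s mN lz.
have [y' ry'] := ropens_end rx op.
rewrite (face_uniq xy (ropens_rep rx op ry')).
exists (a - sg s * (pi * z i + pi / 2)), (fun j => z (fintype.lift i j)).
by split; [exact: ladder_lift|rewrite -unfold_dir1].
Qed.

Lemma isK_forget c N m (x : cube R c N) : isK m x ->
  isK m (forget x : cube R CK0 N).
Proof. by move=> [a [z [lz rx]]]; exists a, z; split=> //; exact: rep_forget. Qed.

(* All faces in all directions agree, and there is an even number of them. *)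
Lemma boundary_isK c n (x : cube R c n.*2.+2) : isK 1 x ->
  boundary (@cube_face R c) << x >> = 0.
Proof.
move=> Kx; have mN : parity R 1 n.*2.+2.
  by rewrite /parity mulr1 cospi -signr_odd /= odd_double expr0.
have [y [y' dE]] : exists y y', forall i, dface (@cube_face R c) i x = << y >> - << y' >>.
  have [y xy] := face_exists ord0 true x; have [y' xy'] := face_exists ord0 false x.
  exists y, y' => i.
  have [w xw] := face_exists i true x; have [w' xw'] := face_exists i false x.
  rewrite (dfaceE xw xw').
  have U s (a b : cube R c n.*2.+1) : isK (shift_twist 1 s) a ->
    isK (shift_twist 1 s) b -> a = b.
    by apply: isK_uniq; exact: parity_shift.
  rewrite (U true w y (isK_face mN Kx xw) (isK_face mN Kx xy)).
  by rewrite (U false w' y' (isK_face mN Kx xw') (isK_face mN Kx xy')).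
rewrite /boundary liftU scale1r.
under eq_bigr do rewrite dE.
rewrite -scaler_suml (_ : \sum_(i < n.*2.+2) _ = 0) ?scale0r//.
elim: n {x Kx mN y y' dE} => [|n IH]; first by rewrite !big_ord_recr big_ord0 /=; ring.
rewrite doubleS !big_ord_recr /= in IH *.
rewrite IH add0r !exprS; ring.
Qed.

End LadderFaces.

(** * The Conway polynomial of twisted two-strand links *)

Section ClosedBraidLinks.
Variable R : realType.
Local Notation R3 := 'rV[R]_3.
Local Notation sg s := (bsign R s).

(* Two strands at [w] and [- w] turn round the axis; [b] tells whether they close
   up separately or one into the other. *)
Definition dirfield (b : bool) (w : R -> R * R) : Prop :=
  [/\ smooth2 w, forall x, w (x + 1) = (sg b * (w x).1, sg b * (w x).2) &
      forall x, 0 < (w x).1 ^+ 2 + (w x).2 ^+ 2 <= 1].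

Definition sign2 (e : bool) (w : R -> R * R) : R -> R * R := mul2 (fun=> sg e) w.

(** Coerced to a number, [b] is the number of components minus one. For periodic [w] the strands at
    [w] and [- w] are two components; for antiperiodic [w] one curve runs through both. *)
Definition closed_braid (b : bool) (w : R -> R * R) (j : 'I_b.+1) (t : R) : R3 :=
  if b then strand (sign2 (j == ord0) w) t else bknot_curve w t.

Lemma dirfield_anti w : dirfield false w -> antiperiodic w.
Proof. by move=> [_ w1 _] x; rewrite w1 /bsign /opp2 !mulN1r. Qed.

Lemma dirfield_neq0 b w x : dirfield b w -> w x != (0, 0).
Proof.
move=> [_ _ wn]; apply/eqP => w0; have := wn x.
by rewrite w0 /= expr0n addr0 ltxx.
Qed.

Lemma dirfield_ge b w x e : dirfield b w ->
  -1 <= (sign2 e w x).1 /\ -1 <= (sign2 e w x).2.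
Proof.
move=> [_ _ wn]; have /andP[_ +] := wn x; rewrite /sign2 /mul2 /=.
by case: e; rewrite /bsign; split; nra.
Qed.

Lemma smooth2_sign e w : smooth2 w -> smooth2 (sign2 e w).
Proof.
by move=> [C1 C2]; split; apply: smoothM => //; exact: smooth_cst.
Qed.

Lemma dirfield_z b w (k : int) : dirfield b w -> exists c, forall e x,
  sign2 e w (x + k%:~R) = sign2 (e (+) c) w x.
Proof.
move=> dw0; have [_ w1 _] := dw0.
have sgx (e e' : bool) : sg (e (+) e') = - (sg e * sg e').
  by case: e; case: e'; rewrite /bsign /=; ring.
case: b w1 dw0 => w1 dw0.
  exists false => e x; rewrite addbF /sign2 /mul2 /= (@periodicZ _ _ w)// => y.
  by rewrite w1 /bsign !mul1r -surjective_pairing.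
have aw := dirfield_anti dw0.
have [[_ [l kl]]|[_ [l kl]]] := antiperiodicZ 0 k aw.
  exists false => e x; have [[E _]|[_ [l' kl']]] := antiperiodicZ x k aw; last by lia.
  by rewrite addbF /sign2 /mul2 E.
exists true => e x; have [[_ [l' kl']]|[E _]] := antiperiodicZ x k aw; first by lia.
rewrite /sign2 /mul2 E sgx /opp2 /=.
by congr (_, _); ring.
Qed.

Lemma dirfield_link b w : dirfield b w -> is_link (@closed_braid b w).
Proof.
move=> dw0; have [Cw w1 wn] := dw0; case: b w1 dw0 => w1 dw0; last first.
  (* A single component is a braid without double points. *)
  have bw : braid w (fun k : 'I_0 => 0).
    split; [|move=> x|move=> x|by case|].
    - by split=> //; exact: dirfield_anti.
    - by have /andP[_] := wn x; nra.
    - split=> [h|[[]]//]; by have := dirfield_neq0 x dw0; rewrite h eqxx.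
    - by split; case.
  have [imm _ inj _] := braid_singular bw; split=> // j s k t.
  rewrite /closed_braid inj !ord1; split=> [[|[[]]]//|[_ h]]; by left.
have pw t (e : bool) : sign2 e w (t + 1) = sign2 e w t.
  by rewrite /sign2 /mul2 w1 /bsign !mul1r.
split=> [j|j s k t]; rewrite /closed_braid.
  split; first by apply: smooth_strand1; exact: smooth2_sign.
    by move=> t; rewrite /strand pw; exact: (cyl_z _ 1).
  move=> t; rewrite derive1_strand; last exact: smooth2_sign.
  by apply: dstrand_neq0; have [] := dirfield_ge t (j == ord0) dw0.
split=> [|[-> /eqZP[m ->]]]; last first.
  by rewrite /strand (@periodicZ _ _ (sign2 _ w)) ?cyl_z.
have pos x e : 0 < 3%:R + (sign2 e w x).1 by have [h _] := dirfield_ge x e dw0; lra.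
move=> /(cyl_inj (pos _ _) (pos _ _))[st h1 h2]; split=> //.
have /eqZP[m sm] := st; move: h1 h2.
rewrite sm !(@periodicZ _ _ (sign2 _ w))// /sign2 /mul2 /= => h1 h2.
have jk : (j == ord0) = (k == ord0).
  have := wn t; move: h1 h2; rewrite /bsign.
  by case: (j == ord0); case: (k == ord0) => // h1 h2; nra.
by apply: val_inj; move: jk; case: j k {h1 h2} => [[|[|//]] ?] [[|[|//]] ?].
Qed.

Definition braid_link b w (h : dirfield b w) : link R b := Link (dirfield_link h).

(** The oriented image is the union of the two strands, however many components they form. This
    makes the links of a skein triple comparable although their numbers of components differ. *)
Lemma closed_braid_arc b w : dirfield b w ->
  \bigcup_(j : 'I_b.+1) oriented_arc (@closed_braid b w j) setT =
  \bigcup_(e : bool) oriented_arc (strand (sign2 e w)) setT.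
Proof.
move=> dw0; have [Cw _ _] := dw0; apply/seteqP; split=> [[p v]|[p v]].
  move=> [j _ [t [l [_ l0 [-> ->]]]]]; case: b dw0 j => dw0 j.
    by exists (j == ord0) => //; exists t, l.
  have E : strand (sign2 true w) = strand w.
    apply/funext => x; rewrite /sign2 /mul2 /bsign /strand !mul1r.
    by case: (w x).
  exists true; first by []; exists (2 * t), (l * 2).
  split; [by []|by rewrite mulr_gt0|].
  by rewrite E /closed_braid (derive1_bknot _ Cw) -(derive1_strand _ Cw) scalerA.
move=> [e _ [t [l [_ l0 [-> ->]]]]]; case: b dw0 => dw0.
  exists (if e then ord0 else ord_max); first by [].
  exists t, l; split; [by []|exact: l0|].
  by rewrite /closed_braid; case: e.
have aw := dirfield_anti dw0.
pose k : int := if e then 0 else 1.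
have E : strand (sign2 e w) = fun x => strand w (x + k%:~R).
  apply/funext => x; rewrite /strand cyl_z /sign2 /mul2 /k /bsign.
  case: e @k => /=; last by rewrite aw /opp2 /= !mulN1r.
  by rewrite addr0 !mul1r.
have D : derive1 (strand (sign2 e w)) t = derive1 (strand w) (t + k%:~R).
  by rewrite E derive1_shift.
exists ord0; first by []; exists ((t + k%:~R) / 2), (l / 2).
split; [by []|by rewrite divr_gt0|].
rewrite /closed_braid (derive1_bknot _ Cw) -(derive1_strand _ Cw) scalerA.
have two0 : 2 != 0 :> R by rewrite pnatr_eq0.
by rewrite /bknot_curve (divfK two0) [2 * _]mulrC (divfK two0) -D E.
Qed.

Lemma link_eq r (L L' : link R r) : lcurve L = lcurve L' -> L = L'.
Proof.
case: L => f hf; case: L' => g hg /= fg; subst g.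
by rewrite (Prop_irrelevance hf hg).
Qed.

Lemma closed_braid_isotopic (b : bool) (w1 w2 : R * R -> R) (L L' : link R b) :
  smooth w1 -> smooth w2 ->
  (forall u, 0 <= u <= 1 -> dirfield b (fun x => (w1 (u, x), w2 (u, x)))) ->
  lcurve L = @closed_braid b (fun x => (w1 (0, x), w2 (0, x))) ->
  lcurve L' = @closed_braid b (fun x => (w1 (1, x), w2 (1, x))) ->
  link_isotopic L L'.
Proof.
move=> C1 C2 dw0 L0 L1.
exists (fun u => @closed_braid b (fun x => (w1 (u, x), w2 (u, x)))), id.
split=> //.
- split=> // j; rewrite /smooth_family /closed_braid; case: b {L L' L0 L1} dw0 j => dw0 j.
    rewrite /strand /sign2 /mul2 /=.
    have C1' : smooth (fun ut : R * R => w1 (ut.1, ut.2)).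
      by apply: smooth_comp2 => //; [exact: smooth_fst|exact: smooth_snd].
    have C2' : smooth (fun ut : R * R => w2 (ut.1, ut.2)).
      by apply: smooth_comp2 => //; [exact: smooth_fst|exact: smooth_snd].
    apply: smooth_strand; [| |exact: smooth_snd].
      by apply: smoothM => //; exact: smooth_cst.
    by apply: smoothM => //; exact: smooth_cst.
  apply: smooth_bknot2 => //; [exact: smooth_fst|exact: smooth_snd].
- by move=> u u01; apply: dirfield_link; exact: dw0.
- by move=> j; rewrite L1.
Qed.

Lemma knot_link_isotopic (K K' : sknot R 0) : isotopic K K' ->
  link_isotopic (knot_link K) (knot_link K').
Proof.
move=> [H [q [[CH _ sH] [H0 _] [H1 _]]]].
exists (fun u _ => H u), id; split=> //.
- by split=> // j; exact: CH.
- move=> u /sH[imm _ inj _]; split=> // j s k t.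
  by rewrite !ord1; split=> [/inj[h|[[]]//]|[_ h]]; [split|apply/inj; left].
- by rewrite H0.
Qed.

Section Values.
Variable nabla : forall r : nat, link R r -> {poly int}.
Hypothesis hnabla : conway_polynomial nabla.

(** The coefficients are defined through a chosen representative of the class; invariance under
    isotopy transfers the value to any curve that represents it. *)
Lemma nabla_rep (x : cube R CK0 0) g q t (L : link R 0) : rep x g q t ->
  lcurve L = (fun=> g) -> nabla (knot_link (repr0 x)) = nabla L.
Proof.
move=> [K [Kx Kg _]] Lg; have [iso _ _] := hnabla.
rewrite -(_ : knot_link K = L); last by apply: link_eq; rewrite Lg -Kg.
have : class0 (repr0 x) = class0 K by rewrite Kx /class0 /repr0 reprK.
move=> /class0P; elim=> [K1 K2 /knot_link_isotopic|//|//|K1 K2 K3 _ -> _ ->//].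
exact: iso.
Qed.

Definition even_twist (m : int) : bool := cos (pi * m%:~R) == 1 :> R.

Lemma cos_even m : cos (pi * m%:~R) = sg (even_twist m).
Proof.
have := cos2Dsin2 (pi * m%:~R : R); rewrite sin_piz expr0n addr0 /even_twist.
by move/eqP; rewrite sqrf_eq1 => /orP[]/eqP ->; rewrite ?eqxx// eqNr oner_eq0.
Qed.

Lemma even_shift m s : even_twist (shift_twist m s) = ~~ even_twist m.
Proof.
by rewrite /even_twist cos_shift cos_even /bsign; case: even_twist;
  rewrite ?opprK ?eqxx ?eqNr ?oner_eq0.
Qed.

Lemma dirfield_uvec m a : dirfield (even_twist m) (uvec m a).
Proof.
split=> [|x|x]; first exact: smooth2_uvec.
  by rewrite uvec_next cos_even.
by rewrite uvec_norm ltr01 lexx.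
Qed.

(* T(m) *)
Definition tnabla m := nabla (braid_link (dirfield_uvec m 0)).

Lemma nabla_isotopy (b : bool) (w1 w2 : R * R -> R) (L L' : link R b) :
  smooth w1 -> smooth w2 ->
  (forall u, 0 <= u <= 1 -> dirfield b (fun x => (w1 (u, x), w2 (u, x)))) ->
  lcurve L = @closed_braid b (fun x => (w1 (0, x), w2 (0, x))) ->
  lcurve L' = @closed_braid b (fun x => (w1 (1, x), w2 (1, x))) ->
  nabla L = nabla L'.
Proof.
move=> C1 C2 dw0 L0 L1; have [iso _ _] := hnabla.
exact/iso/(closed_braid_isotopic C1 C2 dw0 L0 L1).
Qed.

Lemma tnablaE (b : bool) m a (L : link R b) : b = even_twist m ->
  lcurve L = @closed_braid b (uvec m a) -> nabla L = tnabla m.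
Proof.
move=> bm; subst b => La.
pose A (p : R * R) := (1 - p.1) * a.
have CA : smooth A.
  apply: smoothM; last exact: smooth_cst.
  by apply: smoothB; [exact: smooth_cst|exact: smooth_fst].
apply: (@nabla_isotopy _ (fun p => cos (phase m (A p) p.2))
  (fun p => sin (phase m (A p) p.2))).
- by apply: smooth_cosphase => //; exact: smooth_snd.
- by apply: smooth_sinphase => //; exact: smooth_snd.
- by move=> u _; exact: (dirfield_uvec m ((1 - u) * a)).
- by rewrite La /A /= subr0 mul1r.
- by rewrite /A /= subrr mul0r.
Qed.

End Values.

End ClosedBraidLinks.

(** * Offsets of the strands in the skein triple *)

Section SkeinFields.
Variable R : realType.
Local Notation R3 := 'rV[R]_3.
Local Notation sg s := (bsign R s).

(** The threshold 1/5 is the value of sin(pi x)^2 at tan(pi x) = 1/2. In the coordinate X = tan(pi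
    x) of the ball, the profiles have to take their standard form from |X| = 1/2 on. *)
Definition bump (y : R) : R := flat 0 (5%:R^-1 - y).

Lemma bump_ge0 y : 0 <= bump y.
Proof. by have /andP[] := flat_le 0 (5%:R^-1 - y). Qed.

Lemma bump_eq0 y : 5%:R^-1 <= y -> bump y = 0.
Proof. by move=> h; rewrite /bump /flat ltNge subr_le0 h. Qed.

Lemma bump_le y : 0 <= y -> bump y <= 5%:R^-1.
Proof.
move=> y0; have [h|h] := lerP 5%:R^-1 y; first by rewrite bump_eq0// invr_ge0.
have /andP[_ /le_trans] := flat_le 0 (5%:R^-1 - y); apply.
by rewrite mul1r ger0_norm; lra.
Qed.

Lemma bump_gt0 : 0 < bump 0.
Proof. by rewrite /bump /flat subr0 invr_gt0 ltr0n expr0 mul1r expR_gt0. Qed.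

Definition sinpi2 (x : R) := sin (pi * x) ^+ 2.
Definition gap (x : R) : R := bump (sinpi2 x).
(** A positive smooth function equal to |sin(pi x)| away from the integers: where sin(pi x) changes
    sign and the strands would cross, each now stays on its own side. *)
Definition strand_radius (x : R) : R := Num.sqrt (sinpi2 x + gap x).

Lemma sinpi2_ge0 x : 0 <= sinpi2 x. Proof. exact: sqr_ge0. Qed.

Lemma sinpi2_z x (k : int) : sinpi2 (x + k%:~R) = sinpi2 x.
Proof.
apply: (@periodicZ _ _ sinpi2) => t.
by rewrite /sinpi2 mulrDr mulr1 sinDpi sqrrN.
Qed.

Lemma smooth_sinpi (V : normedModType R) (x : V -> R) : smooth x ->
  smooth (fun v => sin (pi * x v)).
Proof.
move=> Cx; apply: (smooth_comp (@smooth_sin R)).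
by apply: smoothM => //; exact: smooth_cst.
Qed.

Lemma smooth_sinpi2 : smooth sinpi2.
Proof. by apply: smoothM; apply: smooth_sinpi; exact: smooth_id. Qed.

Lemma smooth_gap : smooth gap.
Proof.
apply: (smooth_comp (@smooth_flat R 0)).
by apply: smoothB; [exact: smooth_cst|exact: smooth_sinpi2].
Qed.

Lemma gap_next x : gap (x + 1) = gap x.
Proof. by rewrite /gap (sinpi2_z x 1). Qed.

Lemma gap01 x : 0 <= gap x <= 1.
Proof.
rewrite bump_ge0 (le_trans (bump_le (sinpi2_ge0 x)))//.
by rewrite invf_le1// ler1n.
Qed.

Lemma gap_gt0 x : sin (pi * x) = 0 -> 0 < gap x.
Proof. by rewrite /gap /sinpi2 => ->; rewrite expr0n; exact: bump_gt0. Qed.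

Lemma radius_arg x : 0 < sinpi2 x + gap x <= 1.
Proof.
apply/andP; split.
  have [s0|sn] := eqVneq (sin (pi * x)) 0.
    by rewrite ltr_wpDl ?sinpi2_ge0 ?gap_gt0.
  by rewrite ltr_wpDr ?bump_ge0// /sinpi2 exprn_even_gt0.
have s1 : sinpi2 x <= 1.
  by have := cos2Dsin2 (pi * x); have := sqr_ge0 (cos (pi * x)); rewrite /sinpi2; lra.
have := bump_le (sinpi2_ge0 x); rewrite /gap.
have [h _|h] := lerP 5%:R^-1 (sinpi2 x); first by rewrite bump_eq0// addr0.
by lra.
Qed.

Lemma radius01 x : 0 < strand_radius x <= 1.
Proof.
have /andP[h0 h1] := radius_arg x.
by rewrite sqrtr_gt0 h0 -sqrtr1 ler_sqrt.
Qed.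

Lemma radius_next x : strand_radius (x + 1) = strand_radius x.
Proof. by rewrite /strand_radius gap_next (sinpi2_z x 1). Qed.

Lemma smooth_radius : smooth strand_radius.
Proof.
apply: smooth_sqrt => [x|]; first by have /andP[] := radius_arg x.
by apply: smoothD; [exact: smooth_sinpi2|exact: smooth_gap].
Qed.

Lemma unfold_dirfield m s (h : R -> R) : smooth h -> (forall x, h (x + 1) = h x) ->
  (forall x, 0 <= h x <= 1) -> (forall x, sin (pi * x) = 0 -> 0 < h x) ->
  dirfield (~~ even_twist R m) (fun x => unfold_dir m 0 0 s (h x) x).
Proof.
move=> Ch h1 h01 h0; have [C1 C2] := smooth_unfold m (0 : R) 0 s.
split=> [|x|x].
- split; [apply: (smooth_comp2 C1)|apply: (smooth_comp2 C2)] => //;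
    exact: smooth_id.
- rewrite h1 unfold_dir_next cos_even /bsign.
  by case: even_twist => //=; rewrite opprK.
- rewrite unfold_dir_norm subr0.
  have := cos2Dsin2 (pi * x); have := sqr_ge0 (cos (pi * x)).
  have := sqr_ge0 (sin (pi * x)); have /andP[hx0 hx1] := h01 x.
  have h2 : 0 <= h x ^+ 2 <= 1 by rewrite sqr_ge0 exprn_ile1.
  have hs := h0 x; move=> s2 c2 n1; apply/andP; split; last by nra.
  have [s0|sn] := eqVneq (sin (pi * x)) 0.
    have c1 : cos (pi * x) ^+ 2 = 1 by move: n1; rewrite s0 expr0n addr0.
    by rewrite s0 c1 expr0n add0r mulr1 exprn_gt0// hs.
  by rewrite ltr_wpDr ?exprn_even_gt0// mulr_ge0 ?sqr_ge0.
Qed.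

Lemma radial_dirfield m (h : R -> R) : smooth h -> (forall x, h (x + 1) = h x) ->
  (forall x, 0 < h x <= 1) -> dirfield (even_twist R m) (mul2 h (uvec m 0)).
Proof.
move=> Ch h1 h01; split=> [|x|x].
- by apply: smooth2_mul => //; exact: smooth2_uvec.
- by rewrite /mul2 h1 uvec_next cos_even /=; congr (_, _); exact: mulrCA.
- rewrite /mul2 /= !exprMn -mulrDr uvec_norm mulr1.
  by have /andP[h0 hx1] := h01 x; rewrite exprn_gt0//= exprn_ile1// ltW.
Qed.

(** One zero at 0 is opened near 0 only; in [smooth_field] it is rounded off there. Elsewhere the
    three links follow [ref_field] up to exchanging the strands. *)
Definition cross_field m s x := unfold_dir m 0 0 s (gap x) x.
Definition smooth_field m := mul2 strand_radius (uvec m 0).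

Lemma cross_dirfield m s : dirfield (~~ even_twist R m) (cross_field m s).
Proof.
apply: unfold_dirfield; [exact: smooth_gap|exact: gap_next|exact: gap01|].
exact: gap_gt0.
Qed.

Lemma smooth_dirfield m : dirfield (even_twist R m) (smooth_field m).
Proof.
apply: radial_dirfield; [exact: smooth_radius|exact: radius_next|].
exact: radius01.
Qed.

Section Values.
Variable nabla : forall r : nat, link R r -> {poly int}.
Hypothesis hnabla : conway_polynomial nabla.

(** Letting the local opening grow to the constant 1 keeps the field nonzero, and at 1 it is a
    rotating unit vector with one half twist more or less, by [unfold_dir1]. *)
Lemma nabla_cross m s :
  nabla (braid_link (cross_dirfield m s)) = tnabla nabla (shift_twist m s).
Proof.
have [C1 C2] := smooth_unfold m (0 : R) 0 s.
pose h (p : R * R) := (1 - p.1) * gap p.2 + p.1.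
have Ch : smooth h.
  apply: smoothD; last exact: smooth_fst.
  apply: smoothM; last exact: (smooth_comp smooth_gap (@smooth_snd _ _ _)).
  by apply: smoothB; [exact: smooth_cst|exact: smooth_fst].
have dh u : 0 <= u <= 1 ->
    dirfield (~~ even_twist R m) (fun x => unfold_dir m 0 0 s (h (u, x)) x).
  move=> /andP[u0 u1]; apply: unfold_dirfield => [|x|x|x s0].
  - by apply: (smooth_comp2 Ch); [exact: smooth_cst|exact: smooth_id].
  - by rewrite /h /= gap_next.
  - rewrite /h /=; have /andP[g0 g1] := gap01 x.
    by apply/andP; split; nra.
  - by rewrite /h /=; have := gap_gt0 s0; have /andP[g0 g1] := gap01 x; nra.
have u1 : 0 <= (1 : R) <= 1 by rewrite ler01 lexx.
rewrite -(tnablaE hnabla (b := ~~ even_twist R m) (m := shift_twist m s)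
  (a := 0 - sg s * (pi * 0 + pi / 2)) (L := braid_link (dh 1 u1))).
- apply: (@nabla_isotopy _ nabla hnabla _
    (fun p => (unfold_dir m 0 0 s (h p) p.2).1)
    (fun p => (unfold_dir m 0 0 s (h p) p.2).2)).
  + by apply: (smooth_comp2 C1) => //; exact: smooth_snd.
  + by apply: (smooth_comp2 C2) => //; exact: smooth_snd.
  + by move=> u /dh.
  + congr closed_braid; apply/funext => x.
    by rewrite /cross_field /h [(0, x).1]/= subr0 mul1r addr0.
  + by [].
- by rewrite even_shift.
- rewrite -unfold_dir1; congr closed_braid; apply/funext => x.
  by rewrite /h [(1, x).1]/= subrr mul0r add0r.
Qed.

Lemma nabla_smooth m : nabla (braid_link (smooth_dirfield m)) = tnabla nabla m.
Proof.
pose h (p : R * R) := (1 - p.1) * strand_radius p.2 + p.1.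
have Ch : smooth h.
  apply: smoothD; last exact: smooth_fst.
  apply: smoothM; last exact: (smooth_comp smooth_radius (@smooth_snd _ _ _)).
  by apply: smoothB; [exact: smooth_cst|exact: smooth_fst].
have C0 : smooth (fun p : R * R => 0 : R) by exact: smooth_cst.
apply: (@nabla_isotopy _ nabla hnabla _
    (fun p => h p * cos (phase m 0 p.2)) (fun p => h p * sin (phase m 0 p.2))).
- by apply: smoothM => //; apply: smooth_cosphase => //; exact: smooth_snd.
- by apply: smoothM => //; apply: smooth_sinphase => //; exact: smooth_snd.
- move=> u /andP[u0 u1].
  apply: (@radial_dirfield m (fun x => h (u, x))) => [|x|x].
  + by apply: (smooth_comp2 Ch); [exact: smooth_cst|exact: smooth_id].
  + by rewrite /h /= radius_next.
  + rewrite /h /=; have /andP[g0 g1] := radius01 x.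
    by apply/andP; split; nra.
- congr closed_braid; apply/funext => x.
  by rewrite /smooth_field /mul2 /h /= subr0 mul1r addr0.
- congr closed_braid; apply/funext => x.
  by rewrite /h /= subrr mul0r add0r !mul1r.
Qed.

End Values.

Definition ref_field m := mul2 (fun x : R => sin (pi * x)) (uvec m 0).

(* Outside the ball, the fields agree up to sign with one another. *)
Definition outer m (w : R -> R * R) := forall t, 5%:R^-1 < sinpi2 t ->
  exists c, \forall x \near t, w x = sign2 c (ref_field m) x.

Lemma sinpi2_near t : 5%:R^-1 < sinpi2 t -> \forall x \near t, 5%:R^-1 < sinpi2 x.
Proof.
by move=> h; apply: (cvgr_gt _ (smooth_continuous smooth_sinpi2 (x := t))).
Qed.

Lemma cross_outer m s : outer m (cross_field m s).
Proof.
move=> t /sinpi2_near h; exists true; near=> x.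
have hx : 5%:R^-1 < sinpi2 x by near: x.
rewrite /cross_field /gap bump_eq0 1?ltW// /unfold_dir /sign2 /mul2 /uvec subr0 /=.
by rewrite !mul0r addr0 subr0 !mul1r.
Unshelve. all: by end_near. Qed.

(** |sin(pi x)| is sin(pi x) up to a sign that is constant near [t] but differs on the two sides of
    an integer, so [c] has to depend on [t]. *)
Lemma smooth_outer m : outer m (smooth_field m).
Proof.
move=> t ht; have h := sinpi2_near ht.
have Cs : {for t, continuous (fun x => sin (pi * x))}.
  exact: (smooth_continuous (smooth_sinpi (@smooth_id R R)) (x := t)).
have [s0|s0|s0] := ltrgt0P (sin (pi * t)).
- exists true; near=> x.
  have hx : 5%:R^-1 < sinpi2 x by near: x.
  have sx : 0 < sin (pi * x) by near: x; apply: (cvgr_gt _ Cs).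
  rewrite /smooth_field /sign2 /mul2 /= /strand_radius /gap bump_eq0 1?ltW// addr0.
  by rewrite /sinpi2 sqrtr_sqr !mul1r gtr0_norm.
- exists false; near=> x.
  have hx : 5%:R^-1 < sinpi2 x by near: x.
  have sx : sin (pi * x) < 0 by near: x; apply: (cvgr_lt _ Cs).
  rewrite /smooth_field /sign2 /mul2 /= /strand_radius /gap bump_eq0 1?ltW// addr0.
  by rewrite /sinpi2 sqrtr_sqr !mulN1r ltr0_norm// !mulNr.
- by move: ht; rewrite /sinpi2 s0 expr0n /= ltNge invr_ge0 ler0n.
Unshelve. all: by end_near. Qed.

End SkeinFields.

(** * The ball of the skein relation *)

Section SkeinBall.
Variable R : realType.
Local Notation R3 := 'rV[R]_3.
Local Notation sg s := (bsign R s).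

Lemma sin_atan (X : R) : sin (atan X) = X * cos (atan X).
Proof.
have c0 : cos (atan X) != 0.
  by apply/lt0r_neq0/cos_gt0_pihalf; rewrite atan_gtNpi2 atan_ltpi2.
by rewrite -{2}(atanK X) /tan divfK.
Qed.

Lemma cos_atan_gt0 (X : R) : 0 < cos (atan X).
Proof. by apply: cos_gt0_pihalf; rewrite atan_gtNpi2 atan_ltpi2. Qed.

Lemma cos_atan2 (X : R) : cos (atan X) ^+ 2 * (1 + X ^+ 2) = 1.
Proof.
have := cos2Dsin2 (atan X); rewrite sin_atan exprMn => h.
by rewrite -[RHS]h; ring.
Qed.

(** The inverse of X = tan(pi x), where |X| <= 1 means sin(pi x)^2 <= 1/2. The offset sin(pi x)
    equals X cos(atan X); with the factor cos(atan X) built into the chart, it becomes the straight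
    line that [crossing] prescribes. *)
Definition turn (X : R) : R := atan X / pi.

Lemma pi_turn X : pi * turn X = atan X.
Proof. by rewrite /turn mulrC divfK// gt_eqF// pi_gt0. Qed.

Lemma sinpi2_turn X : sinpi2 (turn X) = X ^+ 2 * cos (atan X) ^+ 2.
Proof. by rewrite /sinpi2 pi_turn sin_atan exprMn. Qed.

Lemma turn_bound X : `|turn X| < 2^-1.
Proof.
have := atan_gtNpi2 X; have := atan_ltpi2 X; rewrite -!pi_turn.
have := pi_gt0 R => p0; rewrite ltr_norml => h1 h2.
by apply/andP; split; rewrite -(ltr_pM2l p0); lra.
Qed.

Lemma turn_inj X Y : eqZ (turn X) (turn Y) -> X = Y.
Proof.
move=> /eqZP[k h]; have := turn_bound X; have := turn_bound Y.
rewrite !ltr_norml => /andP[y0 y1] /andP[x0 x1].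
have k0 : k = 0.
  have : (-1)%:~R < k%:~R :> R by rewrite mulrN1z; lra.
  have : k%:~R < 1%:~R :> R by rewrite -[1%:~R]/(1 : R); lra.
  by rewrite !ltr_int; lia.
by rewrite -(atanK X) -(atanK Y) -!pi_turn h k0 addr0.
Qed.

Lemma turn_exists t : sinpi2 t <= 2^-1 ->
  exists X (k : int), `|X| <= 1 /\ t = turn X + k%:~R.
Proof.
set k := Num.floor (t + 2^-1); set y := t - k%:~R.
have /andP[f0 f1] : k%:~R <= t + 2^-1 < (k + 1)%:~R.
  exact: floor_itv.
rewrite (_ : sinpi2 t = sinpi2 y); last first.
  by rewrite -[in LHS](subrK k%:~R t) sinpi2_z.
move=> sy.
have yb : - 2^-1 < y < 2^-1.
  move: f1; rewrite intrD => f1; apply/andP; split; last by rewrite /y; lra.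
  rewrite lt_neqAle; apply/andP; split; last by rewrite /y; lra.
  apply/eqP => yh; move: sy.
  rewrite /sinpi2 -yh (_ : pi * - 2^-1 = - (pi / 2)); last by rewrite mulrN.
  by rewrite sinN sin_pihalf sqrrN expr1n; lra.
have p0 := pi_gt0 R.
have yI : pi * y \in `](- (pi / 2)), (pi / 2)[.
  by rewrite in_itv/=; move: yb => /andP[y0 y1]; apply/andP; split; nra.
have cy : 0 < cos (pi * y).
  by apply: cos_gt0_pihalf; move: yI; rewrite in_itv.
exists (tan (pi * y)), k; split.
  rewrite -(@expr_le1 _ 2)// real_normK ?num_real//.
  rewrite /tan expr_div_n ler_pdivrMr ?exprn_gt0// mul1r.
  by have := cos2Dsin2 (pi * y); move: sy; rewrite /sinpi2; lra.
by rewrite /turn tanK// mulrC mulKf ?gt_eqF// /y subrK.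
Qed.

Lemma is_derive_turn (X : R) : is_derive X 1 turn ((1 + X ^+ 2)^-1 / pi).
Proof.
rewrite mulrC; have -> : turn = fun x => pi^-1 * atan x.
  by apply/funext => x; rewrite mulrC.
have d : is_derive X 1 atan (1 + X ^+ 2)^-1 by exact: is_derive1_atan.
apply: (is_derive_eq (is_deriveM (is_derive_cst pi^-1 X 1) d)).
by rewrite -[LHS]/(_ * _ + _ * 0) mulr0 addr0.
Qed.

Lemma smooth_turn (V : normedModType R) (x : V -> R) : smooth x ->
  smooth (fun v => turn (x v)).
Proof.
move=> Cx; apply: smoothM; last exact: smooth_cst.
exact: (smooth_comp (@smooth_atan R)).
Qed.

Lemma smooth_cos_atan (V : normedModType R) (x : V -> R) : smooth x ->
  smooth (fun v => cos (atan (x v))).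
Proof.
move=> Cx; apply: (smooth_comp (@smooth_cos R)).
exact: (smooth_comp (@smooth_atan R)).
Qed.

Section Chart.
Variable m : int.

Definition chart1 (p : R3) : R := cos (atan (p 0 0)) *
  (p 0 1 * cos (phase m 0 (turn (p 0 0))) - p 0 2%:R * sin (phase m 0 (turn (p 0 0)))).
Definition chart2 (p : R3) : R := cos (atan (p 0 0)) *
  (p 0 1 * sin (phase m 0 (turn (p 0 0))) + p 0 2%:R * cos (phase m 0 (turn (p 0 0)))).

(* The first coordinate parametrizes the half of the core circle where the two
   strands come close; the other two turn along with the twist. *)
Definition chart (p : R3) : R3 := cyl (turn (p 0 0)) (chart1 p) (chart2 p).

Lemma smooth_chart12 : smooth chart1 /\ smooth chart2.
Proof.
have C i : smooth (fun p : R3 => p 0 i) by exact: smooth_coord (@smooth_id R _).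
have C0 : smooth (fun p : R3 => 0 : R) by exact: smooth_cst.
have Ct := smooth_turn (C 0).
have Cc := smooth_cosphase m C0 Ct; have Cs := smooth_sinphase m C0 Ct.
have Ca := smooth_cos_atan (C 0).
split; apply: smoothM => //.
  by apply: smoothB; exact: smoothM.
by apply: smoothD; exact: smoothM.
Qed.

Lemma smooth_chart : smooth chart.
Proof.
have [C1 C2] := smooth_chart12; apply: smooth_strand => //.
by apply: smooth_turn; exact: smooth_coord (@smooth_id R _).
Qed.

Lemma chart_norm p : chart1 p ^+ 2 + chart2 p ^+ 2 =
  cos (atan (p 0 0)) ^+ 2 * (p 0 1 ^+ 2 + p 0 2%:R ^+ 2).
Proof.
rewrite /chart1 /chart2; have := cos2Dsin2 (phase m 0 (turn (p 0 0))).
set c := cos (phase _ _ _); set s := sin _ => n1.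
transitivity (cos (atan (p 0 0)) ^+ 2 * (p 0 1 ^+ 2 + p 0 2%:R ^+ 2) * (c ^+ 2 + s ^+ 2)).
  by ring.
by rewrite n1 mulr1.
Qed.

(** The transverse offset of a point of the box has length at most sqrt 8, less than the core radius
    3. *)
Lemma chart1_gt p : box p -> 0 < 3%:R + chart1 p.
Proof.
move=> [_ b1 b2]; have h := chart_norm p.
have h1 : p 0 1 ^+ 2 <= 4%:R.
  by rewrite -real_normK ?num_real//; have := normr_ge0 (p 0 1); nra.
have h2 : p 0 2%:R ^+ 2 <= 4%:R.
  by rewrite -real_normK ?num_real//; have := normr_ge0 (p 0 2%:R); nra.
have c1 : cos (atan (p 0 0)) ^+ 2 <= 1.
  have := cos2Dsin2 (atan (p 0 0)); have := sqr_ge0 (sin (atan (p 0 0))); lra.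
have c0 := sqr_ge0 (cos (atan (p 0 0))).
have s1 := sqr_ge0 (p 0 1); have s2 := sqr_ge0 (p 0 2%:R).
have : chart1 p ^+ 2 <= 8%:R.
  by have := sqr_ge0 (chart2 p); nra.
by nra.
Qed.

Lemma chart_inj : {in box (R := R) &, injective chart}.
Proof.
move=> p p' /set_mem bp /set_mem bp' /(cyl_inj (chart1_gt bp) (chart1_gt bp')).
move=> [/turn_inj e0 e1 e2]; move: e1 e2; rewrite /chart1 /chart2 -e0.
have c0 : cos (atan (p 0 0)) != 0 by rewrite gt_eqF// cos_atan_gt0.
move=> /(mulfI c0) + /(mulfI c0).
have := cos2Dsin2 (phase m 0 (turn (p 0 0))).
set c := cos (phase _ _ _); set s := sin _ => n1 e1 e2.
have E (y z : R) : y = (y * c - z * s) * c + (y * s + z * c) * s.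
  by transitivity (y * (c ^+ 2 + s ^+ 2)); [rewrite n1 mulr1|ring].
have E' (y z : R) : z = (y * s + z * c) * c - (y * c - z * s) * s.
  by transitivity (z * (c ^+ 2 + s ^+ 2)); [rewrite n1 mulr1|ring].
apply: vecP => //.
  by rewrite (E (p 0 1) (p 0 2%:R)) e1 e2 -E.
by rewrite (E' (p 0 1) (p 0 2%:R)) e1 e2 -E'.
Qed.

End Chart.

End SkeinBall.

(** * Orientation of the chart and standard form of the strands *)

Section SkeinRelation.
Variable R : realType.
Local Notation R3 := 'rV[R]_3.
Local Notation sg s := (bsign R s).

Lemma is_derive_cyl (x a b : R -> R) (t dx da db : R) :
  is_derive t 1 x dx -> is_derive t 1 a da -> is_derive t 1 b db ->
  is_derive t 1 (fun h => cyl (x h) (a h) (b h))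
    (vec3 (da * cos (2 * pi * x t) - (3%:R + a t) * (2 * pi * dx) * sin (2 * pi * x t))
       db
       (da * sin (2 * pi * x t) + (3%:R + a t) * (2 * pi * dx) * cos (2 * pi * x t))).
Proof.
move=> Dx Da Db.
have Da3 : is_derive t 1 (fun h => 3%:R + a h) da.
  by apply: (is_derive_eq (is_deriveD (is_derive_cst (3%:R : R) t 1) Da)); rewrite add0r.
have dc := @is_derive1_comp _ (fun y => cos (2 * pi * y)) x t _ _
  (is_derive_cos2pi (x t)) Dx.
have ds := @is_derive1_comp _ (fun y => sin (2 * pi * y)) x t _ _
  (is_derive_sin2pi (x t)) Dx.
apply: is_derive_vec3 => //.
  apply: (is_derive_eq (is_deriveM Da3 dc)).
  by rewrite -[_ *: _ + _]/(_ * _ + _ * _) /=; ring.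
apply: (is_derive_eq (is_deriveM Da3 ds)).
by rewrite -[_ *: _ + _]/(_ * _ + _ * _) /=; ring.
Qed.

Lemma derive_slice (V W : normedModType R) (f : V -> W) p v :
  'D_v f p = derive1 (fun h => f (h *: v + p)) 0.
Proof.
rewrite /derive1 /derive.
suff -> : (fun h : R => h^-1 *: ((f \o shift p) (h *: v) - f p)) =
  (fun h : R => h^-1 *: (f ((h + 0) *: v + p) - f (0 *: v + p))) by [].
by apply/funext => h /=; rewrite addr0 scale0r add0r.
Qed.

Lemma vec3_shift (p : R3) (h : R) :
  [/\ h *: delta_mx 0 0 + p = vec3 (h + p 0 0) (p 0 1) (p 0 2%:R),
      h *: delta_mx 0 1 + p = vec3 (p 0 0) (h + p 0 1) (p 0 2%:R) &
      h *: delta_mx 0 2%:R + p = vec3 (p 0 0) (p 0 1) (h + p 0 2%:R)].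
Proof.
by split; apply: vecP; rewrite !mxE /= ?eqxx /= ?mulr1 ?mulr0 ?add0r.
Qed.

Lemma jacobianE (f : R3 -> R3) p (i j : 'I_3) : differentiable f p ->
  'J f p i j = 'D_(delta_mx 0 i) f p 0 j.
Proof. by move=> df; rewrite deriveEjacobian// -rowE [RHS]mxE. Qed.

Lemma is_derive_affine (k x c t : R) : is_derive t 1 (fun h => k * (h + x) + c) k.
Proof.
have d1 : is_derive t 1 (fun h => h + x) 1.
  apply: (is_derive_eq (is_deriveD (is_derive_id t (1 : R)) (is_derive_cst x t 1))).
  by rewrite addr0.
have d2 := is_deriveM (is_derive_cst k t (1 : R)) d1.
apply: (is_derive_eq (is_deriveD d2 (is_derive_cst c t (1 : R)))).
by rewrite -[_ *: _ + _]/(_ * _ + _ * _) !mulr0 mulr1 !addr0.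
Qed.

(** The last two partial derivatives span the plane transverse to the core with area k^2, and the
    first has the component [K] along the core. Its transverse part [dA], [dB] cancels in the
    determinant, hence mere existence of these two numbers is recorded. *)
Lemma chart_jacobian m (p : R3) : box p -> 0 < \det ('J (chart m) p).
Proof.
move=> bp; have [C1 C2] := smooth_chart12 R m.
have df := smooth_differentiable p (@smooth_chart R m).
set X := p 0 0; set x := turn X; set k := cos (atan X); set ph := phase m 0 x.
set A := chart1 m p; set B := chart2 m p.
set c := cos (2 * pi * x); set s := sin (2 * pi * x).
have k0 : 0 < k by exact: cos_atan_gt0.
have dx0 : is_derive (0 : R) (1 : R) (fun=> x) 0 by exact: is_derive_cst.
have D1 : 'D_(delta_mx 0 1) (chart m) p =
    vec3 (k * cos ph * c) (k * sin ph) (k * cos ph * s).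
  rewrite derive_slice derive1E; apply: derive_val.
  pose c1 := - k * (p 0 2%:R * sin ph); pose c2 := k * (p 0 2%:R * cos ph).
  rewrite (_ : (fun h => _) = fun h : R => cyl x
    (k * cos ph * (h + p 0 1) + c1) (k * sin ph * (h + p 0 1) + c2)); last first.
    apply/funext => h; have [_ -> _] := vec3_shift p h.
    rewrite /chart /chart1 /chart2.
    have [-> -> ->] := vec3E (p 0 0) (h + p 0 1) (p 0 2%:R).
    by congr cyl; rewrite -/X -/x -/k -/ph /c1 /c2; ring.
  apply: (is_derive_eq (is_derive_cyl dx0
    (is_derive_affine _ _ _ _) (is_derive_affine _ _ _ _))).
  by rewrite -/c -/s !mulr0 !mul0r subr0 addr0.
have D2 : 'D_(delta_mx 0 2%:R) (chart m) p =
    vec3 (- k * sin ph * c) (k * cos ph) (- k * sin ph * s).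
  rewrite derive_slice derive1E; apply: derive_val.
  pose c1 := k * (p 0 1 * cos ph); pose c2 := k * (p 0 1 * sin ph).
  rewrite (_ : (fun h => _) = fun h : R => cyl x
    (- k * sin ph * (h + p 0 2%:R) + c1) (k * cos ph * (h + p 0 2%:R) + c2)); last first.
    apply/funext => h; have [_ _ ->] := vec3_shift p h.
    rewrite /chart /chart1 /chart2.
    have [-> -> ->] := vec3E (p 0 0) (p 0 1) (h + p 0 2%:R).
    by congr cyl; rewrite -/X -/x -/k -/ph /c1 /c2; ring.
  apply: (is_derive_eq (is_derive_cyl dx0
    (is_derive_affine _ _ _ _) (is_derive_affine _ _ _ _))).
  by rewrite -/c -/s !mulr0 !mul0r subr0 addr0.
have [dA [dB D0]] : exists dA dB, 'D_(delta_mx 0 0) (chart m) p =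
    vec3 (dA * c - (3%:R + A) * (2 * pi * ((1 + X ^+ 2)^-1 / pi)) * s) dB
      (dA * s + (3%:R + A) * (2 * pi * ((1 + X ^+ 2)^-1 / pi)) * c).
  pose a h := chart1 m (h *: delta_mx 0 0 + p).
  pose b h := chart2 m (h *: delta_mx 0 0 + p).
  have Cl : smooth (fun h : R => h *: delta_mx 0 0 + p).
    by apply: smoothD; [apply: smoothZl; exact: smooth_id|exact: smooth_cst].
  have D (f : R3 -> R) : smooth f ->
      derivable (f \o (fun h : R => h *: delta_mx 0 0 + p)) 0 1.
    move=> Cf; apply: diff_derivable; apply: differentiable_comp.
      exact: smooth_differentiable.
    exact: smooth_differentiable.
  have da : derivable a 0 1 by exact: D C1.
  have db : derivable b 0 1 by exact: D C2.
  exists ('D_1 a 0), ('D_1 b 0).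
  rewrite derive_slice derive1E; apply: derive_val.
  have dx : is_derive (0 : R) (1 : R) (fun h : R => turn (h + X)) ((1 + X ^+ 2)^-1 / pi).
    have dh : is_derive (0 : R) 1 (fun h => h + X) 1.
      have := is_derive_affine 1 X 0 0.
      by under eq_fun do rewrite mul1r addr0.
    have dt := is_derive_turn (0 + X).
    apply: (is_derive_eq (@is_derive1_comp _ (@turn R) (fun h => h + X) 0 _ _ dt dh)).
    by rewrite add0r mulr1.
  rewrite (_ : (fun h => _) = fun h : R => cyl (turn (h + X)) (a h) (b h)); last first.
    apply/funext => h; rewrite /chart /a /b; congr (cyl (turn _) _ _).
    by rewrite !mxE /= mulr1.
  apply: (is_derive_eq (is_derive_cyl dx (derivableP da) (derivableP db))).
  by rewrite /a scale0r !add0r.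
rewrite det_mx33 !jacobianE// D0 D1 D2 !mxE /=.
have K0 : 0 < (3%:R + A) * (2 * pi * ((1 + X ^+ 2)^-1 / pi)).
  rewrite mulr_gt0 ?chart1_gt// mulr_gt0// ?mulr_gt0 ?divr_gt0 ?invr_gt0 ?pi_gt0//.
  by rewrite ltr_wpDr ?sqr_ge0.
set K := (3%:R + A) * _ in K0 *.
rewrite [ltRHS](_ : _ = K * k ^+ 2 * (c ^+ 2 + s ^+ 2) * (cos ph ^+ 2 + sin ph ^+ 2)).
  by rewrite !cos2Dsin2 !mulr1 mulr_gt0 ?exprn_gt0.
by ring.
Qed.

Lemma chart_ball m : ball_chart (@chart R m).
Proof.
split; [exact: smooth_chart|exact: chart_inj|exact: chart_jacobian].
Qed.

Definition cross_profile (X : R) : R := gap (turn X).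
Definition smooth_profile (X : R) : R := strand_radius (turn X) / cos (atan X).

Lemma cross_profileP : crossing_profile cross_profile.
Proof.
split=> [|X||X hX].
- by apply: (smooth_comp (@smooth_gap R)); apply: smooth_turn; exact: smooth_id.
- exact: gap01.
- by apply: gap_gt0; rewrite pi_turn atan0 sin0.
apply: bump_eq0; rewrite sinpi2_turn.
have X2 : 4%:R^-1 <= X ^+ 2.
  by rewrite -real_normK ?num_real//; have := normr_ge0 X; nra.
by have := cos_atan2 X; have := sqr_ge0 (cos (atan X)); nra.
Qed.

Lemma smooth_profileP : smoothing_profile smooth_profile.
Proof.
split=> [|X X1|X /andP[hX _]].
- apply: smoothM.
    by apply: (smooth_comp (@smooth_radius R)); apply: smooth_turn; exact: smooth_id.
  apply: smoothV => [x|]; first by rewrite gt_eqF// cos_atan_gt0.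
  by apply: smooth_cos_atan; exact: smooth_id.
- have c0 := cos_atan_gt0 X; have /andP[r0 r1] := radius01 (turn X).
  rewrite divr_gt0//= ler_pdivrMr// mul1r.
  rewrite -(@ler_pXn2r _ 2) ?nnegrE ?(ltW r0) ?(ltW c0)//.
  have /andP[h0 _] := radius_arg (turn X).
  rewrite sqr_sqrtr ?(ltW h0)// sinpi2_turn.
  have X2 : X ^+ 2 <= 1.
    by rewrite -real_normK ?num_real//; have := normr_ge0 X; nra.
  have gl := bump_le (sinpi2_ge0 (turn X)); have cX := cos_atan2 X.
  have X0 := sqr_ge0 X.
  (* With S = sin(pi x)^2 and C = cos(atan X)^2 = 1 - S the claim is S + gap <= C. Beyond the
     threshold the gap is 0 and X^2 <= 1; below it S and the gap are at most 1/5, while C is at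
     least 4/5. *)
  rewrite /gap; have [h|h] := lerP 5%:R^-1 (sinpi2 (turn X)).
    by rewrite bump_eq0// addr0 ler_piMl// sqr_ge0.
  by move: gl h cX; rewrite sinpi2_turn; lra.
- have := cross_profileP => -[_ _ _ gz]; have := gz _ hX.
  rewrite /cross_profile /smooth_profile /strand_radius => ->.
  rewrite addr0 sinpi2_turn -exprMn sqrtr_sqr normrM.
  by rewrite (gtr0_norm (cos_atan_gt0 X)) mulfK// gt_eqF// cos_atan_gt0.
Qed.

Lemma chart_crossing m s e X : chart m (crossing cross_profile s e X) =
  strand (sign2 e (cross_field m s)) (turn X).
Proof.
rewrite /chart /chart1 /chart2 /crossing.
have [-> -> ->] := vec3E X (sg e * X) (- (sg s * sg e * cross_profile X)).
rewrite /strand /sign2 /mul2 /cross_field /unfold_dir /= subr0 pi_turn sin_atan.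
rewrite -/(cross_profile X); congr cyl; ring.
Qed.

Lemma chart_smoothing m e X : chart m (smoothing smooth_profile e X) =
  strand (sign2 e (smooth_field m)) (turn X).
Proof.
rewrite /chart /chart1 /chart2 /smoothing.
have [-> -> ->] := vec3E X (sg e * smooth_profile X) 0.
rewrite /strand /sign2 /mul2 /smooth_field /uvec /smooth_profile /=.
have c0 : cos (atan X) != 0 by rewrite gt_eqF// cos_atan_gt0.
by congr cyl; field.
Qed.

Lemma box_crossing s e (X : R) : `|X| <= 1 -> box (crossing cross_profile s e X).
Proof.
move=> X1; rewrite /box /crossing /=.
have [-> -> ->] := vec3E X (sg e * X) (- (sg s * sg e * cross_profile X)).
have [_ h _ _] := cross_profileP; have /andP[h0 h1] := h X.
have n1 (b : bool) : `|sg b| = 1 by rewrite /bsign; case: b; rewrite ?normrN normr1.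
split=> //; first by rewrite normrM n1 mul1r; lra.
by rewrite normrN !normrM !n1 !mul1r ger0_norm//; lra.
Qed.

Lemma box_smoothing e (X : R) : `|X| <= 1 -> box (smoothing smooth_profile e X).
Proof.
move=> X1; rewrite /box /smoothing /=.
have [-> -> ->] := vec3E X (sg e * smooth_profile X) 0.
have [_ h _] := smooth_profileP; have /andP[h0 h1] := h X X1.
split=> //; last by rewrite normr0.
have n1 : `|sg e| = 1 by rewrite /bsign; case: e; rewrite ?normrN normr1.
by rewrite normrM n1 mul1r gtr0_norm//; lra.
Qed.

End SkeinRelation.

(** * The skein triple of twisted strands *)

Section SkeinTriples.
Variable R : realType.
Local Notation R3 := 'rV[R]_3.
Local Notation sg s := (bsign R s).

Lemma strand_z b (w : R -> R * R) (k : int) : dirfield b w -> exists c, forall e,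
  (fun x => strand (sign2 e w) (x + k%:~R)) = strand (sign2 (e (+) c) w).
Proof.
move=> dw0; have [c cE] := dirfield_z k dw0; exists c => e.
by apply/funext => x; rewrite /strand cE cyl_z.
Qed.

Definition charted m (w : R -> R * R) (a : bool -> R -> R3) : Prop := forall e X,
  chart m (a e X) = strand (sign2 e w) (turn X) /\ (`|X| <= 1 -> box (a e X)).

Lemma chart_looks m b w r (L : link R r) a : dirfield b w ->
  oriented_image L = \bigcup_(e : bool) oriented_arc (strand (sign2 e w)) setT ->
  charted m w a -> looks_like L (chart m) a.
Proof.
move=> dw0 im fit; have [Cw _ _] := dw0; rewrite /looks_like im.
have Cs e : smooth (strand (sign2 e w)) by apply: smooth_strand1; exact: smooth2_sign.
have pos x e : 0 < 3%:R + (sign2 e w x).1 by have [h _] := dirfield_ge x e dw0; lra.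
have t0 X : 0 < (1 + X ^+ 2)^-1 / pi :> R.
  by rewrite divr_gt0 ?pi_gt0// invr_gt0 ltr_wpDr ?sqr_ge0.
have D e X : derive1 (chart m \o a e) X =
    ((1 + X ^+ 2)^-1 / pi) *: derive1 (strand (sign2 e w)) (turn X).
  rewrite -(derive1_compr (Cs e) (is_derive_turn X)).
  by congr (derive1 _ X); apply/funext => Y; have [] := fit e Y.
apply/seteqP; split=> [[p v]|[p v]].
  move=> [[e _ [t [l [_ l0 [-> ->]]]]] [q bq /= /(cyl_inj (chart1_gt m bq) (pos _ _))]].
  (* The angle of a point in the ball fixes [X] up to an integral shift [k], which permutes the
     strands by [c]. *)
  move=> [/eqZ_sym/eqZP[k tk] _ _]; have [c /(_ e) cE] := strand_z k dw0.
  set X := q 0 0 in tk; have [fX _] := fit (e (+) c) X.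
  exists (e (+) c) => //; exists X, (l / ((1 + X ^+ 2)^-1 / pi)).
  split; [by case: bq|exact: divr_gt0|].
  rewrite D scalerA (divfK (lt0r_neq0 (t0 X))) [(_ \o _) X]fX -cE derive1_shift.
  by rewrite tk.
move=> [e _ [X [l [X1 l0 [-> ->]]]]]; have [fX bX] := fit e X; split.
  exists e => //; exists (turn X), (l * ((1 + X ^+ 2)^-1 / pi)).
  by rewrite D scalerA /= fX; split=> //; rewrite mulr_gt0.
by exists (a e X) => //; exact: bX.
Qed.

(** A strand point at an angle with sin(pi t)^2 <= 1/2 lies in the ball. Beyond, hence above 1/5,
    both fields agree near [t] with [ref_field] up to signs; these only exchange the strands and
    leave points and tangents unchanged. *)
Lemma chart_agree_sub m b w b' w' r r' (L : link R r) (L' : link R r') a :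
  dirfield b w -> dirfield b' w' ->
  oriented_image L = \bigcup_(e : bool) oriented_arc (strand (sign2 e w)) setT ->
  oriented_image L' = \bigcup_(e : bool) oriented_arc (strand (sign2 e w')) setT ->
  charted m w a -> outer m w -> outer m w' ->
  oriented_image L `\` [set pv | (chart m @` box (R := R)) pv.1] `<=`
  oriented_image L' `\` [set pv | (chart m @` box (R := R)) pv.1].
Proof.
move=> dw0 dw0' -> -> fit ow ow' [p v] [[e _ [t [l [_ l0 [-> ->]]]]] out].
split=> //; have [h|h] := lerP (sinpi2 t) 2^-1.
  case: out; have [X [k [X1 ->]]] := turn_exists h.
  have [c /(_ e) cE] := strand_z k dw0; have [fX bX] := fit (e (+) c) X.
  exists (a (e (+) c) X); first exact: bX.
  by rewrite fX -cE.
have h5 : 5%:R^-1 < sinpi2 t by lra.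
have [c wc] := ow t h5; have [c' wc'] := ow' t h5.
pose e' := e (+) c (+) c'.
have sE : sg e * sg c = sg e' * sg c'.
  by rewrite /e' /bsign; case: (e); case: (c); case: (c') => /=; ring.
have near_eq : \forall x \near t, strand (sign2 e w) x = strand (sign2 e' w') x.
  near=> x; have E : sign2 e w x = sign2 e' w' x.
    rewrite /sign2 /mul2 (near wc x)// (near wc' x)// /sign2 /mul2 /= !mulrA.
    by rewrite sE.
  by rewrite /strand E.
exists e'; first by []; exists t, l; split; [by []|exact: l0|].
by rewrite (nbhs_singleton near_eq) !derive1E (near_eq_derive _ near_eq).
Unshelve. all: by end_near. Qed.

Lemma chart_agree m b w b' w' r r' (L : link R r) (L' : link R r') a a' :
  dirfield b w -> dirfield b' w' ->
  oriented_image L = \bigcup_(e : bool) oriented_arc (strand (sign2 e w)) setT ->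
  oriented_image L' = \bigcup_(e : bool) oriented_arc (strand (sign2 e w')) setT ->
  charted m w a -> charted m w' a' -> outer m w -> outer m w' ->
  agree_outside L L' (chart m).
Proof.
move=> d d' i i' f f' o o'; apply/seteqP; split.
  exact: (chart_agree_sub d d' i i' f o o').
exact: (chart_agree_sub d' d i' i f' o' o).
Qed.

Lemma cross_charted m s : charted m (cross_field m s) (crossing (@cross_profile R) s).
Proof. by move=> e X; split; [exact: chart_crossing|exact: box_crossing]. Qed.

Lemma smooth_charted m : charted m (smooth_field m) (smoothing (@smooth_profile R)).
Proof. by move=> e X; split; [exact: chart_smoothing|exact: box_smoothing]. Qed.

Lemma braid_skein m : skein_triple (braid_link (@cross_dirfield R m true))
  (braid_link (@cross_dirfield R m false)) (braid_link (@smooth_dirfield R m)).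
Proof.
have Ic s : oriented_image (braid_link (@cross_dirfield R m s)) =
    \bigcup_(e : bool) oriented_arc (strand (sign2 e (cross_field m s))) setT.
  exact: closed_braid_arc (@cross_dirfield R m s).
have I0 : oriented_image (braid_link (@smooth_dirfield R m)) =
    \bigcup_(e : bool) oriented_arc (strand (sign2 e (smooth_field m))) setT.
  exact: closed_braid_arc (@smooth_dirfield R m).
exists (@chart R m), (@cross_profile R), (@smooth_profile R); split.
- exact: chart_ball.
- by split; [exact: cross_profileP|exact: smooth_profileP].
- split.
    exact: (chart_agree (cross_dirfield _ _ true) (cross_dirfield _ _ false) (Ic _) (Ic _)
      (cross_charted _ _) (cross_charted _ _) (@cross_outer R m true)
      (@cross_outer R m false)).
  exact: (chart_agree (cross_dirfield _ _ true) (smooth_dirfield _ _) (Ic _) I0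
    (cross_charted _ _) (smooth_charted _) (@cross_outer R m true) (@smooth_outer R m)).
- split.
  + exact: (chart_looks (cross_dirfield _ _ _) (Ic _) (cross_charted _ _)).
  + exact: (chart_looks (cross_dirfield _ _ _) (Ic _) (cross_charted _ _)).
  + exact: (chart_looks (smooth_dirfield _ _) I0 (smooth_charted _)).
Qed.

Lemma tnabla_skein (nabla : forall r : nat, link R r -> {poly int}) m :
  conway_polynomial nabla ->
  tnabla nabla (shift_twist m true) - tnabla nabla (shift_twist m false) =
  'X * tnabla nabla m.
Proof.
move=> hn; rewrite -!nabla_cross// -nabla_smooth//.
have [_ _ sk] := hn; exact: sk (braid_skein m).
Qed.

End SkeinTriples.

(** * The closed strands with one half twist are unknotted *)

Section Unknot.
Variable R : realType.
Local Notation R3 := 'rV[R]_3.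
Local Notation cc t := (cos (2 * pi * t)).
Local Notation ss t := (sin (2 * pi * t)).
Variable nabla : forall r : nat, link R r -> {poly int}.
Hypothesis hnabla : conway_polynomial nabla.

Lemma circle_link (g : R -> R3) : smooth g -> (forall t, g (t + 1) = g t) ->
  (forall t, derive1 g t != 0) -> (forall s t, g s = g t -> eqZ s t) ->
  is_link (fun _ : 'I_1 => g).
Proof.
move=> Cg g1 dg gi; split=> // j s k t; rewrite !ord1; split=> [/gi //|[_]].
by move=> /eqZP[m ->]; rewrite periodicZ.
Qed.

Lemma nabla_circle (H : R -> R -> R3) (L L' : link R 0) : smooth_family H ->
  (forall u, 0 <= u <= 1 -> is_link (fun _ : 'I_1 => H u)) ->
  lcurve L = (fun _ => H 0) -> lcurve L' = (fun _ => H 1) -> nabla L = nabla L'.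
Proof.
move=> CH lH L0 L1; have [iso _ _] := hnabla; apply: iso.
exists (fun u _ => H u), id; split=> //; first by split=> // j; exact: CH.
by move=> j; rewrite L1.
Qed.

Lemma derive1_vec3 (f g h : R -> R) t : smooth f -> smooth g -> smooth h ->
  derive1 (fun t => vec3 (f t) (g t) (h t)) t =
  vec3 (derive1 f t) (derive1 g t) (derive1 h t).
Proof.
move=> Cf Cg Ch; rewrite !derive1E; apply: derive_val.
by apply: is_derive_vec3; apply: derivableP; exact: smooth_derivable.
Qed.

Lemma smooth_cc (V : normedModType R) (t : V -> R) : smooth t ->
  smooth (fun v => cc (t v)).
Proof.
move=> Ct; apply: (smooth_comp (@smooth_cos R)).
by apply: smoothM => //; exact: smooth_cst.
Qed.

Lemma smooth_ss (V : normedModType R) (t : V -> R) : smooth t ->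
  smooth (fun v => ss (t v)).
Proof.
move=> Ct; apply: (smooth_comp (@smooth_sin R)).
by apply: smoothM => //; exact: smooth_cst.
Qed.

Let A t : R := (3%:R + cc t) * (cc t ^+ 2 - ss t ^+ 2).
Let E t : R := (3%:R + cc t) * (2 * ss t).
Let B t : R := cc t * E t.

Lemma once_twisted t : bknot_curve (uvec 1 0) t = vec3 (A t) (ss t) (B t).
Proof.
rewrite /bknot_curve /strand /cyl /uvec /phase /=.
rewrite (_ : pi * 1 * (2 * t) + 0 = 2 * pi * t); last by ring.
rewrite (_ : 2 * pi * (2 * t) = 2 * pi * t + 2 * pi * t); last by ring.
by rewrite cosD sinD /A /B /E; congr vec3; ring.
Qed.

Lemma smooth_AEB : [/\ smooth A, smooth E & smooth B].
Proof.
have Cc := smooth_cc (@smooth_id R R); have Cs := smooth_ss (@smooth_id R R).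
have C3 : smooth (fun t : R => 3%:R + cc t).
  by apply: smoothD => //; exact: smooth_cst.
have CE : smooth E.
  by apply: smoothM => //; apply: smoothM => //; exact: smooth_cst.
split=> //; last exact: smoothM.
by apply: smoothM => //; apply: smoothB; exact: smoothM.
Qed.

Lemma cc1 (t : R) : cc (t + 1) = cc t. Proof. exact: (cos2pi_z t 1). Qed.
Lemma ss1 (t : R) : ss (t + 1) = ss t. Proof. exact: (sin2pi_z t 1). Qed.

Lemma derive1_cc t : derive1 (fun t : R => cc t) t = - (2 * pi) * ss t.
Proof. by rewrite derive1E; apply: derive_val; exact: is_derive_cos2pi. Qed.

Lemma derive1_ss t : derive1 (fun t : R => ss t) t = 2 * pi * cc t.
Proof. by rewrite derive1E; apply: derive_val; exact: is_derive_sin2pi. Qed.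

(** The second coordinate is stationary where cos vanishes, so the third has to move there. As it is
    a multiple of cos, only the derivative of that factor remains. *)
Lemma derive1_B t : cc t = 0 -> derive1 B t != 0.
Proof.
move=> c0; have [_ CE _] := smooth_AEB.
have dE : is_derive t 1 E (derive1 E t).
  by rewrite derive1E; apply: derivableP; exact: smooth_derivable.
have -> : derive1 B t = cc t * derive1 E t + E t * (- (2 * pi) * ss t).
  by rewrite derive1E; apply: derive_val; exact: is_deriveM (is_derive_cos2pi t) dE.
have := cos2Dsin2 (2 * pi * t); rewrite /E c0 expr0n add0r => s2.
rewrite mul0r add0r addr0 [X in X != 0](_ : _ = - (12%:R * pi) * ss t ^+ 2); last by ring.
by rewrite s2 mulr1 oppr_eq0 mulf_neq0 ?pnatr_eq0// gt_eqF// pi_gt0.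
Qed.

Lemma twopi_neq0 : (2 * pi == 0 :> R) = false.
Proof. by rewrite gt_eqF// mulr_gt0// pi_gt0. Qed.

(** The last two coordinates are immersed and coincide for distinct parameters only where sin
    vanishes. There the first coordinate is 3 (1 - u) + cos, which tells the points apart throughout
    the linear deformation to cos. *)
Lemma stage1_link u : 0 <= u <= 1 ->
  is_link (fun _ : 'I_1 => fun t => vec3 ((1 - u) * A t + u * cc t) (ss t) (B t)).
Proof.
move=> /andP[u0 u1]; have [CA _ CB] := smooth_AEB.
have Cc := smooth_cc (@smooth_id R R); have Cs := smooth_ss (@smooth_id R R).
have Cx : smooth (fun t => (1 - u) * A t + u * cc t).
  by apply: smoothD; apply: smoothM => //; exact: smooth_cst.
apply: circle_link => [|t|t|s t].
- exact: smooth_vec3.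
- by rewrite /A /B /E cc1 ss1.
- rewrite derive1_vec3// derive1_ss; apply/eqP => h.
  have := congr1 (fun M : R3 => M 0 1) h; have := congr1 (fun M : R3 => M 0 2%:R) h.
  rewrite /= !mxE /= => hB /eqP; rewrite mulf_eq0 twopi_neq0 /=.
  by move=> /eqP /derive1_B; rewrite hB eqxx.
- move=> h; have := congr1 (fun M : R3 => M 0 1) h.
  have := congr1 (fun M : R3 => M 0 2%:R) h; have := congr1 (fun M : R3 => M 0 0) h.
  rewrite /= !mxE /= => hx hB hs.
  apply: cs_eqZ => //; move: hx hB; rewrite /A /B /E hs.
  have n1 := cos2Dsin2 (2 * pi * s); have n2 := cos2Dsin2 (2 * pi * t).
  rewrite hs in n1; have := @cos_le1 R (2 * pi * s); have := @cos_le1 R (2 * pi * t).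
  have := @cos_geN1 R (2 * pi * s); have := @cos_geN1 R (2 * pi * t).
  move: n1 n2; move: (cc s) (cc t) (ss t) => c d z n1 n2 d1 c1 d2 c2 hx hB.
  have [z0|zn] := eqVneq z 0.
    move: n1 n2 hx; rewrite z0 expr0n /= !addr0 !subr0 => -> -> hx.
    by apply/eqP; rewrite -subr_eq0; apply/eqP; lra.
  have : (2 * z) * ((c - d) * (3%:R + c + d)) = 0 by nra.
  move/eqP; rewrite !mulf_eq0 pnatr_eq0 (negbTE zn) /= subr_eq0 => /orP[/eqP//|].
  by rewrite gt_eqF//; lra.
Qed.

(** The first two coordinates already trace the unit circle, so the third may be flattened. *)
Lemma stage2_link u :
  is_link (fun _ : 'I_1 => fun t => vec3 (cc t) (ss t) ((1 - u) * B t)).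
Proof.
have [_ _ CB] := smooth_AEB.
have Cc := smooth_cc (@smooth_id R R); have Cs := smooth_ss (@smooth_id R R).
have Cx : smooth (fun t => (1 - u) * B t).
  by apply: smoothM => //; exact: smooth_cst.
apply: circle_link => [|t|t|s t].
- exact: smooth_vec3.
- by rewrite /B /E cc1 ss1.
- rewrite derive1_vec3// derive1_ss derive1_cc; apply/eqP => h.
  have := congr1 (fun M : R3 => M 0 1) h; have := congr1 (fun M : R3 => M 0 0) h.
  have := cos2Dsin2 (2 * pi * t).
  rewrite /= !mxE /= => n1 /eqP; rewrite mulNr oppr_eq0 mulf_eq0 twopi_neq0 /=.
  move=> /eqP s0 /eqP; rewrite mulf_eq0 twopi_neq0 => /eqP c0.
  by move: n1; rewrite s0 c0 expr0n addr0 => /eqP; rewrite eq_sym oner_eq0.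
- move=> h; have := congr1 (fun M : R3 => M 0 1) h.
  have := congr1 (fun M : R3 => M 0 0) h.
  by rewrite /= !mxE /= => hc hs; exact: cs_eqZ.
Qed.

Lemma tnabla1 : tnabla nabla 1 = 1.
Proof.
have [CA _ CB] := smooth_AEB.
have CA2 : smooth (fun p : R * R => A p.2) by exact: (smooth_comp CA (@smooth_snd _ _ _)).
have CB2 : smooth (fun p : R * R => B p.2) by exact: (smooth_comp CB (@smooth_snd _ _ _)).
have Cc := smooth_cc (@smooth_snd R R R); have Cs := smooth_ss (@smooth_snd R R R).
have Cu : smooth (fun p : R * R => 1 - p.1).
  by apply: smoothB; [exact: smooth_cst|exact: smooth_fst].
have h0 : 0 <= (0 : R) <= 1 by rewrite lexx ler01.
have h1 : 0 <= (1 : R) <= 1 by rewrite lexx ler01.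
rewrite -(tnablaE hnabla (b := false) (a := 0) (L := Link (stage1_link h0))); last first.
- by apply/funext => j; apply/funext => t; rewrite /closed_braid once_twisted /=
    subr0 mul1r mul0r addr0.
- by rewrite /even_twist mulr1 cospi eqNr oner_eq0.
rewrite (@nabla_circle (fun u t => vec3 ((1 - u) * A t + u * cc t) (ss t) (B t)) _
  (Link (stage1_link h1)))//; last 2 first.
- apply: smooth_vec3 => //; apply: smoothD; first exact: smoothM.
  by apply: smoothM => //; exact: smooth_fst.
- exact: stage1_link.
rewrite (@nabla_circle (fun u t => vec3 (cc t) (ss t) ((1 - u) * B t)) _
  (Link (stage2_link 1)))//; last 3 first.
- by apply: smooth_vec3 => //; exact: smoothM.
- by move=> u _; exact: stage2_link.
- by apply/funext => j; apply/funext => t /=; rewrite subrr subr0 mul0r add0r !mul1r.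
have [_ unk _] := hnabla; apply: unk.
by apply/funext => t /=; rewrite subrr mul0r.
Qed.

End Unknot.

(** * The value on the cycle and nontriviality *)

Section ConwayValues.
Variable R : realType.
Local Notation R3 := 'rV[R]_3.
Variable nabla : forall r : nat, link R r -> {poly int}.
Hypothesis hnabla : conway_polynomial nabla.

Lemma extend_isK d N m (x : cube R CK0 N) : parity R m N -> isK m x ->
  extend (conway_coef nabla d) x = (('X ^+ N * tnabla nabla m)`_d)%:~R.
Proof.
elim: N m x => [|N IH] m x mN Kx.
  (* For N = 0 the parity condition makes [m] odd, so the strands form one component. *)
  have ev : even_twist R m = false.
    by rewrite /even_twist mN expr0 eqNr oner_eq0.
  have [a [z [_ rx]]] := Kx; have dw0 := dirfield_uvec m a; rewrite ev in dw0.
  have Pz1 : mul2 (Pz z) (uvec m a) = uvec m a.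
    by apply/funext => t; rewrite /mul2 /Pz big_ord0 !mul1r -surjective_pairing.
  rewrite Pz1 in rx.
  rewrite expr0 mul1r -(tnablaE hnabla (a := a) (L := braid_link dw0))//.
  by rewrite /= /conway_coef (nabla_rep hnabla rx (L := braid_link dw0)).
have [y xy] := face_exists (c := CK0) ord0 true x.
have [y' xy'] := face_exists (c := CK0) ord0 false x.
have mS s := parity_shift s mN.
rewrite (extend_face _ xy xy') (IH _ _ (mS true) (isK_face mN Kx xy)).
rewrite (IH _ _ (mS false) (isK_face mN Kx xy')) -rmorphB -coefB -mulrBr.
by rewrite tnabla_skein// mulrA -exprSr.
Qed.

Lemma conway_isK N (x : cube R CK0 N.*2) : isK 1 x ->
  extend (conway_coef nabla N.*2) x = 1.
Proof.
move=> Kx; rewrite (extend_isK _ _ Kx); last first.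
  by rewrite /parity mulr1 cospi -signr_odd odd_double expr0.
by rewrite tnabla1// mulr1 coefXn eqxx.
Qed.

Lemma nontrivial_conway c n (v : X0 R 0 -> rat) : vassiliev n.*2 v ->
  from_conway nabla n.*2 v ->
  nontrivial_class (@cube_face R c) (@vassiliev_cochain R c n.*2 v).
Proof.
move=> hv hC; split; [exact: vassiliev_rel_cochain|exact: vassiliev_cocycle|].
have [x Kx] : exists x : cube R c n.*2, isK 1 x.
  apply: isK_exists.
  by rewrite /parity mulr1 cospi -signr_odd odd_double expr0.
have fx : vassiliev_cochain v (<< x >> : chain (cube R c) _) = 1.
  by rewrite /vassiliev_cochain /cochain_of fgliftU hC conway_isK//; exact: isK_forget.
(* In degree 0 a coboundary is zero, which the value 1 on a single knot excludes. In positive degree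
   the cube is a cycle. *)
case: n hv hC x Kx fx => [|n] hv hC x Kx fx /=.
  by move=> /(_ << x >>); rewrite fx => /eqP; rewrite oner_eq0.
move=> [g [sg _] /(_ << x >>)]; rewrite fx /= boundary_isK// => h.
have g0 : g 0 = 0 by have := sg (-1) 0 0; rewrite scaler0 addr0 mulN1r addNr.
by move/eqP: h; rewrite g0 oner_eq0.
Qed.

End ConwayValues.

Theorem corollary5p21 (R : realType)
    (nabla : forall r : nat, link R r -> {poly int})
    (hnabla : conway_polynomial nabla)
    (c : cube_complex) (n : nat) (v : X0 R 0 -> rat)
    (hv : vassiliev (2 * n) v) (hC : from_conway nabla (2 * n) v) :
  nontrivial_class (@cube_face R c) (@vassiliev_cochain R c (2 * n) v).
Proof.
by move: hv hC; rewrite mul2n; exact: nontrivial_conway.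
Qed.
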